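(* Let $0<\alpha<1$, $T>0$, $I=(0,T)$, $\lambda\ge0$, and let $f\in H^{r}_{\omega^{\alpha,0}}(I)\cap H^{-\frac{\alpha}{2}}(I)$ with $r\ge-\alpha$. For $N\in\mathbb{N}$ let $V_N=P_N(I)$ be the space of algebraic polynomials of degree at most $N$ on $I$ and $U_N=\{t^{\alpha}v: v\in V_N\}$. Define $b(u,v)=(u,{}_{t}D_T^{\alpha}(\omega^{\alpha,0}v))+\lambda(u,v)_{\omega^{\alpha,0}}$. Then for all sufficiently large $N$ there exists a unique $u_N\in U_N$ satisfying $$b(u_N,v_N)=\langle f,v_N\rangle_{\omega^{\alpha,0}}\qquad\forall v_N\in V_N,$$ and $$\|u_N\|_{\omega^{0,-\alpha}}\le C\|f\|_{H^{-\alpha}_{\omega^{\alpha,0}}}$$ with $C$ independent of $N$ and $f$. Moreover, suppose $u\in L^2_{\omega^{0,-\alpha}}(I)$ solves $$b(u,v)=\langle f,v\rangle_{\omega^{\alpha,0}}\qquad\forall v\in H^{\alpha}_{\omega^{\alpha,0}}(I).$$ Then, for sufficiently large $N$, $$\|u-u_N\|_{\omega^{0,-\alpha}}\le CN^{-m}\|f\|_{H^{r}_{\omega^{\alpha,0}}}$$ with $C$ independent of $N$, where $m$ is the regularity index of $\omega^{0,-\alpha}u$, i.e. $\omega^{0,-\alpha}u\in H^{m}_{\omega^{0,\alpha}}(I)$.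
   Context: Weights and spaces. $\omega^{\gamma,\beta}(x)=(T-x)^{\gamma}x^{\beta}$; in particular $\omega^{0,-\alpha}u$ is $t\mapsto t^{-\alpha}u(t)$. For $\gamma,\beta>-1$, $L^2_{\omega^{\gamma,\beta}}(I)=\{v:\int_I\omega^{\gamma,\beta}v^2dx<\infty\}$ with inner product $(u,v)_{\omega^{\gamma,\beta}}=\int_Iuv\,\omega^{\gamma,\beta}dx$ and norm $\|\cdot\|_{\omega^{\gamma,\beta}}$; $(\cdot,\cdot)$ is the $L^2(I)$ product. For an integer $s\ge0$, $H^s_{\omega^{\gamma,\beta}}(I)=\{v:D^kv\in L^2_{\omega^{\gamma+k,\beta+k}}(I),\ k=0,\dots,s\}$ with norm $\big(\sum_{k=0}^s\|D^kv\|^2_{\omega^{\gamma+k,\beta+k}}\big)^{1/2}$; for real $s>0$ it is defined by the K-method of interpolation, and for $s<0$ by duality with respect to $L^2_{\omega^{\gamma,\beta}}(I)$. For every real $s$ the norm is equivalent to $\big(\sum_{n\ge0}(v_n)^2h_n^{\gamma,\beta}(1+n^2)^s\big)^{1/2}$, where $Q_n^{\gamma,\beta}(t)=P_n^{\gamma,\beta}(\frac{2t}{T}-1)$ is the shifted classical Jacobi polynomial, $h_n^{\gamma,\beta}=\|Q_n^{\gamma,\beta}\|^2_{\omega^{\gamma,\beta}}$, and $v_n=\frac{1}{h_n^{\gamma,\beta}}\int_I vQ_n^{\gamma,\beta}\omega^{\gamma,\beta}dx$. $\langle\cdot,\cdot\rangle_{\omega^{\gamma,\beta}}$ is the $L^2_{\omega^{\gamma,\beta}}$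 duality pairing of $H^{-\mu}_{\omega^{\gamma,\beta}}(I)$ and $H^{\mu}_{\omega^{\gamma,\beta}}(I)$, $\mu\ge0$. $H^{-\alpha/2}(I)$ is the ordinary fractional Sobolev space of negative order, defined by $L^2$ duality. Fractional derivative. ${}_{t}D_T^{\alpha}w=-{}_{t}I_T^{1-\alpha}(w')$ is the right Caputo derivative, with ${}_{t}I_T^{\mu}w(t)=\frac{1}{\Gamma(\mu)}\int_t^T\frac{w(s)}{(s-t)^{1-\mu}}ds$. It satisfies ${}_{t}D_T^{\alpha}(\omega^{\alpha,0}Q_n^{\alpha,0})=\frac{\Gamma(n+\alpha+1)}{\Gamma(n+1)}Q_n^{0,\alpha}$, and $v\mapsto{}_{t}D_T^{\alpha}(\omega^{\alpha,0}v)$ is understood on $H^{\alpha}_{\omega^{\alpha,0}}(I)$ through Jacobi expansion, as a continuous map into $L^2_{\omega^{0,\alpha}}(I)$. ''Regularity index'' $m\geq 0$ of a function in the scale $H^{s}_{\omega^{0,\alpha}}(I)$ means that the function belongs to $H^{m}_{\omega^{0,\alpha}}(I)$. $C$ denotes generic constants independent of the truncation number $N$. *)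

(* Defs.v *)
From HB Require Import structures.
From mathcomp Require Import all_boot all_order all_algebra.
From mathcomp Require Import all_classical all_reals all_analysis.
Import Order.TTheory GRing.Theory Num.Theory numFieldNormedType.Exports.

Set Implicit Arguments.
Unset Strict Implicit.
Unset Printing Implicit Defensive.

Local Open Scope classical_set_scope.
Local Open Scope ring_scope.

(* Functions on I = (0, T) (dom T below) are represented by total functions R -> R, whose
   values outside I are irrelevant in all the norms and integrals below. *)

Section Defs.
Variable R : realType.
Local Notation mu := (@lebesgue_measure R).
Implicit Types (T s theta : R) (k n N : nat) (u v w g phi : R -> R)
  (f F : (R -> R) -> R).

Definition dom T : set R := `]0, T[.

Definition omega T (gamma beta : R) (x : R) : R :=
  (T - x) `^ gamma * x `^ beta.

Definition inner T u v : R := \int[mu]_(x in dom T) (u x * v x).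

Definition winner T (gamma beta : R) u v : R :=
  \int[mu]_(x in dom T) (u x * v x * omega T gamma beta x).

Definition wnorm T (gamma beta : R) v : \bar R :=
  (sqrte (\int[mu]_(x in dom T) (omega T gamma beta x * v x ^+ 2)%:E))%E.

Definition wL2 T (gamma beta : R) : set (R -> R) :=
  [set v | measurable_fun (dom T) v /\ (wnorm T gamma beta v < +oo)%E].

(* Compactly supported functions on I of class C^n. *)
Definition Cc T n : set (R -> R) :=
  [set phi | [/\ forall i, (i < n)%N -> forall x, derivable (derive1n i phi) x 1,
                 continuous (derive1n n phi) &
                 exists a b : R, [/\ 0 < a, b < T &
                   forall x, x \notin `[a, b] -> phi x = 0]]].

Definition Cc_infty T : set (R -> R) := [set phi | forall n, Cc T n phi].

(* Order-one weak derivatives may equivalently be tested against C_c^1 or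
   C_c^infty functions. *)
Definition weak_derivative T v g : Prop :=
  [/\ locally_integrable (dom T) v, locally_integrable (dom T) g &
      forall phi, Cc T 1 phi ->
        \int[mu]_(x in dom T) (v x * derive1 phi x) =
        - \int[mu]_(x in dom T) (g x * phi x)].

(* Norm of H^k, k a natural number; the family D lists the successive weak
   derivatives of v.  Such a family is unique up to a.e. equality, so all
   elements of the set are equal; the infimum is +oo if there is none. *)
Definition Hnat_norm T (gamma beta : R) k v : \bar R :=
  ereal_inf [set (sqrte (\sum_(j < k.+1)
      wnorm T (gamma + j%:R)%R (beta + j%:R)%R (D j) ^+ 2))%E
    | D in [set D : nat -> R -> R |
        [/\ D 0%N = v,
            forall j, (j < k)%N -> weak_derivative T (D j) (D j.+1) &
            forall j, (j <= k)%N -> measurable_fun (dom T) (D j)]]].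

(* Peetre's K-functional of the couple (H^k, H^(k+1)). *)
Definition Kfun T (gamma beta : R) k (t : R) v : \bar R :=
  ereal_inf [set (Hnat_norm T gamma beta k (v \- v1)%R +
                  t%:E * Hnat_norm T gamma beta k.+1 v1)%E
    | v1 in [set: R -> R]].

(* Norm of H^s for s >= 0: (H^k, H^(k+1))_(theta, 2) if s = k + theta with
   0 < theta < 1. *)
Definition Hs_norm T (gamma beta : R) s v : \bar R :=
  let k := Num.truncn s in
  let theta := s - k%:R in
  if theta == 0 then Hnat_norm T gamma beta k v
  else (sqrte (\int[mu]_(t in `]0%R, +oo[)
          ((t `^ (- (2 * theta) - 1))%:E * Kfun T gamma beta k t v ^+ 2)))%E.

Definition Hs T (gamma beta : R) s : set (R -> R) :=
  [set v | (Hs_norm T gamma beta s v < +oo)%E].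

Definition linear_on (D : set (R -> R)) f : Prop :=
  forall (a : R) u v, D u -> D v -> f (fun x => a * u x + v x) = a * f u + f v.

(* An element f of H^r is represented, for every sign of r, by the functional
   v |-> <f, v>_omega.  Its domain is H^(-r) if r < 0 and L^2_omega if r >= 0,
   in which case the functional is integration against a function of H^r. *)
Definition represents T (gamma beta : R) g f : Prop :=
  measurable_fun (dom T) g /\
  forall v, wL2 T gamma beta v -> f v = winner T gamma beta g v.

Definition Hr_norm T (gamma beta : R) (r : R) f : \bar R :=
  if r < 0 then
    ereal_sup [set `|f v|%:E
              | v in [set v | (Hs_norm T gamma beta (- r)%R v <= 1)%E]]
  else
    ereal_inf [set Hs_norm T gamma beta r g
              | g in [set g | represents T gamma beta g f]].

Definition in_Hr T (gamma beta : R) (r : R) f : Prop :=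
  (r < 0 -> linear_on (Hs T gamma beta (- r)) f) /\
  (Hr_norm T gamma beta r f < +oo)%E.

(* The ordinary (Sobolev-Slobodeckij) space H^s(I), 0 < s < 1, and its dual. *)
Definition slobodeckij_norm T s v : \bar R :=
  (sqrte (\int[mu]_(x in dom T) (v x ^+ 2)%:E +
          \int[mu]_(x in dom T) \int[mu]_(y in dom T)
            ((v x - v y) ^+ 2 / `|x - y| `^ (1 + 2 * s))%:E))%E.

Definition slobodeckij T s : set (R -> R) :=
  [set v | measurable_fun (dom T) v /\ (slobodeckij_norm T s v < +oo)%E].

(* A functional f acting through <f, .>_omega is, as a distribution on I,
   phi |-> f (omega^-1 phi).  It belongs to H^(-s)(I) if this distribution is
   the restriction of a bounded linear functional on H^s(I). *)
Definition in_Hminus T (gamma beta s : R) f : Prop :=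
  exists F, [/\ linear_on (slobodeckij T s) F,
    exists M : R, forall v, slobodeckij T s v ->
      (`|F v|%:E <= M%:E * slobodeckij_norm T s v)%E &
    forall phi, Cc_infty T phi ->
      F phi = f (fun x => phi x / omega T gamma beta x)].

Definition gbinom (a : R) k : R := (\prod_(i < k) (a - i%:R)) / k`!%:R.

(* Classical Jacobi polynomials, orthogonal on (-1, 1) for the weight
   (1 - x)^a (1 + x)^b. *)
Definition jacobi (a b : R) n : {poly R} :=
  \sum_(i < n.+1) (gbinom (n%:R + a) (n - i) * gbinom (n%:R + b) i) *:
     ((2^-1 *: ('X - 1)) ^+ i * (2^-1 *: ('X + 1)) ^+ (n - i)).

Definition Qjac T (gamma beta : R) n (t : R) : R :=
  (jacobi gamma beta n).[2 * t / T - 1].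

Definition jacobi_coef T (gamma beta : R) v n : R :=
  winner T gamma beta v (Qjac T gamma beta n) /
  winner T gamma beta (Qjac T gamma beta n) (Qjac T gamma beta n).

Definition Gamma (z : R) : R :=
  \int[mu]_(t in `]0, +oo[) (t `^ (z - 1) * expR (- t)).

Definition right_integral T (m : R) w (t : R) : R :=
  (Gamma m)^-1 * \int[mu]_(s in `]t, T[) (w s / (s - t) `^ (1 - m)).

Definition right_caputo T (alpha : R) w (t : R) : R :=
  - right_integral T (1 - alpha) (derive1 w) t.

(* v |-> D_T^alpha (omega^(alpha, 0) v), through the Jacobi expansion of v: the
   limit in L^2_omega^(0, alpha) of the images of the partial sums. *)
Definition caputo_partial T (alpha : R) v N (t : R) : R :=
  \sum_(n < N) jacobi_coef T alpha 0 v n *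
     right_caputo T alpha
       (fun s => omega T alpha 0 s * Qjac T alpha 0 n s) t.

Definition caputo_weighted T (alpha : R) v : R -> R :=
  xget (cst 0) [set g | wL2 T 0 alpha g /\
    (fun N => wnorm T 0 alpha (g \- caputo_partial T alpha v N)) @ \oo
      --> 0%E].

Definition bform T (alpha lambda : R) u v : R :=
  inner T u (caputo_weighted T alpha v) + lambda * winner T alpha 0 u v.

Definition VN N : set (R -> R) :=
  [set v | exists p : {poly R}, (size p <= N.+1)%N /\ v = horner p].

Definition UN (alpha : R) N : set (R -> R) :=
  [set u | exists2 v, VN N v & u = (fun t => t `^ alpha * v t)].

Definition discrete_solution T (alpha lambda : R) f N (uN : R -> R) : Prop :=
  UN alpha N uN /\
  forall vN, VN N vN -> bform T alpha lambda uN vN = f vN.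

Definition weak_solution T (alpha lambda : R) f u : Prop :=
  wL2 T 0 (- alpha) u /\
  forall v, Hs T alpha 0 alpha v -> bform T alpha lambda u v = f v.

End Defs.

(* Main.v *)
(* Write u = t^alpha P.  On polynomials v the operator v |-> D_T^alpha(omega^(alpha,0) v) is a
   polynomial operator S, diagonal in the powers of T - t, and
   b(u, v) = <P, S v> + lambda <P, omega^(alpha,0) v> in L^2_omega^(0,alpha).  The crux is that
   <S v, omega^(alpha,0) v> >= 0: in the monomial coefficients of S v it is a quadratic form
   whose matrix is a Hadamard product of Gram matrices, by a partial fraction expansion of a
   quotient of Gamma functions.  Hence b(t^alpha S v, v) >= |S v|^2, and as S is bijective on
   polynomials of degree at most N the discrete problem is uniformly coercive for every N:
   this gives existence, uniqueness, stability and quasi-best approximation without any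
   compactness argument.  S maps the Jacobi basis to an orthogonal family with |S Q_n| growing
   like n^alpha |Q_n|, so that |S v| dominates the H^alpha norm of v; this turns the bound of
   f in H^(-alpha) into a bound of the discrete solution.  The rate comes from Jackson's
   estimate, obtained from the Sturm-Liouville equation of Jacobi polynomials, combined with
   the splittings that define the K-functional. *)

Require Import Defs.
From HB Require Import structures.
From mathcomp Require Import all_boot all_order all_algebra.
From mathcomp Require Import all_classical all_reals all_analysis.
From mathcomp Require Import measurable_realfun.
From mathcomp Require Import ring lra.
Import Order.TTheory GRing.Theory Num.Theory numFieldNormedType.Exports.

Local Open Scope classical_set_scope.
Local Open Scope ring_scope.

Set Implicit Arguments.
Unset Strict Implicit.
Unset Printing Implicit Defensive.

(** * Integration on open intervals and the Beta function *)

(** The form [<S v, omega^(alpha,0) v>] carries the weight [t^alpha (T - t)^alpha], for which [S] is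
    not symmetric, so that its sign is not apparent. The factor [(T - t)^alpha] can be traded for
    [S]: the product of [t^i] and [v] for that weight is [b_i] times the product of [t^i] and [S v]
    for the weight [t^(2 alpha)], where [b_i = Gamma(alpha + i + 1) / Gamma(2 alpha + i + 1)]. With
    [q_i] the coefficients of [S v], this leaves [sum q_i q_j b_i / (2 alpha + i + j + 1)] up to
    powers of [T]. Now [b_i] is a limit of nonnegative combinations of [1] and of the
    [1 / (alpha + i + 1 + k)], and symmetrising the latter in [i] and [j] yields the numerator
    [(2 alpha + i + j + 1) + (1 + 2 k)]: its first part cancels the denominator and leaves a square.
    The interpolation norms are never computed; one-sided bounds suffice. An explicit splitting of a
    polynomial bounds its norm from above, for the dual norm of [f]; a near-optimal splitting of
    [omega^(0,-alpha) u] is approximated part by part, for the rate. *)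

Section real_integrals.
Variable R : realType.
Local Notation mu := (@lebesgue_measure R).
Variables (D : set R).
Hypothesis mD : measurable (D : set (measurableTypeR R)).
Implicit Types f g : R -> R.

Definition intg f := mu.-integrable D (EFin \o f).

Lemma intg_measurable f : intg f -> measurable_fun D f.
Proof. by move=> /integrableP[/measurable_EFinP]. Qed.

Lemma intg0 : intg (fun=> 0).
Proof. by apply: integrable0; exact: mD. Qed.

Lemma intgD f g : intg f -> intg g -> intg (fun x => f x + g x).
Proof. by move=> fi gi; exact: (integrableD mD fi gi). Qed.

Lemma intgB f g : intg f -> intg g -> intg (fun x => f x - g x).
Proof. by move=> fi gi; exact: (integrableB mD fi gi). Qed.

Lemma intgZ k f : intg f -> intg (fun x => k * f x).
Proof. by move=> fi; exact: (integrableZl mD k fi). Qed.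

Lemma intg_norm f : intg f -> intg (fun x => `|f x|).
Proof. exact: integrable_norm. Qed.

Lemma intg_le f g : measurable_fun D f -> (forall x, D x -> `|f x| <= g x) ->
  intg g -> intg f.
Proof.
move=> mf fg gi; apply: (le_integrable mD _ _ gi); first exact/measurable_EFinP.
move=> x Dx; rewrite lee_fin; apply: le_trans (fg _ Dx) _; exact: ler_norm.
Qed.

Lemma intg_eq f g : (forall x, D x -> f x = g x) -> intg f -> intg g.
Proof.
move=> fg; apply: (eq_integrable mD) => x; rewrite inE => Dx /=.
by rewrite fg.
Qed.

Lemma intg_sum (I : Type) (r : seq I) (F : I -> R -> R) :
  (forall i, intg (F i)) -> intg (fun x => \sum_(i <- r) F i x).
Proof.
move=> Fi; elim: r => [|i r IH].
  apply: (@intg_eq (fun=> 0)); last exact: intg0.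
  by move=> x _; rewrite big_nil.
apply: (@intg_eq (fun x => F i x + \sum_(j <- r) F j x)); last exact: intgD.
by move=> x _; rewrite big_cons.
Qed.

Lemma Rint_eq f g : (forall x, D x -> f x = g x) ->
  \int[mu]_(x in D) f x = \int[mu]_(x in D) g x.
Proof. by move=> fg; apply: eq_Rintegral => x; rewrite inE; exact: fg. Qed.

Lemma RintD f g : intg f -> intg g ->
  \int[mu]_(x in D) (f x + g x) = \int[mu]_(x in D) f x + \int[mu]_(x in D) g x.
Proof. by move=> fi gi; exact: (RintegralD mD fi gi). Qed.

Lemma RintB f g : intg f -> intg g ->
  \int[mu]_(x in D) (f x - g x) = \int[mu]_(x in D) f x - \int[mu]_(x in D) g x.
Proof. by move=> fi gi; exact: (RintegralB mD fi gi). Qed.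

Lemma RintZ k f : intg f ->
  \int[mu]_(x in D) (k * f x) = k * \int[mu]_(x in D) f x.
Proof. by move=> fi; exact: (RintegralZl k mD fi). Qed.

Lemma Rint_sum (I : Type) (r : seq I) (F : I -> R -> R) :
  (forall i, intg (F i)) ->
  \int[mu]_(x in D) (\sum_(i <- r) F i x) = \sum_(i <- r) \int[mu]_(x in D) F i x.
Proof.
move=> Fi; elim: r => [|i r IH].
  rewrite big_nil -[RHS](mul0r (\int[mu]_(x in D) (fun=> 0) x)).
  rewrite -(RintZ _ intg0); apply: Rint_eq => x _.
  by rewrite big_nil mulr0.
rewrite big_cons -IH -RintD //; last exact: intg_sum.
by apply: Rint_eq => x _; rewrite big_cons.
Qed.

Lemma Rint_le f g : intg f -> intg g -> (forall x, D x -> f x <= g x) ->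
  \int[mu]_(x in D) f x <= \int[mu]_(x in D) g x.
Proof. by move=> fi gi fg; exact: (le_Rintegral mD fi gi fg). Qed.

Lemma Rint_ge0 f : (forall x, D x -> 0 <= f x) -> 0 <= \int[mu]_(x in D) f x.
Proof. by move=> f0; rewrite /Rintegral fine_ge0 // integral_ge0 // => x Dx; rewrite lee_fin f0. Qed.

Lemma Rint_EFin f : intg f ->
  (\int[mu]_(x in D) (f x)%:E)%E = (\int[mu]_(x in D) f x)%:E.
Proof.
move=> fi; have finn : (\int[mu]_(x in D) (f x)%:E)%E \is a fin_num.
  exact: (integrable_fin_num mD fi).
by rewrite -(fineK finn).
Qed.

Lemma ge0_intg f : measurable_fun D f -> (forall x, D x -> 0 <= f x) ->
  (\int[mu]_(x in D) (f x)%:E < +oo)%E -> intg f.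
Proof.
move=> mf f0 fi; apply/integrableP; split; first exact/measurable_EFinP.
move: fi; congr (_ < _)%E; apply: eq_integral => x; rewrite inE => Dx /=.
by rewrite ger0_norm // f0.
Qed.

Lemma Rint_dominated (f_ : nat -> R -> R) f g :
  (forall n, measurable_fun D (f_ n)) -> measurable_fun D f -> intg g ->
  (forall x, D x -> f_ n x @[n --> \oo] --> f x) ->
  (forall n x, D x -> `|f_ n x| <= g x) ->
  \int[mu]_(x in D) f_ n x @[n --> \oo] --> \int[mu]_(x in D) f x.
Proof.
move=> mf_ mf gi cf fg.
have fni n : intg (f_ n) by apply: intg_le (fg n) gi.
have fi : intg f.
  apply: (intg_le mf _ gi) => x Dx.
  have cn : `|f_ n x| @[n --> \oo] --> `|f x| by apply: cvg_norm; exact: cf.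
  rewrite -(cvg_lim (@Rhausdorff R) cn); apply: limr_le; first exact: cvgP cn.
  by apply: nearW => n; exact: fg.
have [|||||_ _] := @dominated_convergence _ _ R mu D mD
  (fun n x => (f_ n x)%:E) (fun x => (f x)%:E) (fun x => (g x)%:E).
- by move=> n; apply/measurable_EFinP; exact: mf_.
- exact/measurable_EFinP.
- by apply: aeW => x Dx; apply/fine_cvgP; split; [exact: nearW|exact: cf].
- exact: gi.
- by apply: aeW => x n Dx; rewrite lee_fin; exact: fg.
rewrite Rint_EFin // => /fine_cvgP[_]; apply: cvg_trans; apply: near_eq_cvg.
by apply: nearW => n /=; rewrite Rint_EFin.
Qed.

End real_integrals.

(** * The fundamental theorem of calculus with endpoint singularities *)

Section FTC_open.
Variable R : realType.
Local Notation mu := (@lebesgue_measure R).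
Implicit Types (a b c : R) (f F : R -> R).

Lemma continuous_oo_measurable a b f :
  {in `]a, b[, continuous f} -> measurable_fun `]a, b[ f.
Proof.
move=> cf; apply: subspace_continuous_measurable_fun => //.
by apply: continuous_in_subspaceT => x; rewrite inE/= => xab; exact: cf.
Qed.

Lemma integrable_oo_cc a b f :
  mu.-integrable `]a, b[ (EFin \o f) -> mu.-integrable `[a, b] (EFin \o f).
Proof.
move=> /integrableP[mf foo]; apply/integrableP; split.
  exact: emeasurable_fun_itv_cc mf.
rewrite integral_itv_bndoo //; exact: measurableT_comp.
Qed.

Lemma const_on_itv a b F : a < b -> {within `[a, b], continuous F} ->
  (forall x, x \in `]a, b[ -> is_derive x 1 F 0) -> F b = F a.
Proof.
move=> ab cF dF.
have [c _] := @MVT _ F (fun=> 0) _ _ ab dF cF.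
by rewrite mul0r => /eqP; rewrite subr_eq0 => /eqP.
Qed.

(** [F] and the indefinite integral of [f] are both continuous up to the endpoints and have
    derivative [f] inside, so they differ by a constant. [f] itself may blow up at [a] and [b], as
    the weights do. *)
Lemma Rintegral_oo_FTC a b f F : a < b -> {within `[a, b], continuous F} ->
  (forall x, x \in `]a, b[ -> is_derive x 1 F (f x)) ->
  {in `]a, b[, continuous f} -> mu.-integrable `]a, b[ (EFin \o f) ->
  \int[mu]_(x in `]a, b[) f x = F b - F a.
Proof.
move=> ab cF dF cf intf.
have intfcc := integrable_oo_cc intf.
pose G := (parameterized_integral mu a)^~ f.
have cG : {within `[a, b], continuous G}.
  by apply: parameterized_integral_continuous => //; exact: ltW.
have dG x : x \in `]a, b[ -> is_derive x 1 G (f x).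
  move=> xab.
  have [] := @continuous_FTC1 R f (BLeft a) x b.
  - by move: xab; rewrite in_itv/= => /andP[].
  - exact: intfcc.
  - move: xab; rewrite in_itv/= => /andP[ax xb]. by rewrite lte_fin.
  - exact: cf.
  move=> dG <-; rewrite derive1E; exact/derivableP.
have : (F - G) b = (F - G) a.
  apply: const_on_itv => //.
  - by move=> x; apply: cvgB; [exact: cF|exact: cG].
  - move=> x xab; have := dF _ xab; have := dG _ xab => ? ?.
    by rewrite -(subrr (f x)); apply: is_deriveB.
rewrite !fctE /G /parameterized_integral set_itv1 Rintegral_set1 subr0.
move=> <-; rewrite opprB addrC subrK.
by rewrite /Rintegral [in RHS]integral_itv_bndoo //; case/integrableP: intf.
Qed.

(** On compact subintervals exhausting []a, b[] the integral of [f] is an increment of [F], hence at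
    most twice a bound of [|F|]; monotone convergence passes to the whole interval. *)
Lemma ge0_oo_FTC_integrable a b f F : a < b -> {within `[a, b], continuous F} ->
  (forall x, x \in `]a, b[ -> is_derive x 1 F (f x)) ->
  {in `]a, b[, continuous f} -> {in `]a, b[, forall x, 0 <= f x} ->
  mu.-integrable `]a, b[ (EFin \o f).
Proof.
move=> ab cF dF cf f0.
have mf := continuous_oo_measurable cf.
apply/integrableP; split; first exact/measurable_EFinP.
have [M [_ MF]] : bounded_set (F @` `[a, b]).
  apply: compact_bounded; apply: continuous_compact => //.
  exact: segment_compact.
have {}MF x : x \in `[a, b] -> `|F x| <= M + 1.
  by move=> xab; apply: (MF (M + 1)); [rewrite ltrDl|exists x].
(* [n + 3] keeps [e n] below half the length, so that the truncated interval is never empty. *)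
pose e n := (b - a) / n.+3%:R.
have e0 n : 0 < e n by rewrite divr_gt0 // subr_gt0.
have eab n : e n < (b - a) / 2.
  by rewrite ltr_pM2l ?subr_gt0 // ltf_pV2 ?posrE // ltr_nat.
have en n m : (n <= m)%N -> e m <= e n.
  by move=> nm; rewrite ler_pM2l ?subr_gt0 // lef_pV2 ?posrE // ler_nat !ltnS.
pose E n : set R := `]a + e n, b - e n[%classic.
have EE n : E n = `]a + e n, b - e n[%classic by [].
have EU : \bigcup_n E n = `]a, b[%classic.
  apply/seteqP; split => [x [n _]|x]; rewrite /E /= !in_itv/= => /andP[ax xb].
    by have := e0 n; lra.
  have d0 : 0 < Num.min (x - a) (b - x) by rewrite lt_min !subr_gt0 ax xb.
  pose n := Num.truncn ((b - a) / Num.min (x - a) (b - x)).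
  have en1 : e n < Num.min (x - a) (b - x).
    rewrite ltr_pdivrMr // mulrC -ltr_pdivrMr //.
    apply: (@lt_le_trans _ _ n.+1%:R); last by rewrite ler_nat -[n.+3]addn2 leq_addr.
    exact: truncnS_gt.
  exists n => //; rewrite /= in_itv/=; move: en1; rewrite lt_min; lra.
have mE n : measurable (E n) by exact: measurable_itv.
have Esub n : E n `<=` `]a, b[%classic by rewrite -EU; exact: bigcup_sup.
rewrite -EU.
have -> : (\int[mu]_(x in \bigcup_n E n) `|(EFin \o f) x| =
           \int[mu]_(x in \bigcup_n E n) (f x)%:E)%E.
  apply: eq_integral => x; rewrite inE EU/= => xab.
  by rewrite ger0_norm // f0.
have cvgE : ((\int[mu]_(x in E n) (f x)%:E)%E @[n --> \oo] -->
    (\int[mu]_(x in \bigcup_n E n) (f x)%:E)%E).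
  apply: ge0_nondecreasing_set_cvg_integral.
  - move=> m n mn; apply/subsetPset => x; rewrite /E/= !in_itv/=.
    by have := en m n mn; lra.
  - by move=> i; exact: measurable_itv.
  - by move=> i; apply/measurable_EFinP; apply: measurable_funS mf.
  - by move=> i x /Esub xab; rewrite lee_fin; exact: f0.
rewrite -(cvg_lim _ cvgE) //.
apply: (@le_lt_trans _ _ (2 * (M + 1))%:E); last exact: ltry.
apply: lime_le.
  apply: ereal_nondecreasing_is_cvgn => m n mn.
  apply: ge0_subset_integral; [exact: mE|exact: mE| | |].
  + by apply/measurable_EFinP; apply: measurable_funS mf.
  + by move=> x /Esub xab; rewrite lee_fin; exact: f0.
  + move=> x; rewrite /E/= !in_itv/=; have := en m n mn; lra.
apply: nearW => n.
have abn : a + e n < b - e n by have := eab n; lra.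
have sub : `[a + e n, b - e n]%classic `<=` `]a, b[%classic.
  by move=> x; rewrite /= !in_itv/=; have := e0 n; lra.
have sub' : `[a + e n, b - e n]%classic `<=` `[a, b]%classic.
  by move=> x /sub; rewrite /= !in_itv/= => /andP[/ltW -> /ltW ->].
have fint0 : mu.-integrable `[a + e n, b - e n] (EFin \o f).
  apply: continuous_compact_integrable; first exact: segment_compact.
  by apply: continuous_in_subspaceT => x; rewrite inE => /sub xab; exact: cf.
have fint : mu.-integrable (E n) (EFin \o f).
  apply: integrableS fint0; [exact: measurable_itv|exact: mE|].
  by move=> x; rewrite /E /= !in_itv/= => /andP[/ltW -> /ltW ->].
have finn : (\int[mu]_(x in E n) (f x)%:E)%E \is a fin_num.
  by apply: (integrable_fin_num _ fint); exact: mE.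
rewrite -(fineK finn).
rewrite lee_fin -[X in X <= _]/(\int[mu]_(x in E n) f x).
have -> : \int[mu]_(x in E n) f x = F (b - e n) - F (a + e n).
  have cFn : {within `[a + e n, b - e n], continuous F}.
    exact: continuous_subspaceW cF.
  have Y1 x : x \in `]a + e n, b - e n[ -> is_derive x 1 F (f x).
    by move=> xab; apply: dF; apply: (Esub n).
  have Y2 : {in `]a + e n, b - e n[, continuous f}.
    by move=> x xab; apply: cf; apply: (Esub n).
  exact: (Rintegral_oo_FTC abn cFn Y1 Y2 fint).
rewrite mulrDl mul1r; apply: le_trans (ler_norm _) _.
apply: le_trans (ler_normB _ _) _.
by apply: lerD; apply: MF; rewrite in_itv/=; have := e0 n; lra.
Qed.

End FTC_open.

(** * The Beta integral and its recurrences *)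

Section beta.
Variable R : realType.
Local Notation mu := (@lebesgue_measure R).
Implicit Types (a b x y s t : R).

Lemma measurable_oo a b : measurable (`]a, b[%classic : set (measurableTypeR R)).
Proof. exact: measurable_itv. Qed.

Lemma is_derive_ext (f g : R -> R) s d e :
  is_derive s 1 f d -> f =1 g -> d = e -> is_derive s 1 g e.
Proof. by move=> df /funext <- <-. Qed.

Lemma continuous_norm_powR x : 0 < x -> continuous (fun s => `|s| `^ x).
Proof.
move=> x0 s; have [->|s0] := eqVneq s 0.
  rewrite /continuous_at normr0 powR0 ?gt_eqF //.
  apply/cvgrPdist_lt => e e0; near=> y.
  rewrite sub0r normrN ger0_norm ?powR_ge0 //.
  rewrite -[ltRHS]powRr1 ?(ltW e0) // -(mulVf (lt0r_neq0 x0)) powRrM.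
  apply: gt0_ltr_powR; rewrite ?nnegrE ?powR_ge0 //.
  near: y; apply: (@nbhs0_lt _ R^o); exact: powR_gt0.
apply: (@continuous_comp R R R (fun s => `|s|) (fun y => y `^ x) s).
  exact: norm_continuous.
apply: differentiable_continuous; apply/derivable1_diffP.
by apply: derivable_powR; rewrite in_itv/= andbT normr_gt0.
Unshelve. all: by end_near. Qed.

Lemma within_powRl a b x : 0 < x ->
  {within `[a, b], continuous (fun s => (s - a) `^ x)}.
Proof.
move=> x0; apply: (@subspace_eq_continuous _ _ _ (fun s => `|s - a| `^ x)).
  by move=> s; rewrite inE/= in_itv/= => /andP[asb _]; rewrite ger0_norm ?subr_ge0.
apply: continuous_subspaceT => s.
apply: (@continuous_comp R R R (fun s => s - a) (fun s => `|s| `^ x)).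
  by apply: cvgB; [exact: cvg_id|exact: cvg_cst].
exact: continuous_norm_powR.
Qed.

Lemma within_powRr a b x : 0 < x ->
  {within `[a, b], continuous (fun s => (b - s) `^ x)}.
Proof.
move=> x0; apply: (@subspace_eq_continuous _ _ _ (fun s => `|b - s| `^ x)).
  by move=> s; rewrite inE/= in_itv/= => /andP[_ asb]; rewrite ger0_norm ?subr_ge0.
apply: continuous_subspaceT => s.
apply: (@continuous_comp R R R (fun s => b - s) (fun s => `|s| `^ x)).
  by apply: cvgB; [exact: cvg_cst|exact: cvg_id].
exact: continuous_norm_powR.
Qed.

Lemma is_derive_powRl a x s : a < s ->
  is_derive s 1 (fun s => (s - a) `^ x) (x * (s - a) `^ (x - 1)).
Proof.
move=> sa; have s0 : 0 < s - a by rewrite subr_gt0.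
have d1 : is_derive s 1 (fun s : R => s - a) 1.
  by rewrite -[X in is_derive _ _ _ X]subr0; apply: is_deriveB.
have := @is_derive1_comp R (@powR R ^~ x) (fun s => s - a) s _ _ (is_derive1_powR x s0) d1.
by rewrite mulr1.
Qed.

Lemma is_derive_powRr b x s : s < b ->
  is_derive s 1 (fun s => (b - s) `^ x) (- (x * (b - s) `^ (x - 1))).
Proof.
move=> sa; have s0 : 0 < b - s by rewrite subr_gt0.
have d1 : is_derive s 1 (fun s : R => b - s) (- 1).
  by rewrite -[X in is_derive _ _ _ X]sub0r; apply: is_deriveB.
have := @is_derive1_comp R (@powR R ^~ x) (fun s => b - s) s _ _ (is_derive1_powR x s0) d1.
by rewrite mulrN1.
Qed.

Lemma is_derive_continuous (f : R -> R) s d : is_derive s 1 f d -> {for s, continuous f}.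
Proof. by move=> [df _]; exact/differentiable_continuous/derivable1_diffP. Qed.

Lemma continuous_oo_powRl a b x : {in `]a, b[, continuous (fun s => (s - a) `^ x)}.
Proof.
move=> s; rewrite in_itv/= => /andP[sa _].
exact: is_derive_continuous (is_derive_powRl x sa).
Qed.

Lemma continuous_oo_powRr a b x : {in `]a, b[, continuous (fun s => (b - s) `^ x)}.
Proof.
move=> s; rewrite in_itv/= => /andP[_ sa].
exact: is_derive_continuous (is_derive_powRr x sa).
Qed.

Lemma integrable_powRl a b x : a < b -> 0 < x ->
  intg `]a, b[ (fun s => (s - a) `^ (x - 1)).
Proof.
move=> ab x0.
have dF s : s \in `]a, b[ -> is_derive s 1 (fun s => x^-1 * (s - a) `^ x) ((s - a) `^ (x - 1)).
  rewrite in_itv/= => /andP[sa _].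
  have d := is_derive_powRl x sa.
  apply: (is_derive_ext (is_deriveZ x^-1 d)) => //.
  rewrite -[LHS]/(x^-1 * (x * (s - a) `^ (x - 1))) mulKf // gt_eqF //.
apply: (ge0_oo_FTC_integrable ab _ dF).
- move=> s; apply: (@cvgM _ _ _ _ (cst x^-1)); first exact: cvg_cst.
  exact: within_powRl.
- exact: continuous_oo_powRl.
- by move=> s _; exact: powR_ge0.
Qed.

Lemma integrable_powRr a b x : a < b -> 0 < x ->
  intg `]a, b[ (fun s => (b - s) `^ (x - 1)).
Proof.
move=> ab x0.
have dF s : s \in `]a, b[ -> is_derive s 1 (fun s => - x^-1 * (b - s) `^ x) ((b - s) `^ (x - 1)).
  rewrite in_itv/= => /andP[_ sa].
  have d := is_derive_powRr x sa.
  apply: (is_derive_ext (is_deriveZ (- x^-1) d)) => //.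
  rewrite -[LHS]/(- x^-1 * (- (x * (b - s) `^ (x - 1)))) mulrNN mulKf // gt_eqF //.
apply: (ge0_oo_FTC_integrable ab _ dF).
- move=> s; apply: (@cvgM _ _ _ _ (cst (- x^-1))); first exact: cvg_cst.
  exact: within_powRr.
- exact: continuous_oo_powRr.
- by move=> s _; exact: powR_ge0.
Qed.

(** [bfun] is the Beta integral [(b - a)^(x + y - 1) B(x, y)]. It is handled through its recurrences
    in [x] and [y] rather than through Gamma functions. *)
Definition bker a b x y s := (s - a) `^ (x - 1) * (b - s) `^ (y - 1).
Definition bfun a b x y := \int[mu]_(s in `]a, b[) bker a b x y s.

Lemma continuous_oo_bker a b x y : {in `]a, b[, continuous (bker a b x y)}.
Proof.
move=> s sab; apply: cvgM.
  exact: continuous_oo_powRl sab.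
exact: continuous_oo_powRr sab.
Qed.

(** The sum of the two endpoint values covers both signs of the exponent [x]. *)
Lemma powR_half_bound (d u x : R) : 0 < d -> d / 2 <= u -> u <= d ->
  u `^ x <= d `^ x + (d / 2) `^ x.
Proof.
move=> d0 du ud.
have d20 : 0 < d / 2 by rewrite divr_gt0.
have u0 : 0 < u by apply: lt_le_trans du.
have [x0|x0] := leP 0 x.
  apply: (@le_trans _ _ (d `^ x)); last by rewrite lerDl powR_ge0.
  by apply: ge0_ler_powR; rewrite ?nnegrE // ltW.
apply: (@le_trans _ _ ((d / 2) `^ x)); last by rewrite lerDr powR_ge0.
rewrite -(opprK x) powRN [leRHS]powRN lef_pV2 ?posrE ?powR_gt0 //.
by apply: ge0_ler_powR; rewrite ?nnegrE ?oppr_ge0 // ltW.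
Qed.

Lemma integrable_bker a b x y : a < b -> 0 < x -> 0 < y ->
  intg `]a, b[ (bker a b x y).
Proof.
move=> ab x0 y0; pose d := b - a; have d0 : 0 < d by rewrite subr_gt0.
pose A z := d `^ (z - 1) + (d / 2) `^ (z - 1).
have i1 := integrable_powRl ab x0; have i2 := integrable_powRr ab y0.
have mab := measurable_oo a b.
have i3 := intgD mab (intgZ mab (A y) i1) (intgZ mab (A x) i2).
apply: (intg_le mab _ _ i3).
  exact: continuous_oo_measurable (@continuous_oo_bker a b x y).
move=> s; rewrite /= in_itv/= => /andP[sa sb]; rewrite /bker.
have p1 : 0 <= (s - a) `^ (x - 1) by exact: powR_ge0.
have p2 : 0 <= (b - s) `^ (y - 1) by exact: powR_ge0.
have Ap z : 0 <= A z by rewrite addr_ge0 ?powR_ge0.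
rewrite ger0_norm ?mulr_ge0 //.
(* In each half of the interval one of the two factors is bounded; the other one carries the
   integrable singularity. *)
have [h|h] := leP (d / 2) (s - a).
  rewrite ler_wpDl ?mulr_ge0 // ler_wpM2r //.
  by apply: powR_half_bound => //; rewrite /d; lra.
rewrite ler_wpDr ?mulr_ge0 // mulrC ler_wpM2r //.
by apply: powR_half_bound => //; move: h; rewrite /d; lra.
Qed.

(** The integral of the derivative of [(s - a)^x (b - s)^y] vanishes, this product being zero at
    both endpoints. *)
Lemma bfun_swap a b x y : a < b -> 0 < x -> 0 < y ->
  x * bfun a b x (y + 1) = y * bfun a b (x + 1) y.
Proof.
move=> ab x0 y0.
have mab := measurable_oo a b.
have x1 : 0 < x + 1 by rewrite addr_gt0.
have y1 : 0 < y + 1 by rewrite addr_gt0.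
have ia := integrable_bker ab x0 y1; have ib := integrable_bker ab x1 y0.
pose F s := (s - a) `^ x * (b - s) `^ y.
pose f s := x * bker a b x (y + 1) s - y * bker a b (x + 1) y s.
have iaZ := intgZ mab x ia; have ibZ := intgZ mab y ib.
have fi : intg `]a, b[ f by exact: (intgB mab iaZ ibZ).
have dF s : s \in `]a, b[ -> is_derive s 1 F (f s).
  rewrite in_itv/= => /andP[sa sb].
  have d1 := is_derive_powRl x sa; have d2 := is_derive_powRr y sb.
  apply: (is_derive_ext (is_deriveM d1 d2)) => //.
  rewrite -[LHS]/((s - a) `^ x * (- (y * (b - s) `^ (y - 1))) +
    (b - s) `^ y * (x * (s - a) `^ (x - 1))).
  by rewrite /f /bker !addrK; ring.
have cf : {in `]a, b[, continuous f}.
  move=> s sab; apply: cvgB.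
    by apply: cvgM; [exact: cvg_cst|exact: continuous_oo_bker sab].
  by apply: cvgM; [exact: cvg_cst|exact: continuous_oo_bker sab].
have cF : {within `[a, b], continuous F}.
  by move=> s; apply: cvgM; [exact: within_powRl|exact: within_powRr].
have := Rintegral_oo_FTC ab cF dF cf fi.
have -> : F b - F a = 0.
  by rewrite /F !subrr powR0 ?gt_eqF // powR0 ?gt_eqF // mulr0 mul0r subr0.
rewrite (RintB mab iaZ ibZ) (RintZ mab _ ia) (RintZ mab _ ib).
by move=> /eqP; rewrite subr_eq0 => /eqP.
Qed.

(** Multiply the kernel by [b - a = (s - a) + (b - s)]. *)
Lemma bfun_add a b x y : a < b -> 0 < x -> 0 < y ->
  bfun a b (x + 1) y + bfun a b x (y + 1) = (b - a) * bfun a b x y.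
Proof.
move=> ab x0 y0.
have mab := measurable_oo a b.
have x1 : 0 < x + 1 by rewrite addr_gt0.
have y1 : 0 < y + 1 by rewrite addr_gt0.
have ia := integrable_bker ab x0 y1; have ib := integrable_bker ab x1 y0.
rewrite /bfun -(RintD mab ib ia) -(RintZ mab _ (integrable_bker ab x0 y0)).
apply: Rint_eq => s; rewrite /= in_itv/= => /andP[sa sb].
rewrite /bker !addrK.
rewrite -(@mulr_powRB1 _ (s - a) x) ?subr_ge0 ?(ltW sa) //.
rewrite -(@mulr_powRB1 _ (b - s) y) ?subr_ge0 ?(ltW sb) //; ring.
Qed.

Lemma bfun_recr a b x y : a < b -> 0 < x -> 0 < y ->
  (x + y) * bfun a b x (y + 1) = y * (b - a) * bfun a b x y.
Proof.
move=> ab x0 y0; rewrite -mulrA -bfun_add // mulrDl bfun_swap //; ring.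
Qed.

Lemma bfun_recl a b x y : a < b -> 0 < x -> 0 < y ->
  (x + y) * bfun a b (x + 1) y = x * (b - a) * bfun a b x y.
Proof.
move=> ab x0 y0; rewrite -mulrA -bfun_add // mulrDl mulrDr bfun_swap //; ring.
Qed.

End beta.

(** * Affine substitution and strict positivity of integrals *)

Section scaling.
Variable R : realType.
Local Notation mu := (@lebesgue_measure R).
Implicit Types (a b x y s t : R).

Lemma powRD_gt0 a r s : 0 < a -> a `^ (r + s) = a `^ r * a `^ s.
Proof. by move=> a0; rewrite powRD // (gt_eqF a0) implybT. Qed.

Lemma is_derive_affine (u v z : R) : is_derive z 1 (fun z => u + v * z) v.
Proof.
have d1 : is_derive z 1 (fun _ : R => u) 0 by exact: is_derive_cst.
have d2 : is_derive z 1 (fun z : R => z) 1 by exact: is_derive_id.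
apply: (is_derive_ext (is_deriveD d1 (is_deriveZ v d2))) => //.
by rewrite add0r; exact: mulr1.
Qed.

(** A primitive of [f] composed with the affine map is a primitive of the transformed integrand.
    Continuity is required inside the interval only, so the substitution applies to singular
    kernels. *)
Lemma Rint_affine a b (f : R -> R) : a < b -> {in `]a, b[, continuous f} ->
  intg `]a, b[ f -> intg `]0, 1[ (fun z => (b - a) * f (a + (b - a) * z)) ->
  \int[mu]_(s in `]a, b[) f s =
  \int[mu]_(z in `]0, 1[) ((b - a) * f (a + (b - a) * z)).
Proof.
move=> ab cf fi hi; pose d := b - a; have d0 : 0 < d by rewrite subr_gt0.
have intfcc := integrable_oo_cc fi.
pose P := (parameterized_integral mu a)^~ f.
have cP : {within `[a, b], continuous P}.
  by apply: parameterized_integral_continuous => //; exact: ltW.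
have dP (x : R) : x \in `]a, b[ -> is_derive x 1 P (f x).
  rewrite in_itv/= => /andP[ax xb].
  have [] := @continuous_FTC1 R f (BLeft a) x b xb intfcc.
  - by rewrite lte_fin.
  - by apply: cf; rewrite in_itv/= ax.
  by move=> df <-; rewrite derive1E; exact/derivableP.
pose A z := a + d * z; pose G := P \o A.
have Aab (z : R) : z \in `]0, 1[ -> A z \in `]a, b[.
  rewrite !in_itv/= /A /d => /andP[z0 z1].
  rewrite ltrDl mulr_gt0 //= -[ltRHS](subrK a) addrC ltrD2r -[ltRHS]mulr1.
  by rewrite ltr_pM2l.
have dA z := is_derive_affine a d z.
have dG (z : R) : z \in `]0, 1[ -> is_derive z 1 G ((b - a) * f (a + (b - a) * z)).
  move=> z01; have := is_derive1_comp (dP _ (Aab _ z01)) (dA z).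
  by rewrite mulrC.
have incA (D : pred R) : {in D &, {homo A : x y / x < y}}.
  by move=> x y _ _ xy; rewrite /A ltrD2l ltr_pM2l.
have A0 : A 0 = a by rewrite /A mulr0 addr0.
have A1 : A 1 = b by rewrite /A mulr1 /d addrC subrK.
have cA z : {for z, continuous A} := is_derive_continuous (dA z).
have [_ Pa Pb] := (continuous_within_itvP _ ab).1 cP.
have cG : {within `[0, 1], continuous G}.
  apply/(continuous_within_itvP _ ltr01); split.
  - by move=> z z01; exact: is_derive_continuous (dG z z01).
  - rewrite -[G 0]/(P (A 0)) A0.
    apply: (@increasing_cvg_at_right_comp _ A P 0 (BLeft 1) (P a)).
    + by rewrite bnd_simp.
    + exact: incA.
    + exact: cvg_at_right_filter (cA 0).
    + by rewrite A0.
  - rewrite -[G 1]/(P (A 1)) A1.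
    apply: (@increasing_cvg_at_left_comp _ A P (BRight 0) 1 (P b)).
    + by rewrite bnd_simp.
    + exact: incA.
    + exact: cvg_at_left_filter (cA 1).
    + by rewrite A1.
have ch : {in `]0, 1[, continuous (fun z => (b - a) * f (a + (b - a) * z))}.
  move=> z z01; apply: cvgM; first exact: cvg_cst.
  apply: (@continuous_comp R R R A f z (cA z)); exact: cf (Aab _ z01).
have := Rintegral_oo_FTC ltr01 cG dG ch hi.
rewrite -[G 0]/(P (A 0)) -[G 1]/(P (A 1)) A0 A1.
rewrite /P /parameterized_integral set_itv1 Rintegral_set1 subr0 => ->.
by rewrite /Rintegral [in RHS]integral_itv_bndoo //; case/integrableP: fi.
Qed.

Lemma bfun_scale a b x y : a < b -> 0 < x -> 0 < y ->
  bfun a b x y = (b - a) `^ (x + y - 1) * bfun 0 1 x y.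
Proof.
move=> ab x0 y0; have d0 : 0 < b - a by rewrite subr_gt0.
have hE (z : R) : z \in `]0, 1[ -> (b - a) `^ (x + y - 1) * bker 0 1 x y z =
    (b - a) * bker a b x y (a + (b - a) * z).
  rewrite in_itv/= => /andP[z0 z1]; rewrite /bker.
  have -> : a + (b - a) * z - a = (b - a) * z by ring.
  have -> : b - (a + (b - a) * z) = (b - a) * (1 - z) by ring.
  rewrite subr0 !powRM ?(ltW d0) ?(ltW z0) ?subr_ge0 ?(ltW z1) //.
  have -> : x + y - 1 = 1 + ((x - 1) + (y - 1)) by ring.
  have pD r r' : (b - a) `^ (r + r') = (b - a) `^ r * (b - a) `^ r'.
    exact: powRD_gt0.
  rewrite !pD powRr1 ?(ltW d0) //; ring.
have i1 := integrable_bker (@ltr01 R) x0 y0.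
have i2 : intg `]0, 1[ (fun z => (b - a) * bker a b x y (a + (b - a) * z)).
  apply: (intg_eq (measurable_oo _ _) _ (intgZ (measurable_oo _ _) ((b - a) `^ (x + y - 1)) i1)) => z.
  exact: hE.
rewrite /bfun (Rint_affine ab (@continuous_oo_bker _ a b x y) (integrable_bker ab x0 y0) i2).
rewrite -(RintZ (measurable_oo _ _) _ i1); apply: Rint_eq => z z01.
by rewrite hE.
Qed.

(** Were [f x > 0], a ball around [x] would lie in the set where [f] is at least [f x / 2], which is
    null by Markov's inequality. *)
Lemma Rint_eq0_continuous a b (f : R -> R) : intg `]a, b[ f ->
  {in `]a, b[, continuous f} -> (forall x, x \in `]a, b[ -> 0 <= f x) ->
  \int[mu]_(s in `]a, b[) f s = 0 -> forall x, x \in `]a, b[ -> f x = 0.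
Proof.
move=> fi cf f0 If0 x xab; apply/eqP/negPn/negP => fx.
have {}fx : 0 < f x by rewrite lt_neqAle eq_sym fx f0.
have fx2 : 0 < f x / 2 by rewrite divr_gt0.
have mab := measurable_oo a b.
have nf : \forall y \near x, f x / 2 < f y.
  by apply: (cvgr_gt (f x) (cf x xab)); lra.
have nab : \forall y \near x, y \in `]a, b[ by exact: near_in_itvoo.
have [e /= e0 he] : nbhs_ball x [set y | f x / 2 < f y /\ y \in `]a, b[].
  by apply/nbhs_ballP; near=> y; split; near: y.
have mf : measurable_fun `]a, b[ (EFin \o f) by case/integrableP: fi.
have := le_integral_abse mu mab mf fx2.
have -> : (\int[mu]_(y in `]a, b[) `|(EFin \o f) y| = 0)%E.
  rewrite -[RHS]/((0 : R)%:E) -If0 -(Rint_EFin mab fi); apply: eq_integral => y.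
  by rewrite inE => yab; rewrite /= ger0_norm // f0.
rewrite pmule_rle0 ?lte_fin // measure_le0 => /eqP mu0.
have : (mu (`](x - e)%R, (x + e)%R[%classic) <= 0)%E.
  rewrite -mu0; apply: le_measure; rewrite ?inE.
  - exact: measurable_oo.
  - apply: emeasurable_fun_c_infty => //; exact: measurableT_comp.
  - move=> y /=; rewrite in_itv/= => /andP[y1 y2].
    have [] := he y; first by rewrite /ball/= ltr_distlC y1 y2.
    move=> fy yab; split => //.
    by rewrite lee_fin (le_trans (ltW fy)) // ler_norm.
rewrite lebesgue_measure_itv/= lte_fin ifT; last by lra.
by rewrite -EFinB lee_fin; lra.
Unshelve. all: by end_near. Qed.

Lemma Rint_gt0_continuous a b (f : R -> R) : a < b -> intg `]a, b[ f ->
  {in `]a, b[, continuous f} -> (forall x, x \in `]a, b[ -> 0 < f x) ->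
  0 < \int[mu]_(s in `]a, b[) f s.
Proof.
move=> ab fi cf f0.
rewrite lt_neqAle Rint_ge0 ?andbT; last by move=> s /f0/ltW.
rewrite eq_sym; apply/eqP => If0.
have mab : (a + b) / 2 \in `]a, b[ by rewrite in_itv/=; lra.
have := Rint_eq0_continuous fi cf (fun x xab => ltW (f0 x xab)) If0 mab.
by apply/eqP; rewrite gt_eqF // f0.
Qed.

Lemma bfun_gt0 a b x y : a < b -> 0 < x -> 0 < y -> 0 < bfun a b x y.
Proof.
move=> ab x0 y0; apply: (Rint_gt0_continuous ab (integrable_bker ab x0 y0)).
  exact: continuous_oo_bker.
move=> s; rewrite in_itv/= => /andP[sa sb].
by rewrite mulr_gt0 // powR_gt0 // subr_gt0.
Qed.

End scaling.

(** * Weighted square-integrable functions on the interval *)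

Section weighted_L2.
Variable R : realType.
Local Notation mu := (@lebesgue_measure R).
Variable T : R.
Hypothesis T_gt0 : 0 < T.
Local Notation D := (dom T).
Implicit Types (g b : R) (u v w : R -> R) (p q : {poly R}).

Lemma mdom : measurable (D : set (measurableTypeR R)).
Proof. exact: measurable_oo. Qed.

Lemma domP x : D x -> 0 < x /\ x < T.
Proof. by rewrite /dom /= in_itv/= => /andP. Qed.

Lemma omegaE g b x : omega T g b x = bker 0 T (b + 1) (g + 1) x.
Proof. by rewrite /omega /bker !addrK subr0 mulrC. Qed.

Lemma omega_gt0 g b x : D x -> 0 < omega T g b x.
Proof. by move=> /domP[x0 xT]; rewrite mulr_gt0 // powR_gt0 // subr_gt0. Qed.

Lemma omega_ge0 g b x : 0 <= omega T g b x.
Proof. by rewrite mulr_ge0 // powR_ge0. Qed.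

Lemma omega_continuous g b : {in `]0, T[, continuous (omega T g b)}.
Proof.
have -> : omega T g b = bker 0 T (b + 1) (g + 1) by apply/funext => x; exact: omegaE.
exact: continuous_oo_bker.
Qed.

Lemma omega_measurable g b : measurable_fun D (omega T g b).
Proof. exact: continuous_oo_measurable (@omega_continuous g b). Qed.

Lemma omega_bound g b x : 0 <= g -> 0 <= b -> D x ->
  omega T g b x <= T `^ g * T `^ b.
Proof.
move=> g0 b0 /domP[x0 xT]; apply: ler_pM; rewrite ?powR_ge0 //.
  by apply: ge0_ler_powR; rewrite ?nnegrE ?subr_ge0 ?(ltW xT) ?(ltW T_gt0) // gerBl ltW.
by apply: ge0_ler_powR; rewrite ?nnegrE ?(ltW x0) ?(ltW xT) ?(ltW T_gt0).
Qed.

Lemma intg_cst (k : R) : intg D (fun=> k).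
Proof.
apply: (@measurable_bounded_integrable _ _ _ mu (fun=> k) D mdom).
- have muD : (mu (`]0%R, T[%classic) < +oo)%E.
    by rewrite lebesgue_measure_itv/= lte_fin T_gt0 -EFinB ltry.
  exact: muD.
- exact: measurable_cst.
- exists `|k|; split; first exact: num_real.
  by move=> M kM x _; exact: ltW.
Qed.

Lemma intg_bounded (f : R -> R) (k : R) : measurable_fun D f ->
  (forall x, D x -> `|f x| <= k) -> intg D f.
Proof. by move=> mf fk; apply: (intg_le mdom mf fk); exact: intg_cst. Qed.

(** The same functions as in [wL2], described by the integrability of a real function rather than by
    the finiteness of an extended norm, which gives access to the linearity of real integrals. *)
Definition L2w g b v := measurable_fun D v /\
  intg D (fun x => omega T g b x * v x ^+ 2).

Lemma L2w_measurable g b v : L2w g b v -> measurable_fun D v.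
Proof. by case. Qed.

Lemma measurable_wsq g b v : measurable_fun D v ->
  measurable_fun D (fun x => omega T g b x * v x ^+ 2).
Proof.
move=> mv; apply: measurable_funM; first exact: omega_measurable.
exact: measurable_funX.
Qed.

Lemma wL2P g b v : wL2 T g b v <-> L2w g b v.
Proof.
split=> -[mv].
  move=> vlt; split => //; apply: ge0_intg.
  - exact: measurable_wsq.
  - by move=> x _; rewrite mulr_ge0 ?omega_ge0 ?sqr_ge0.
  have I0 : (0 <= \int[mu]_(x in D) (omega T g b x * v x ^+ 2)%:E)%E.
    by apply: integral_ge0 => x _; rewrite lee_fin mulr_ge0 ?omega_ge0 ?sqr_ge0.
  have key (I : \bar R) : (0 <= I)%E -> (sqrte I < +oo)%E -> (I < +oo)%E.
    by case: I => //= r _ _; exact: ltry.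
  exact: key I0 vlt.
move=> iv; split => //; rewrite /wnorm (Rint_EFin mdom iv) /=.
exact: ltry.
Qed.

Lemma L2w_prod g b u v : L2w g b u -> L2w g b v ->
  intg D (fun x => u x * v x * omega T g b x).
Proof.
move=> [mu_ iu] [mv iv]; apply: (intg_le mdom _ _ (intgD mdom iu iv)).
  by apply: measurable_funM; [exact: measurable_funM|exact: omega_measurable].
move=> x Dx; rewrite normrM (ger0_norm (omega_ge0 _ _ _)) mulrC -mulrDr.
rewrite ler_wpM2l ?omega_ge0 // ler_norml.
have := sqr_ge0 (u x + v x); have := sqr_ge0 (u x - v x).
have := sqr_ge0 (u x); have := sqr_ge0 (v x).
rewrite sqrrB sqrrD; lra.
Qed.

Lemma L2w_eq g b u v : (forall x, D x -> u x = v x) -> L2w g b u -> L2w g b v.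
Proof.
move=> uv [mu_ iu]; split.
  by apply: eq_measurable_fun mu_ => x; rewrite inE; exact: uv.
by apply: (intg_eq mdom) iu => x Dx; rewrite uv.
Qed.

Lemma L2wD g b u v : L2w g b u -> L2w g b v -> L2w g b (fun x => u x + v x).
Proof.
move=> u2 v2; have [mu_ iu] := u2; have [mv iv] := v2.
split; first exact: measurable_funD.
have := intgD mdom (intgD mdom iu iv) (intgZ mdom 2 (L2w_prod u2 v2)).
by apply: (intg_eq mdom) => x Dx; ring.
Qed.

Lemma L2wZ g b k u : L2w g b u -> L2w g b (fun x => k * u x).
Proof.
move=> [mu_ iu]; split.
  by apply: measurable_funM => //; exact: measurable_cst.
by have := intgZ mdom (k ^+ 2) iu; apply: (intg_eq mdom) => x Dx; ring.
Qed.

Lemma L2wB g b u v : L2w g b u -> L2w g b v -> L2w g b (fun x => u x - v x).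
Proof.
move=> u2 v2; have := L2wD u2 (L2wZ (-1) v2).
by apply: L2w_eq => x _; rewrite mulN1r.
Qed.

Lemma L2w_bounded g b v k : 0 <= g -> 0 <= b -> measurable_fun D v ->
  (forall x, D x -> `|v x| <= k) -> L2w g b v.
Proof.
move=> g0 b0 mv vk; split => //.
apply: (@intg_bounded _ (T `^ g * T `^ b * k ^+ 2)).
  exact: measurable_wsq.
move=> x Dx; rewrite ger0_norm; last by rewrite mulr_ge0 ?omega_ge0 ?sqr_ge0.
apply: ler_pM; rewrite ?omega_ge0 ?sqr_ge0 ?omega_bound //.
by rewrite -real_normK ?num_real // lerXn2r ?nnegrE // ?vk // (le_trans _ (vk _ Dx)).
Qed.

Lemma continuous_bounded_dom (f : R -> R) : continuous f ->
  exists k, forall x, D x -> `|f x| <= k.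
Proof.
move=> cf; have [M [_ Mf]] : bounded_set (f @` `[0, T]).
  apply: compact_bounded; apply: continuous_compact; last exact: segment_compact.
  exact: continuous_subspaceT.
exists (M + 1) => x /domP[x0 xT]; apply: (Mf (M + 1)); first by rewrite ltrDl.
by exists x => //; rewrite /= in_itv/= !ltW.
Qed.

Lemma L2w_continuous g b f : 0 <= g -> 0 <= b -> continuous f -> L2w g b f.
Proof.
move=> g0 b0 cf; have [k fk] := continuous_bounded_dom cf.
apply: (L2w_bounded g0 b0 _ fk).
by apply: measurable_funTS; exact: continuous_measurable_fun.
Qed.

Lemma continuous_poly p : continuous (horner p).
Proof. by move=> x; exact: (is_derive_continuous (is_derive_poly p x)). Qed.

Lemma L2w_poly g b p : 0 <= g -> 0 <= b -> L2w g b (horner p).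
Proof. by move=> g0 b0; apply: L2w_continuous => //; exact: continuous_poly. Qed.

Local Notation ip := (winner T).

Lemma ipC g b u v : ip g b u v = ip g b v u.
Proof. by apply: Rint_eq => x _; rewrite (mulrC (u x)). Qed.

Lemma ip_eq g b u u' v v' : (forall x, D x -> u x = u' x) ->
  (forall x, D x -> v x = v' x) -> ip g b u v = ip g b u' v'.
Proof. by move=> uu' vv'; apply: Rint_eq => x Dx; rewrite uu' // vv'. Qed.

Lemma ipDl g b u v w : L2w g b u -> L2w g b v -> L2w g b w ->
  ip g b (fun x => u x + v x) w = ip g b u w + ip g b v w.
Proof.
move=> u2 v2 w2; rewrite /winner -(RintD mdom (L2w_prod u2 w2) (L2w_prod v2 w2)).
by apply: Rint_eq => x _; ring.
Qed.

Lemma ipZl g b k u w : L2w g b u -> L2w g b w ->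
  ip g b (fun x => k * u x) w = k * ip g b u w.
Proof.
move=> u2 w2; rewrite /winner -(RintZ mdom k (L2w_prod u2 w2)).
by apply: Rint_eq => x _; ring.
Qed.

Lemma ipBl g b u v w : L2w g b u -> L2w g b v -> L2w g b w ->
  ip g b (fun x => u x - v x) w = ip g b u w - ip g b v w.
Proof.
move=> u2 v2 w2; rewrite /winner -(RintB mdom (L2w_prod u2 w2) (L2w_prod v2 w2)).
by apply: Rint_eq => x _; ring.
Qed.

Lemma ipDr g b u v w : L2w g b u -> L2w g b v -> L2w g b w ->
  ip g b w (fun x => u x + v x) = ip g b w u + ip g b w v.
Proof. by move=> *; rewrite ipC ipDl // !(ipC _ _ w). Qed.

Lemma ipZr g b k u w : L2w g b u -> L2w g b w ->
  ip g b w (fun x => k * u x) = k * ip g b w u.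
Proof. by move=> *; rewrite ipC ipZl // (ipC _ _ w). Qed.

Lemma ipBr g b u v w : L2w g b u -> L2w g b v -> L2w g b w ->
  ip g b w (fun x => u x - v x) = ip g b w u - ip g b w v.
Proof. by move=> *; rewrite ipC ipBl // !(ipC _ _ w). Qed.

Lemma ip_ge0 g b u : 0 <= ip g b u u.
Proof.
by apply: Rint_ge0 => x _; rewrite mulr_ge0 ?omega_ge0 // -expr2 sqr_ge0.
Qed.

Lemma ip_CS2 g b u v : L2w g b u -> L2w g b v ->
  ip g b u v ^+ 2 <= ip g b u u * ip g b v v.
Proof.
move=> u2 v2; set A := ip g b u u; set B := ip g b u v; set C := ip g b v v.
have E t : 0 <= A - 2 * t * B + t ^+ 2 * C.
  have := ip_ge0 g b (fun x => u x - t * v x).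
  rewrite ipBl ?ipBr ?ipZl ?ipZr //; try exact: L2wZ; last exact: L2wB (L2wZ _ _).
  rewrite (ipC _ _ v u) -/A -/B -/C; congr (0 <= _); ring.
have A0 : 0 <= A by exact: ip_ge0.
have [C0|C0] := eqVneq C 0.
  rewrite C0 mulr0; have [->|B0] := eqVneq B 0; first by rewrite expr0n.
  (* With [C = 0] the quadratic is affine in [t], and this [t] gives it the value [-1]. *)
  have := E ((A + 1) / (2 * B)); rewrite C0 mulr0 addr0.
  have -> : 2 * ((A + 1) / (2 * B)) * B = A + 1 by field.
  by move=> h; exfalso; lra.
have Cp : 0 < C by rewrite lt_neqAle eq_sym C0 ip_ge0.
have := E (B / C).
have -> : A - 2 * (B / C) * B + (B / C) ^+ 2 * C = (A * C - B ^+ 2) / C by field.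
by rewrite pmulr_lge0 ?invr_gt0 // subr_ge0.
Qed.

Definition nrm g b u := Num.sqrt (ip g b u u).

Lemma nrm_ge0 g b u : 0 <= nrm g b u.
Proof. exact: sqrtr_ge0. Qed.

Lemma nrm_sq g b u : nrm g b u ^+ 2 = ip g b u u.
Proof. by rewrite sqr_sqrtr // ip_ge0. Qed.

Lemma nrm_eq g b u v : (forall x, D x -> u x = v x) -> nrm g b u = nrm g b v.
Proof. by move=> uv; congr Num.sqrt; exact: ip_eq. Qed.

Lemma wnormE g b u : L2w g b u -> wnorm T g b u = (nrm g b u)%:E.
Proof.
move=> [_ iu]; rewrite /wnorm (Rint_EFin mdom iu) /=; congr (Num.sqrt _)%:E.
by apply: Rint_eq => x _; ring.
Qed.

Lemma ip_CS g b u v : L2w g b u -> L2w g b v ->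
  `|ip g b u v| <= nrm g b u * nrm g b v.
Proof.
move=> u2 v2; rewrite -sqrtrM ?ip_ge0 // -sqrtr_sqr ler_wsqrtr //.
exact: ip_CS2.
Qed.

Lemma nrmD g b u v : L2w g b u -> L2w g b v ->
  nrm g b (fun x => u x + v x) <= nrm g b u + nrm g b v.
Proof.
move=> u2 v2; rewrite -(@ler_pXn2r _ 2) ?nnegrE ?addr_ge0 ?nrm_ge0 //.
rewrite sqrrD !nrm_sq ipDl ?ipDr //; try exact: L2wD.
have := ip_CS u2 v2; have := ler_norm (ip g b u v).
rewrite (ipC _ _ v u) mulr2n; lra.
Qed.

Lemma nrmZ g b k u : L2w g b u -> nrm g b (fun x => k * u x) = `|k| * nrm g b u.
Proof.
move=> u2; rewrite /nrm ipZl ?ipZr //; last exact: L2wZ.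
by rewrite mulrA -expr2 sqrtrM ?sqr_ge0 // sqrtr_sqr.
Qed.

Lemma nrm_triang g b u v w : L2w g b u -> L2w g b v -> L2w g b w ->
  nrm g b (fun x => u x - w x) <=
  nrm g b (fun x => u x - v x) + nrm g b (fun x => v x - w x).
Proof.
move=> u2 v2 w2; have := nrmD (L2wB u2 v2) (L2wB v2 w2).
by congr (_ <= _); apply: nrm_eq => x _; ring.
Qed.

(** The integrand is continuous and nonnegative, so it vanishes throughout []0, T[], and so does
    [p], which then has more roots than its degree allows. *)
Lemma ip_poly_eq0 g b p : 0 <= g -> 0 <= b ->
  ip g b (horner p) (horner p) = 0 -> p = 0.
Proof.
move=> g0 b0 ip0.
have p2 := L2w_poly p g0 b0.
have z x : D x -> p.[x] * p.[x] * omega T g b x = 0.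
  move=> Dx; apply: (Rint_eq0_continuous (L2w_prod p2 p2) _ _ ip0 Dx).
    move=> y yD; apply: cvgM; last exact: omega_continuous.
    by apply: cvgM; exact: continuous_poly.
  by move=> y yD; rewrite mulr_ge0 ?omega_ge0 // -expr2 sqr_ge0.
apply/eqP/negPn/negP => pn0.
pose s := [seq T * (i.+1%:R / (size p).+1%:R) | i <- iota 0 (size p)].
have := @max_poly_roots _ p s pn0.
rewrite size_map size_iota ltnn => /(_ _ _)/negP; apply => //.
  apply/allP => y /mapP[i]; rewrite mem_iota/= add0n => ip ->.
  have Di : D (T * (i.+1%:R / (size p).+1%:R)).
    rewrite /dom/= in_itv/= mulr_gt0 ?divr_gt0 //= -[ltRHS]mulr1 ltr_pM2l //.
    by rewrite ltr_pdivrMr // mul1r ltr_nat ltnS.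
  have /eqP := z _ Di; rewrite mulf_eq0 (gt_eqF (omega_gt0 _ _ Di)) orbF.
  by rewrite mulf_eq0 orbb.
rewrite map_inj_uniq ?iota_uniq // => i j /(mulfI (lt0r_neq0 T_gt0)).
move/(mulIf _) => /(_ _)/eqP; rewrite invr_eq0 pnatr_eq0 => /(_ isT).
by rewrite eqr_nat eqSS => /eqP.
Qed.

Lemma ip_poly_gt0 g b p : 0 <= g -> 0 <= b -> p != 0 ->
  0 < ip g b (horner p) (horner p).
Proof.
move=> g0 b0 p0; rewrite lt_neqAle ip_ge0 andbT eq_sym.
by apply: contra p0 => /eqP /(ip_poly_eq0 g0 b0) ->.
Qed.

End weighted_L2.

(** * Density of polynomials *)

Section bernstein.
Variable R : realType.
Implicit Types (x y : R) (phi psi : nat -> R).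

(* The expectation of [phi] under the binomial distribution of parameters [n] and [x], as
   a polynomial in [x], computed by conditioning on one trial. *)
Fixpoint bernstein n phi : {poly R} :=
  if n is n'.+1 then
    'X * bernstein n' (fun k => phi k.+1) + (1 - 'X) * bernstein n' phi
  else (phi 0%N)%:P.

Lemma bernsteinS n phi x : (bernstein n.+1 phi).[x] =
  x * (bernstein n (fun k => phi k.+1)).[x] + (1 - x) * (bernstein n phi).[x].
Proof. by rewrite /= !hornerE. Qed.

Lemma bernstein_le n phi psi x : 0 <= x <= 1 ->
  (forall k, (k <= n)%N -> phi k <= psi k) ->
  (bernstein n phi).[x] <= (bernstein n psi).[x].
Proof.
move=> /andP[x0 x1]; elim: n phi psi => [|n IH] phi psi le.
  by rewrite /= !hornerC le.
rewrite !bernsteinS lerD // ler_wpM2l ?subr_ge0 //.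
  by apply: IH => k kn; exact: le.
by apply: IH => k kn; apply: le; exact: leqW.
Qed.

Lemma bernstein_lin n phi psi x a b :
  (bernstein n (fun k => a * phi k + b * psi k)).[x] =
  a * (bernstein n phi).[x] + b * (bernstein n psi).[x].
Proof.
elim: n phi psi => [|n IH] phi psi; first by rewrite /= !hornerC.
rewrite !bernsteinS (IH (fun k => phi k.+1) (fun k => psi k.+1)) IH; ring.
Qed.

Lemma bernstein_cst n x a : (bernstein n (fun=> a)).[x] = a.
Proof. by elim: n => [|n IH]; rewrite ?bernsteinS ?IH /= ?hornerC //; ring. Qed.

Lemma bernstein_id n x : (bernstein n (fun k => k%:R)).[x] = n%:R * x.
Proof.
elim: n => [|n IH]; first by rewrite /= hornerC mul0r.
have E : (fun k => k.+1%:R) = (fun k => 1 * k%:R + 1 * 1) :> (nat -> R).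
  by apply/funext => k; rewrite -natr1; ring.
rewrite bernsteinS IH E (bernstein_lin _ _ (fun=> 1)) IH bernstein_cst -natr1; ring.
Qed.

Lemma bernstein_sq n x : (bernstein n (fun k => k%:R ^+ 2)).[x] =
  n%:R * (x * (1 - x)) + (n%:R * x) ^+ 2.
Proof.
elim: n => [|n IH]; first by rewrite /= hornerC; ring.
have E : (fun k => k.+1%:R ^+ 2) = (fun k => 1 * k%:R ^+ 2 + 1 * (2 * k%:R + 1 * 1)) :> (nat -> R).
  by apply/funext => k; rewrite -natr1; ring.
rewrite bernsteinS IH E (bernstein_lin _ _ (fun k => 2 * k%:R + 1 * 1)) IH.
rewrite (bernstein_lin _ _ (fun=> 1)) bernstein_id bernstein_cst -natr1; ring.
Qed.

Lemma bernstein_var n x : (0 < n)%N ->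
  (bernstein n (fun k => (k%:R / n%:R - x) ^+ 2)).[x] = x * (1 - x) / n%:R.
Proof.
move=> n0; have n1 : n%:R != 0 :> R by rewrite pnatr_eq0 -lt0n.
have E : (fun k => (k%:R / n%:R - x) ^+ 2) = (fun k => n%:R ^- 2 * k%:R ^+ 2 +
    1 * (- (2 * x / n%:R) * k%:R + x ^+ 2 * 1)) :> (nat -> R).
  by apply/funext => k; field.
rewrite E (bernstein_lin _ _ (fun k => _ * k%:R + _ * 1)) bernstein_sq.
by rewrite (bernstein_lin _ _ (fun=> 1)) bernstein_id bernstein_cst; field.
Qed.

(** Nearby points are handled by uniform continuity; at distance at least [d] the quadratic term
    exceeds twice a bound of [f]. In this form the modulus of continuity can be averaged by means of
    the variance of the binomial law. *)
Lemma unit_modulus (f : R -> R) (e : R) : continuous f -> 0 < e ->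
  exists C : R, 0 <= C /\ forall x y, 0 <= x <= 1 -> 0 <= y <= 1 ->
    `|f x - f y| <= e + C * (x - y) ^+ 2.
Proof.
move=> cf e0.
have [M [_ Mf]] : bounded_set (f @` `[0, 1]).
  apply: compact_bounded; apply: continuous_compact; last exact: segment_compact.
  exact: continuous_subspaceT.
have {}Mf x : 0 <= x <= 1 -> `|f x| <= `|M| + 1.
  move=> x01; apply: (Mf (`|M| + 1)); first by rewrite (le_lt_trans (ler_norm M)) // ltrDl.
  by exists x => //; rewrite /= in_itv.
have cc : compact (`[0, 1] : set R) by exact: segment_compact.
have [d d0 fd] : exists2 d : R, 0 < d & forall x y, 0 <= x <= 1 -> 0 <= y <= 1 ->
    `|x - y| < d -> `|f x - f y| <= e.
  have e2 : 0 < e / 2 by rewrite divr_gt0.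
  apply: contrapT => H.
  (* Failure of uniform continuity gives pairs at distance less than [1 / (n + 1)] whose values are
     more than [e] apart; their first components have a cluster point by compactness. *)
  have H' n : exists z : R * R, [/\ 0 <= z.1 <= 1, 0 <= z.2 <= 1,
      `|z.1 - z.2| < n.+1%:R^-1 & e < `|f z.1 - f z.2|].
    apply: contrapT => Hn; apply: H; exists n.+1%:R^-1; first by rewrite invr_gt0.
    move=> x y hx hy xy; rewrite leNgt; apply/negP => lt.
    by apply: Hn; exists (x, y).
  have [z zP] := choice H'.
  have zc n : `[0, 1]%classic (z n).1 by case: (zP n) => + _ _ _; rewrite /= in_itv.
  have [p [_ clp]] : `[0, 1]%classic `&` cluster ((fun n => (z n).1) @ \oo) !=set0.
    by apply: cc; exists 0%N => // n _; exact: zc.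
  have nf : \forall u \near p, `|f p - f u| < e / 2.
    by move/cvgrPdist_lt: (cf p); apply.
  have [r /= r0 hr] : nbhs_ball p [set u | `|f p - f u| < e / 2] by apply/nbhs_ballP.
  have [N _ hN] : \forall n \near \oo, n.+1%:R^-1 < r / 2.
    exists (Num.truncn (2 / r)) => // n /= hn.
    rewrite invf_plt ?posrE ?divr_gt0 // invf_div.
    by apply: lt_le_trans (truncnS_gt _) _; rewrite ler_nat ltnS.
  have A1 : ((fun n => (z n).1) @ \oo) [set u | exists2 n, (N <= n)%N & (z n).1 = u].
    by exists N => // n hn; exists n.
  have A2 : nbhs p (ball p (r / 2)) by apply: nbhsx_ballx; rewrite divr_gt0.
  have [u [[n nN <-] up]] := clp _ _ A1 A2.
  case: (zP n) => _ _ zd ze.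
  have h1 : `|f p - f (z n).1| < e / 2.
    by apply: hr; apply: le_ball up; lra.
  have h2 : `|f p - f (z n).2| < e / 2.
    apply: hr; rewrite /ball/=; have := hN _ nN; move: up; rewrite /ball/= => up hn.
    have -> : p - (z n).2 = (p - (z n).1) + ((z n).1 - (z n).2) by ring.
    by rewrite (le_lt_trans (ler_normD _ _)) // [ltRHS]splitr ltrD // (lt_trans zd hn).
  have := ler_distD (f p) (f (z n).1) (f (z n).2).
  by rewrite (distrC (f (z n).1) (f p)); lra.
exists (2 * (`|M| + 1) / d ^+ 2); split.
  by rewrite divr_ge0 ?sqr_ge0 // mulr_ge0 // addr_ge0.
move=> x y x01 y01; have [xy|xy] := ltP `|x - y| d.
  apply: le_trans (fd x y x01 y01 xy) _; rewrite lerDl.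
  by rewrite mulr_ge0 ?sqr_ge0 // divr_ge0 ?sqr_ge0 // mulr_ge0 // addr_ge0.
apply: le_trans (ler_normB _ _) _; apply: ler_wpDl; first exact: ltW.
have [K [K0 KE]] : exists K : R, 0 <= K /\ 2 * (`|M| + 1) = K.
  by eexists; split; last by []; rewrite mulr_ge0 // addr_ge0.
apply: (@le_trans _ _ K).
  by have := Mf x x01; have := Mf y y01; rewrite -KE; lra.
rewrite KE; have -> : K / d ^+ 2 * (x - y) ^+ 2 = K * ((x - y) ^+ 2 / d ^+ 2) by ring.
rewrite ler_peMr // ler_pdivlMr ?exprn_gt0 // mul1r.
by rewrite -[leRHS]real_normK ?num_real // lerXn2r ?nnegrE ?(ltW d0).
Qed.

(** The Bernstein operator is linear and monotone, so it inherits the modulus of continuity: the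
    error is at most [e / 2] plus [C] times the variance [x (1 - x) / n]. *)
Lemma weierstrass_unit (f : R -> R) (e : R) : continuous f -> 0 < e ->
  exists p : {poly R}, forall x, 0 <= x <= 1 -> `|f x - p.[x]| <= e.
Proof.
move=> cf e0; have e2 : 0 < e / 2 by rewrite divr_gt0.
have [C [C0 fC]] := unit_modulus cf e2.
pose n := (Num.truncn (C / (e / 2))).+1.
have n0 : 0 < n%:R :> R by rewrite ltr0n.
have Cn : C / n%:R <= e / 2.
  by rewrite ler_pdivrMr // mulrC -ler_pdivrMr //; apply/ltW/truncnS_gt.
exists (bernstein n (fun k => f (k%:R / n%:R))) => x x01.
pose W := (fun k : nat => e / 2 + C * (k%:R / n%:R - x) ^+ 2) : nat -> R.
have EW : (bernstein n W).[x] <= e.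
  have -> : W = (fun k : nat => 1 * (e / 2) + C * (k%:R / n%:R - x) ^+ 2).
    by apply/funext => k; rewrite /W mul1r.
  rewrite (bernstein_lin _ (fun=> e / 2)) bernstein_cst bernstein_var // mul1r.
  have : C * (x * (1 - x) / n%:R) <= C / n%:R.
    rewrite ler_wpM2l // ler_piMl ?invr_ge0 ?(ltW n0) //.
    case/andP: x01 => x0 x1; apply: mulr_ile1 => //; lra.
  lra.
have kn k : (k <= n)%N -> 0 <= (k%:R / n%:R : R) <= 1.
  by move=> kn; rewrite divr_ge0 ?(ltW n0) //= ler_pdivrMr // mul1r ler_nat.
have lin : (bernstein n (fun k => 1 * f (k%:R / n%:R) + (-1) * f x)).[x] =
    (bernstein n (fun k => f (k%:R / n%:R))).[x] - f x.
  by rewrite (bernstein_lin _ _ (fun=> f x)) bernstein_cst; ring.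
have linN : (bernstein n (fun k => (-1) * f (k%:R / n%:R) + 1 * f x)).[x] =
    f x - (bernstein n (fun k => f (k%:R / n%:R))).[x].
  by rewrite (bernstein_lin _ _ (fun=> f x)) bernstein_cst; ring.
rewrite ler_norml; apply/andP; split.
  rewrite lerNl opprB -lin (le_trans _ EW) //; apply: bernstein_le => // k /kn hk.
  have := fC _ _ hk x01; have := ler_norm (f (k%:R / n%:R) - f x); rewrite /W; lra.
rewrite -linN (le_trans _ EW) //; apply: bernstein_le => // k /kn hk.
have := fC _ _ hk x01; have := ler_norm (- (f (k%:R / n%:R) - f x)); rewrite normrN /W; lra.
Qed.

Lemma weierstrass (f : R -> R) (T e : R) : 0 < T -> continuous f -> 0 < e ->
  exists p : {poly R}, forall x, 0 <= x <= T -> `|f x - p.[x]| <= e.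
Proof.
move=> T0 cf e0.
have cg : continuous (fun x => f (T * x)).
  move=> x; apply: (@continuous_comp R R R (fun x => T * x) f x); last exact: cf.
  by apply: cvgM; [exact: cvg_cst|exact: cvg_id].
have [p pP] := weierstrass_unit cg e0.
exists (p \Po (T^-1 *: 'X)) => x /andP[x0 xT].
rewrite horner_comp !hornerE.
have := pP (T^-1 * x); rewrite mulVKf ?gt_eqF //; apply.
by rewrite mulr_ge0 ?invr_ge0 ?(ltW T0) //= mulrC ler_pdivrMr // mul1r.
Qed.

End bernstein.

(** * Density of polynomials in weighted L^2 *)

Section density.
Variable R : realType.
Local Notation mu := (@lebesgue_measure R).
Variable T : R.
Hypothesis T_gt0 : 0 < T.
Local Notation D := (dom T).
Implicit Types (g b : R) (u v w : R -> R).

Definition clip (M t : R) := Num.max (- M) (Num.min t M).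

Lemma clip_bound M t : 0 <= M -> `|clip M t| <= M.
Proof.
move=> M0; rewrite /clip ler_norml; apply/andP; split; first by rewrite le_max lexx.
by rewrite ge_max ge_min lexx orbT andbT; lra.
Qed.

Lemma clip_id M t : `|t| <= M -> clip M t = t.
Proof.
rewrite ler_norml => /andP[t1 t2]; rewrite /clip (min_idPl t2).
by apply/max_idPr.
Qed.

Lemma clip_lipschitz M s t : `|clip M s - clip M t| <= `|s - t|.
Proof.
rewrite /clip !maxEle !minEle.
case: (leP s M) => h1; case: (leP t M) => h2;
  repeat match goal with |- context [if ?a <= ?b then _ else _] => case: (leP a b) => ? end;
  rewrite ler_norml; apply/andP; split;
  have := ler_norm (s - t); have := ler_norm (- (s - t)); rewrite normrN; lra.
Qed.

Lemma clip_residual M t : 0 <= M -> `|t - clip M t| <= `|t|.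
Proof.
move=> M0; have [h|h] := leP `|t| M; first by rewrite clip_id // subrr normr0.
have [t0|t0] := leP 0 t.
  rewrite (ger0_norm t0) in h *; rewrite /clip (min_idPr (ltW h)) (max_idPr _); last by lra.
  by rewrite ger0_norm; lra.
rewrite (ltr0_norm t0) in h *.
have tM : t <= M by lra.
rewrite /clip (min_idPl tM) (max_idPl _); last by lra.
by rewrite ler0_norm; lra.
Qed.

Lemma clip_continuous M : continuous (clip M).
Proof.
move=> t; apply/cvgrPdist_lt => e e0; apply/nbhs_ballP; exists e => //= s ts.
exact: le_lt_trans (clip_lipschitz _ _ _) ts.
Qed.

Lemma clip_measurable M v : measurable_fun D v -> measurable_fun D (clip M \o v).
Proof.
move=> mv; apply: measurableT_comp => //.
exact: continuous_measurable_fun (@clip_continuous M).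
Qed.

Lemma nrm_clip g b v (e : R) : L2w T g b v -> 0 < e ->
  exists2 M : R, 0 <= M & nrm T g b (fun x => v x - clip M (v x)) <= e.
Proof.
move=> [mv iv] e0.
have lim : (\int[mu]_(x in D) (omega T g b x * (v x - clip n%:R (v x)) ^+ 2))
    @[n --> \oo] --> \int[mu]_(x in D) (fun=> 0) x.
  apply: (Rint_dominated (mdom T) _ _ iv).
  - move=> n; apply: measurable_wsq => //; apply: measurable_funB => //.
    exact: clip_measurable.
  - exact: measurable_cst.
  - move=> x Dx; apply: cvg_near_cst.
    exists (Num.truncn `|v x|).+1 => // n /= hn.
    rewrite clip_id ?subrr ?expr0n ?mulr0 //.
    apply: ltW; apply: lt_le_trans (truncnS_gt _) _; by rewrite ler_nat.
  - move=> n x Dx; rewrite normrM (ger0_norm (omega_ge0 _ _ _ _)).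
    rewrite ler_wpM2l ?omega_ge0 // ger0_norm ?sqr_ge0 //.
    rewrite -[leLHS]real_normK ?num_real // -[leRHS]real_normK ?num_real //.
    rewrite lerXn2r ?nnegrE //.
    exact: clip_residual.
have I0 : \int[mu]_(x in D) (fun=> 0 : R) x = 0.
  transitivity (0 * \int[mu]_(x in D) (fun=> 0 : R) x); last by rewrite mul0r.
  rewrite -(RintZ (mdom T) 0 (intg_cst T_gt0 0)); apply: Rint_eq => x _.
  by rewrite mul0r.
rewrite I0 in lim.
have [n _ hn] := cvgr_lt _ lim _ (exprn_gt0 2 e0).
exists n%:R; first exact: ler0n.
rewrite -(@ler_pXn2r _ 2) ?nnegrE ?nrm_ge0 ?(ltW e0) // nrm_sq.
apply: ltW; have := hn n (leqnn n); congr (_ < _).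
by apply: Rint_eq => x _; ring.
Qed.

(** Truncate [v], approximate the truncation in L^1 by a continuous function truncated at the same
    level, and apply Weierstrass. The common bound [M] converts L^1 closeness into weighted L^2
    closeness, because [(x - y)^2 <= 2 M |x - y|]. *)
Lemma poly_dense g b v (e : R) : 0 <= g -> 0 <= b -> L2w T g b v -> 0 < e ->
  exists p : {poly R}, nrm T g b (fun x => v x - p.[x]) <= e.
Proof.
move=> g0 b0 v2 e0; have e3 : 0 < e / 3 by rewrite divr_gt0.
have [M M0 hM] := nrm_clip v2 e3.
pose vM := clip M \o v.
have mvM : measurable_fun D vM by apply: clip_measurable; case: v2.
have vMb x : D x -> `|vM x| <= M by move=> _; exact: clip_bound.
have vM2 : L2w T g b vM := L2w_bounded T_gt0 g0 b0 mvM vMb.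
pose W := T `^ g * T `^ b + 1.
have W0 : 0 < W by rewrite ltr_wpDl // mulr_ge0 ?powR_ge0.
have Wb x : D x -> omega T g b x <= W.
  by move=> Dx; rewrite (le_trans (omega_bound T_gt0 g0 b0 Dx)) // lerDl.
have ivM : intg D vM := intg_bounded T_gt0 mvM vMb.
have muD : (mu (`]0%R, T[%classic) < +oo)%E.
  by rewrite lebesgue_measure_itv/= lte_fin T_gt0 -EFinB ltry.
have [h_ [ch _ hlim]] := approximation_continuous_integrable (mdom T) muD ivM.
(* Chosen so that [W (2 M + 1) d = (e / 3)^2]; the [+ 1] avoids a zero denominator when [M = 0]. *)
pose d := (e / 3) ^+ 2 / (W * (2 * M + 1)).
have d0 : 0 < d by rewrite divr_gt0 ?exprn_gt0 // mulr_gt0 // ltr_wpDl // mulr_ge0.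
have [n _ hn] : \forall n \near \oo, (\int[mu]_(z in D) `|(vM z - h_ n z)%:E| < d%:E)%E.
  move/fine_cvgP: hlim => [hfin hl].
  have hd : \forall n \near \oo, fine (\int[mu]_(z in D) `|(vM z - h_ n z)%:E|)%E < d.
    by apply: (cvgr_lt _ hl).
  by apply: filterS2 hfin hd => n fn; rewrite -[X in _ -> (X < _)%E](fineK fn) lte_fin.
have {hn} := hn n (leqnn n).
set h0 := h_ n; have ch0 : continuous h0 := ch n.
move=> hn; pose h := clip M \o h0.
have ch' : continuous h.
  by move=> x; apply: (@continuous_comp R R R h0 (clip M) x); [exact: ch0|exact: clip_continuous].
have mh0 : measurable_fun D h0 by apply: measurable_funTS; exact: continuous_measurable_fun.
have mh : measurable_fun D h by apply: measurable_funTS; exact: continuous_measurable_fun.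
have h2 : L2w T g b h by exact: L2w_continuous.
have id : intg D (fun z => `|vM z - h0 z|).
  apply: ge0_intg.
  - by apply: measurableT_comp => //; exact: measurable_funB.
  - by [].
  - apply: lt_trans (ltry d); exact: hn.
have Id : \int[mu]_(z in D) `|vM z - h0 z| < d.
  by rewrite -lte_fin -(Rint_EFin (mdom T) id).
have hh : nrm T g b (fun x => vM x - h x) <= e / 3.
  rewrite -(@ler_pXn2r _ 2) ?nnegrE ?nrm_ge0 ?(ltW e3) // nrm_sq.
  apply: (@le_trans _ _ (W * (2 * M + 1) * d)); last first.
    by rewrite /d mulrC divfK // gt_eqF // mulr_gt0 // ltr_wpDl // mulr_ge0.
  apply: (@le_trans _ _ (W * (2 * M + 1) * \int[mu]_(z in D) `|vM z - h0 z|)); last first.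
    by rewrite ler_wpM2l ?(ltW Id) // mulr_ge0 ?(ltW W0) // addr_ge0 // mulr_ge0.
  rewrite -(RintZ (mdom T) _ id); apply: Rint_le.
  - exact: mdom.
  - by apply: L2w_prod; exact: L2wB.
  - exact: (intgZ (mdom T)).
  move=> x Dx; rewrite -expr2 -[(_ - _) ^+ 2]real_normK ?num_real // expr2 mulrC -mulrA.
  rewrite ler_pM ?omega_ge0 ?mulr_ge0 ?Wb // ler_pM //.
    have := clip_bound (h0 x) M0; have := vMb x Dx; have := ler_normB (vM x) (h x).
    rewrite /h /=; lra.
  have E : clip M (vM x) = vM x by apply: clip_id; exact: vMb.
  by rewrite -{1}E; exact: (clip_lipschitz M (vM x) (h0 x)).
pose e' := e / 3 / Num.sqrt (W * T).
have sW : 0 < Num.sqrt (W * T) by rewrite sqrtr_gt0 mulr_gt0.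
have e'0 : 0 < e' by rewrite divr_gt0.
have [p hp] := weierstrass T_gt0 ch' e'0.
exists p.
have p2 := L2w_poly T_gt0 p g0 b0.
have np : nrm T g b (fun x => h x - p.[x]) <= e / 3.
  rewrite -(@ler_pXn2r _ 2) ?nnegrE ?nrm_ge0 ?(ltW e3) // nrm_sq.
  have -> : (e / 3) ^+ 2 = \int[mu]_(x in D) (fun=> W * e' ^+ 2) x.
    rewrite Rintegral_cst; last exact: mdom.
    rewrite (_ : fine (mu D) = T); last first.
      have : mu (`]0%R, T[%classic) = T%:E by rewrite lebesgue_measure_itv/= lte_fin T_gt0 -EFinB subr0.
      by rewrite /dom => ->.
    rewrite /e' [(_ / Num.sqrt _) ^+ 2]expr_div_n sqr_sqrtr ?mulr_ge0 ?(ltW W0) ?(ltW T_gt0) //.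
    by field; rewrite (gt_eqF W0) (gt_eqF T_gt0).
  apply: Rint_le.
  - exact: mdom.
  - by apply: L2w_prod; exact: L2wB.
  - exact: intg_cst.
  move=> x Dx; rewrite -expr2 mulrC ler_pM ?omega_ge0 ?sqr_ge0 ?Wb //.
  rewrite -[leLHS]real_normK ?num_real // lerXn2r ?nnegrE ?(ltW e'0) //.
  by apply: hp; case: (domP Dx) => x0 xT; rewrite (ltW x0) (ltW xT).
have t1 := nrm_triang v2 vM2 p2; have t2 := nrm_triang vM2 h2 p2.
have -> : e = e / 3 + (e / 3 + e / 3) by field.
apply: le_trans t1 _; apply: lerD; first exact: hM.
by apply: le_trans t2 _; exact: lerD.
Qed.

End density.

(** * Orthogonal polynomials *)

Section monomials.
Variable F : fieldType.
Implicit Types p m : {poly F}.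

Lemma poly_monomials n p : (size p <= n)%N -> p = \sum_(k < n) p`_k *: 'X^k.
Proof.
move=> pn; rewrite -poly_def; apply/polyP => i; rewrite coef_poly; case: ltnP => // ni.
by rewrite nth_default // (leq_trans pn).
Qed.

Lemma coef_last_neq0 n m : size m = n.+1 -> m`_n != 0.
Proof. by move=> mn; rewrite -[n]/(n.+1.-1) -mn -lead_coefE lead_coef_eq0 -size_poly_eq0 mn. Qed.

Lemma size_cancel_last n p m : (size p <= n.+1)%N -> size m = n.+1 ->
  (size (p - (p`_n / m`_n) *: m)%R <= n)%N.
Proof.
move=> pn mn; apply/leq_sizeP => j; rewrite coefB coefZ leq_eqVlt => /predU1P[<-|nj].
  by rewrite divfK ?subrr // coef_last_neq0.
by rewrite (nth_default 0 (leq_trans pn nj)) (nth_default 0 (_ : size m <= j)%N) ?mn // mulr0 subrr.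
Qed.

End monomials.

Section orthogonal_polynomials.
Variable R : realType.
Local Notation mu := (@lebesgue_measure R).
Variables (T g b : R).
Hypothesis T_gt0 : 0 < T.
Hypothesis g_ge0 : 0 <= g.
Hypothesis b_ge0 : 0 <= b.
Local Notation D := (dom T).
Local Notation ip := (winner T g b).
Local Notation nm := (nrm T g b).
Local Notation L2 := (L2w T g b).
Implicit Types (p q r : {poly R}) (u v : R -> R) (P : nat -> {poly R}).

Let pL2 p : L2 (horner p). Proof. exact: L2w_poly. Qed.

Lemma horner_lin a p q : horner (a *: p + q) = (fun x => a * p.[x] + q.[x]).
Proof. by apply/funext => x; rewrite !hornerE. Qed.

Lemma ip_polyDZr a p q u : L2 u ->
  ip u (horner (a *: p + q)) = a * ip u (horner p) + ip u (horner q).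
Proof. by move=> u2; rewrite horner_lin ipDr ?ipZr //; exact: L2wZ. Qed.

Lemma ip_polyDZl a p q u : L2 u ->
  ip (horner (a *: p + q)) u = a * ip (horner p) u + ip (horner q) u.
Proof. by move=> u2; rewrite ipC ip_polyDZr // !(ipC _ _ _ u). Qed.

Lemma ip_poly0r u : L2 u -> ip u (horner 0) = 0.
Proof.
move=> u2; have := ip_polyDZr (-1) 0 0 u2; rewrite scaler0 addr0 mulN1r addNr //.
Qed.

Lemma ip_poly_sumr (I : Type) (r : seq I) (c : I -> R) (F : I -> {poly R}) u : L2 u ->
  ip u (horner (\sum_(i <- r) c i *: F i)) = \sum_(i <- r) c i * ip u (horner (F i)).
Proof.
move=> u2; elim: r => [|i r IH]; first by rewrite !big_nil ip_poly0r.
by rewrite !big_cons ip_polyDZr // IH.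
Qed.

Definition orth_upto (n : nat) u := forall q, (size q <= n)%N -> ip u (horner q) = 0.

(** One step of Gram-Schmidt: [m] is [X^n] minus its own projection on lower degrees, and the
    projection of [v] gains its component along [m]. *)
Lemma projection_exists n v : L2 v ->
  exists2 p : {poly R}, (size p <= n)%N & orth_upto n (fun x => v x - p.[x]).
Proof.
elim: n v => [|n IH] v v2.
  exists 0; first by rewrite size_poly0.
  move=> q; rewrite leqn0 size_poly_eq0 => /eqP ->; rewrite ip_poly0r //.
  exact: L2wB.
have [p pn po] := IH v v2.
have [e en eo] := IH _ (pL2 'X^n).
pose m := 'X^n - e.
have mo : orth_upto n (horner m).
  by move=> q qn; rewrite -(eo q qn); apply: ip_eq => // x _; rewrite /m !hornerE.
have mn : size m = n.+1.
  by rewrite /m size_polyDl size_polyXn // size_polyN ltnS.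
have m0 : m != 0 by rewrite -size_poly_eq0 mn.
have hm := lt0r_neq0 (ip_poly_gt0 T_gt0 g_ge0 b_ge0 m0).
pose c := ip v (horner m) / ip (horner m) (horner m).
exists (c *: m + p).
  rewrite (leq_trans (size_polyD _ _)) // geq_max (leqW pn) andbT.
  by rewrite (leq_trans (size_scale_leq _ _)) ?mn.
have vp2 : L2 (fun x => v x - p.[x]) by exact: L2wB.
have E u : L2 u -> ip (fun x => v x - (c *: m + p).[x]) u =
    ip (fun x => v x - p.[x]) u - c * ip (horner m) u.
  move=> u2; rewrite -ipZl // -ipBl //; last exact: L2wZ.
  by apply: ip_eq => // x _; rewrite !hornerE; ring.
move=> q qn; rewrite E //.
have -> : q = (q`_n / m`_n) *: m + (q - (q`_n / m`_n) *: m) by rewrite addrC subrK.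
have rn := size_cancel_last qn mn; set r := q - _ in rn *.
rewrite !ip_polyDZr // (po r rn) (mo r rn) !addr0.
have -> : ip (fun x => v x - p.[x]) (horner m) = ip v (horner m).
  by rewrite ipBl // (ipC _ _ _ (horner p)) (mo p pn) subr0.
by rewrite /c [X in _ - X]mulrCA divfK // subrr.
Qed.

Lemma ip_pythagoras u v : L2 u -> L2 v -> ip u v = 0 ->
  ip (fun x => u x + v x) (fun x => u x + v x) = ip u u + ip v v.
Proof.
move=> u2 v2 uv0; have uv2 := L2wD u2 v2.
by rewrite ipDl // !ipDr // (ipC _ _ _ v u) uv0 addr0 add0r.
Qed.

Lemma projection_best n v p q : L2 v -> (size p <= n)%N -> (size q <= n)%N ->
  orth_upto n (fun x => v x - p.[x]) ->
  nm (fun x => v x - p.[x]) <= nm (fun x => v x - q.[x]).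
Proof.
move=> v2 pn qn po; have vp2 : L2 (fun x => v x - p.[x]) by exact: L2wB.
have vq2 : L2 (fun x => v x - q.[x]) by exact: L2wB.
apply: ler_wsqrtr.
have -> : ip (fun x => v x - q.[x]) (fun x => v x - q.[x]) =
   ip (fun x => v x - p.[x]) (fun x => v x - p.[x]) +
   ip (horner (p - q)) (horner (p - q)).
  have -> : ip (fun x => v x - q.[x]) (fun x => v x - q.[x]) =
      ip (fun x => (v x - p.[x]) + (p - q).[x]) (fun x => (v x - p.[x]) + (p - q).[x]).
    by apply: ip_eq => x _; rewrite hornerD hornerN addrA subrK.
  have pq0 : ip (fun x => v x - p.[x]) (horner (p - q)) = 0.
    by apply: po; rewrite (leq_trans (size_polyD _ _)) // geq_max pn size_polyN.
  exact: ip_pythagoras.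
by rewrite lerDl ip_ge0.
Qed.

(** No normalisation is imposed, so that the Jacobi polynomials qualify as well as an abstract
    Gram-Schmidt basis. *)
Definition orth_family P :=
  forall n, size (P n) = n.+1 /\ orth_upto n (horner (P n)).

Lemma orth_family_exists : exists P, orth_family P.
Proof.
have H n : exists m : {poly R}, size m = n.+1 /\ orth_upto n (horner m).
  have [e en eo] := projection_exists n (pL2 'X^n).
  exists ('X^n - e); split; first by rewrite size_polyDl size_polyXn // size_polyN ltnS.
  by move=> q qn; rewrite -(eo q qn); apply: ip_eq => // x _; rewrite !hornerE.
by have [P PP] := choice H; exists P.
Qed.

Section family.
Variable P : nat -> {poly R}.
Hypothesis oP : orth_family P.

Definition hsq n := ip (horner (P n)) (horner (P n)).

Lemma orth_neq0 n : P n != 0.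
Proof. by rewrite -size_poly_eq0; case: (oP n) => ->. Qed.

Lemma hsq_gt0 n : 0 < hsq n.
Proof. exact: ip_poly_gt0 (orth_neq0 n). Qed.

Lemma orth_ip i j : i != j -> ip (horner (P i)) (horner (P j)) = 0.
Proof.
have [si oi] := oP i; have [sj oj] := oP j.
case: (ltngtP i j) => // ij _.
  by rewrite ipC; apply: oj; rewrite si.
by apply: oi; rewrite sj.
Qed.

(** Subtracting the multiple of [P n] with the same coefficient of degree [n] leaves a polynomial of
    lower degree, orthogonal to itself. *)
Lemma orth_lead n (q : {poly R}) : (size q <= n.+1)%N ->
  (forall r, (size r <= n)%N -> ip (horner q) (horner r) = 0) ->
  q = (q`_n / (P n)`_n) *: P n.
Proof.
move=> qn qo; have [sn on] := oP n.
apply/eqP; rewrite -subr_eq0; apply/eqP.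
have dn := size_cancel_last qn sn; set d := q - _ in dn *.
apply: (ip_poly_eq0 T_gt0 g_ge0 b_ge0).
have dE : d = - (q`_n / (P n)`_n) *: P n + q by rewrite /d scaleNr addrC.
by rewrite {1}dE ip_polyDZl // qo // on // mulr0 addr0.
Qed.

Definition coefs u n := ip u (horner (P n)) / hsq n.

Lemma orth_expansion n q : (size q <= n)%N ->
  q = \sum_(k < n) coefs (horner q) k *: P k.
Proof.
elim: n q => [|n IH] q.
  by rewrite leqn0 size_poly_eq0 big_ord0 => /eqP.
move=> qn; have [sn on] := oP n.
pose c := q`_n / (P n)`_n; pose r := q - c *: P n.
have rn : (size r <= n)%N := size_cancel_last qn sn.
have qE : q = c *: P n + r by rewrite /r addrC subrK.
have rE := IH r rn.
have cn : coefs (horner q) n = c.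
  rewrite /coefs {1}qE ip_polyDZl // [ip (horner r) _]ipC (on r rn) addr0.
  by rewrite mulfK // gt_eqF // hsq_gt0.
rewrite big_ord_recr /= cn {1}qE addrC; congr (_ + _); rewrite {1}rE.
apply: eq_bigr => k _; congr (_ *: _); rewrite /coefs qE ip_polyDZl //.
by rewrite orth_ip ?mulr0 ?add0r // gtn_eqF.
Qed.

Lemma ip_orth_sum n (c d : nat -> R) :
  ip (horner (\sum_(k < n) c k *: P k)) (horner (\sum_(k < n) d k *: P k)) =
  \sum_(k < n) c k * d k * hsq k.
Proof.
rewrite ip_poly_sumr //; apply: eq_bigr => k _.
rewrite ipC ip_poly_sumr // (bigD1 k) //= big1 ?addr0; first by rewrite mulrA (mulrC (d k)).
move=> j jk; rewrite orth_ip ?mulr0 //.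
by apply: contra jk => /eqP e; apply/eqP/val_inj.
Qed.

Lemma parseval n q : (size q <= n)%N ->
  ip (horner q) (horner q) = \sum_(k < n) coefs (horner q) k ^+ 2 * hsq k.
Proof.
by move=> qn; rewrite {1 2}(orth_expansion qn) ip_orth_sum; apply: eq_bigr => k _; rewrite expr2.
Qed.

Lemma projE n u : L2 u ->
  orth_upto n (fun x => u x - (\sum_(k < n) coefs u k *: P k).[x]).
Proof.
move=> u2 q qn; rewrite ipBl // (orth_expansion qn) ip_orth_sum ip_poly_sumr // -sumrB big1 // => k _.
by rewrite /coefs; field; rewrite gt_eqF // hsq_gt0.
Qed.

Lemma size_orth_sum n (c : nat -> R) : (size ((\sum_(k < n) c k *: P k)%R : {poly R}) <= n)%N.
Proof.
rewrite (leq_trans (size_sum _ _ _)) //; apply/bigmax_leqP => k _.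
by rewrite (leq_trans (size_scale_leq _ _)) //; case: (oP k) => ->.
Qed.

End family.

End orthogonal_polynomials.

(** * The Caputo derivative on polynomials *)

Section finite_differences.
Variable R : realType.

Lemma alternating_binomialS n (f : nat -> R) :
  \sum_(i < n.+2) (-1) ^+ i * 'C(n.+1, i)%:R * f i =
  \sum_(i < n.+1) (-1) ^+ i * 'C(n, i)%:R * (f i - f i.+1).
Proof.
rewrite big_ord_recl /= expr0 bin0 !mul1r.
under eq_bigr => i _ do rewrite /bump leq0n add1n binS natrD mulrDr mulrDl.
rewrite big_split /= addrA.
under [RHS]eq_bigr => i _ do rewrite mulrBr.
rewrite sumrB; congr (_ + _); last first.
  rewrite -sumrN; apply: eq_bigr => i _.
  by rewrite exprS mulN1r !mulNr.
transitivity (\sum_(i < n.+2) (-1) ^+ i * 'C(n, i)%:R * f i).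
  by rewrite [RHS]big_ord_recl /= expr0 bin0 !mul1r.
by rewrite big_ord_recr /= bin_small // mulr0 mul0r addr0.
Qed.

Lemma size_difference_poly n (p : {poly R}) : (size p <= n.+1)%N ->
  (size ((p - (p \Po ('X + 1%:P)))%R : {poly R}) <= n)%N.
Proof.
move=> pn; apply/leq_sizeP => j nj; rewrite coefB.
have sX : size ('X + 1%:P : {poly R}) = 2%N by rewrite size_XaddC.
have sc : size (p \Po ('X + 1%:P)) = size p by rewrite size_comp_poly2.
have [ps|ps] := leqP (size p) j.
  by rewrite !nth_default ?subrr // sc.
have pj : (size p).-1 = j.
  by apply/eqP; rewrite eqn_leq -ltnS prednK ?(leq_trans _ ps) // (leq_trans pn) //= -ltnS prednK // (leq_ltn_trans _ ps).
rewrite -{1}pj -[X in _ - _`_X]pj -{2}sc -!lead_coefE lead_coef_comp ?sX //.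
by rewrite lead_coefXaddC expr1n mulr1 subrr.
Qed.

(** Each use of Pascal's rule replaces [p] by [p(X) - p(X + 1)], of lower degree, until the zero
    polynomial is reached. *)
Lemma alternating_binomial_poly n (p : {poly R}) : (size p <= n)%N ->
  \sum_(i < n.+1) (-1) ^+ i * 'C(n, i)%:R * p.[i%:R] = 0.
Proof.
elim: n p => [|n IH] p.
  rewrite leqn0 size_poly_eq0 => /eqP ->.
  by rewrite big1 // => i _; rewrite horner0 mulr0.
move=> pn; rewrite (alternating_binomialS n (fun i => p.[i%:R])).
rewrite -[RHS](IH _ (size_difference_poly pn)); apply: eq_bigr => i _.
by rewrite hornerD hornerN horner_comp !hornerE natr1.
Qed.

End finite_differences.

(** * Positivity of the quadratic form by partial fractions *)

Section partial_fractions.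
Variable R : realType.
Variable alpha : R.
Hypothesis alpha_gt0 : 0 < alpha.
Hypothesis alpha_lt1 : alpha < 1.

(* The residue of the product at [- n] is [alpha] times its value there, which is positive
   because all the zeros and poles interlace. *)
Lemma gamma_ratio_partial_fractions n : exists r : nat -> R,
  (forall k, 0 <= r k) /\
  forall x, (forall k, (k < n)%N -> x + k%:R != 0) ->
    \prod_(l < n) ((x + l%:R + alpha) / (x + l%:R)) =
    1 + \sum_(k < n) r k / (x + k%:R).
Proof.
elim: n => [|n [r [r0 IH]]].
  by exists (fun=> 0); split => // x _; rewrite !big_ord0 addr0.
have nk k : (k < n)%N -> - n%:R + k%:R != 0 :> R.
  by move=> kn; rewrite addrC subr_eq0 eqr_nat ltn_eqF.
(* In the product at [x = - n] each numerator [l - n + alpha] is nonpositive, as [alpha < 1], and so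
   is each denominator [l - n]. *)
have val : 0 <= 1 + \sum_(k < n) r k / (- n%:R + k%:R).
  rewrite -IH //; apply: prodr_ge0 => l _.
  rewrite -mulrNN -invrN; apply: divr_ge0; rewrite oppr_ge0.
    have : l.+1%:R <= n%:R :> R by rewrite ler_nat.
    have key (a c : R) : c + 1 <= a -> - a + c + alpha <= 0.
      by move=> h; have a1 := alpha_lt1; lra.
    by rewrite -[l.+1%:R]natr1; exact: key.
  have : l%:R <= n%:R :> R by rewrite ler_nat ltnW.
  have key (a c : R) : c <= a -> - a + c <= 0 by move=> h; lra.
  exact: key.
pose rn := alpha * (1 + \sum_(k < n) r k / (- n%:R + k%:R)).
(* The cross terms are split by [1 / ((x + k) (x + n)) = (1 / (x + k) - 1 / (x + n)) / (n - k)]: old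
   residues gain the factor [1 + alpha / (n - k)], and the rest is collected at [- n]. *)
exists (fun k => if k == n then rn else r k * (1 + alpha / (n%:R - k%:R)) *+ (k < n)).
split.
  move=> k; case: eqP => _; first by rewrite mulr_ge0 // ltW.
  case: ltnP => kn; rewrite ?mulr0n ?mulr1n // mulr_ge0 // addr_ge0 //.
  by rewrite divr_ge0 ?(ltW alpha_gt0) // subr_ge0 ler_nat ltnW.
move=> x hx; rewrite big_ord_recr /= IH; last by move=> k kn; apply: hx; rewrite ltnS ltnW.
rewrite [in RHS]big_ord_recr /= eqxx.
have hn := hx n (ltnSn n).
rewrite [X in _ = _ + (X + _)](eq_bigr (fun k : 'I_n => r k / (x + k%:R) + alpha / (x + n%:R) * (r k / (x + k%:R)) +
    alpha / (x + n%:R) * (r k / (n%:R - k%:R)))); last first.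
  move=> k _; rewrite ltn_eqF // ltn_ord mulr1n.
  have hk := hx k (ltnW (ltn_ord k)).
  have h1 : n%:R - k%:R != 0 :> R by rewrite subr_eq0 eqr_nat gtn_eqF.
  by field; rewrite hn h1 hk.
rewrite !big_split /= -!mulr_sumr /rn.
have -> : \sum_(k < n) r k / (- n%:R + k%:R) = - \sum_(k < n) r k / (n%:R - k%:R).
  by rewrite -sumrN; apply: eq_bigr => k _; rewrite -mulrN -invrN opprB addrC.
by field.
Qed.

End partial_fractions.

Section positivity.
Variable R : realType.
Variable alpha : R.
Hypothesis alpha_gt0 : 0 < alpha.
Hypothesis alpha_lt1 : alpha < 1.

(** Up to the factor [T^(2 alpha + 1)], the Gram matrix of the monomials on [(0, T)] for the weight
    [t^(2 alpha)]. Its positivity is taken as a section hypothesis, so that the argument below is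
    purely algebraic up to one limit. *)
Let gram (T : R) i j := T ^+ (i + j) / (2 * alpha + (i + j)%:R + 1).

Hypothesis gram_ge0 : forall T n (p : nat -> R), 0 < T ->
  0 <= \sum_(i < n) \sum_(j < n) p i * p j * gram T i j.

(** Adding the transposed sum makes the weight [(2 alpha + i + j + 1) + (1 + 2 c)]: the first part
    cancels the denominator of [gram] and leaves the square of [sum p_i T^i], the second is a
    nonnegative multiple of the Gram form. *)
Lemma gram_sym_ge0 T n (p : nat -> R) (c : R) : 0 < T -> 0 <= c ->
  0 <= \sum_(i < n) \sum_(j < n) p i * p j * gram T i j * (alpha + i%:R + 1 + c).
Proof.
move=> T0 c0; set S := \sum_(i < n) _.
have SE : S = \sum_(i < n) \sum_(j < n) p i * p j * gram T i j * (alpha + j%:R + 1 + c).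
  rewrite /S exchange_big; apply: eq_bigr => i _; apply: eq_bigr => j _.
  by rewrite /gram addnC; ring.
have : S + S = (\sum_(i < n) p i * T ^+ i) ^+ 2 +
    (1 + 2 * c) * \sum_(i < n) \sum_(j < n) p i * p j * gram T i j.
  rewrite {1}SE /S -big_split /= expr2 mulr_suml mulr_sumr -big_split /=.
  apply: eq_bigr => i _; rewrite -big_split /= mulr_sumr mulr_sumr -big_split /=.
  apply: eq_bigr => j _; rewrite /gram exprD natrD.
  have h : 2 * alpha + (i%:R + j%:R) + 1 != 0.
    by rewrite gt_eqF // ltr_wpDl // addr_ge0 ?addr_ge0 // mulr_ge0 // ltW.
  by field.
have g0 := gram_ge0 n p T0.
move=> SS; have : 0 <= S + S.
  by rewrite SS addr_ge0 ?sqr_ge0 // mulr_ge0 // addr_ge0 // mulr_ge0.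
by rewrite -mulr2n pmulrn_lge0.
Qed.

(** By partial fractions the weight is a nonnegative combination of [1] and of the
    [1 / (alpha + i + 1 + k)]. Each of the latter turns into the weight of [gram_sym_ge0] once [q_i]
    is replaced by [q_i / (alpha + i + 1 + k)]. *)
Lemma gram_weight_ge0 T n (q : nat -> R) (w : nat -> R) m : 0 < T ->
  (forall i, w i = \prod_(l < m) ((alpha + i%:R + 1 + l%:R + alpha) / (alpha + i%:R + 1 + l%:R))) ->
  0 <= \sum_(i < n) \sum_(j < n) q i * q j * gram T i j * w i.
Proof.
move=> T0 wE; have [r [r0 rE]] := gamma_ratio_partial_fractions alpha_gt0 alpha_lt1 m.
have x0 i k : 0 < alpha + i%:R + 1 + k%:R by rewrite ltr_wpDr // ltr_wpDl // addr_ge0 // ltW.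
have -> : \sum_(i < n) \sum_(j < n) q i * q j * gram T i j * w i =
    \sum_(i < n) \sum_(j < n) q i * q j * gram T i j +
    \sum_(k < m) r k * \sum_(i < n) \sum_(j < n)
      (q i / (alpha + i%:R + 1 + k%:R)) * (q j / (alpha + j%:R + 1 + k%:R)) * gram T i j *
        (alpha + j%:R + 1 + k%:R).
  under [X in _ = _ + X]eq_bigr => k _ do rewrite mulr_sumr.
  rewrite [X in _ = _ + X]exchange_big /= -big_split /=; apply: eq_bigr => i _.
  under [X in _ = _ + X]eq_bigr => k _ do rewrite mulr_sumr.
  rewrite [X in _ = _ + X]exchange_big /= -big_split /=; apply: eq_bigr => j _.
  rewrite wE rE; last by move=> k _; rewrite gt_eqF.
  rewrite mulrDr mulr1 mulr_sumr; congr (_ + _); apply: eq_bigr => k _.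
  have hi := lt0r_neq0 (x0 i k); have hj := lt0r_neq0 (x0 j k).
  by field; rewrite hi hj.
rewrite addr_ge0 ?gram_ge0 // sumr_ge0 // => k _; rewrite mulr_ge0 //.
rewrite exchange_big /=.
have := gram_sym_ge0 n (fun i => q i / (alpha + i%:R + 1 + k%:R)) T0 (ler0n R k).
congr (0 <= _); apply: eq_bigr => i _; apply: eq_bigr => j _.
by rewrite /gram addnC; ring.
Qed.

Lemma cvg_ord_sum n (F : nat -> nat -> R) (l : nat -> R) :
  (forall i, F i m @[m --> \oo] --> l i) ->
  \sum_(i < n) F i m @[m --> \oo] --> \sum_(i < n) l i.
Proof.
move=> Fl; elim: n => [|n IH].
  rewrite (_ : (fun m => _) = (fun=> 0)); last by apply/funext => m; rewrite big_ord0.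
  by rewrite big_ord0; exact: cvg_cst.
rewrite (_ : (fun m => _) = (fun m => \sum_(i < n) F i m + F n m)).
  by rewrite big_ord_recr /=; apply: cvgD.
by apply/funext => m; rewrite big_ord_recr.
Qed.

(* [b] is a positive multiple of [i |-> Beta (alpha + i + 1, alpha)]. *)
Lemma gram_beta_ge0 T n (q b : nat -> R) : 0 < T ->
  (forall i, 0 < b i) ->
  (forall i, (2 * alpha + i%:R + 1) * b i.+1 = (alpha + i%:R + 1) * b i) ->
  0 <= \sum_(i < n) \sum_(j < n) q i * q j * gram T i j * b i.
Proof.
move=> T0 b0 brec.
pose w m i := \prod_(l < m) ((alpha + i%:R + 1 + l%:R + alpha) / (alpha + i%:R + 1 + l%:R)).
have x0 i k : 0 < alpha + i%:R + 1 + k%:R by rewrite ltr_wpDr // ltr_wpDl // addr_ge0 // ltW.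
(* The recurrence iterated from [i] to [i + m]: [w m i] is the telescoped ratio [b_i / b_(i+m)]. *)
have bE m i : b i = b (i + m)%N * w m i.
  elim: m => [|m IH]; first by rewrite addn0 /w big_ord0 mulr1.
  rewrite IH /w big_ord_recr /= addnS -/(w m i).
  have := brec (i + m)%N; rewrite natrD.
  have h := lt0r_neq0 (x0 i m).
  move=> e; have {}e : b (i + m).+1 * (alpha + i%:R + 1 + m%:R + alpha) =
    (alpha + i%:R + 1 + m%:R) * b (i + m)%N by rewrite -[RHS]mulrC; move: e; lra.
  rewrite [LHS]mulrC [RHS]mulrCA; congr (_ * _).
  by apply: (mulIf h); rewrite -mulrA divfK // e mulrC.
(* Hence [b m * w m i] tends to [b i]: the finite products, for which positivity is known, converge
   to [b] after multiplication by a factor common to all [i]. *)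
have cvb i : (b m / b (i + m)%N) @[m --> \oo] --> (1 : R).
  elim: i => [|i IH].
    rewrite (_ : (fun m => _) = (fun=> 1)); first exact: cvg_cst.
    by apply/funext => m; rewrite add0n divff // gt_eqF.
  rewrite (_ : (fun m => _) = (fun m => b m / b (i + m)%N *
     (1 + alpha / (alpha + i%:R + m%:R + 1)))); last first.
    apply/funext => m; rewrite addSn -[RHS]mulrA; congr (_ * _).
    have h : alpha + i%:R + m%:R + 1 != 0.
      by rewrite gt_eqF // ltr_wpDl // addr_ge0 // addr_ge0 // ltW.
    have hb := lt0r_neq0 (b0 (i + m)%N); have hb' := lt0r_neq0 (b0 (i + m).+1).
    have := brec (i + m)%N; rewrite natrD => e.
    apply: (mulfI hb'); rewrite divff //; apply: (mulfI h); rewrite mulr1.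
    transitivity ((alpha + i%:R + m%:R + 1) * b (i + m)%N / b (i + m)%N); first by rewrite mulfK.
    have -> : (alpha + i%:R + m%:R + 1) * b (i + m)%N =
      (2 * alpha + i%:R + m%:R + 1) * b (i + m).+1 by move: e; lra.
    by field; rewrite h hb.
  rewrite -[X in _ --> X]mulr1; apply: cvgM => //.
  rewrite -[X in _ --> X]addr0; apply: cvgD; first exact: cvg_cst.
  rewrite -(mulr0 alpha); apply: cvgM; first exact: cvg_cst.
  apply/gtr0_cvgV0.
    apply: nearW => m; by rewrite ltr_wpDl // addr_ge0 // addr_ge0 // ltW.
  apply: (@ger_cvgy _ _ _ _ (fun m => m%:R)); last exact: cvgr_idn.
  by apply: nearW => m /=; rewrite addrAC lerDr addr_ge0 // addr_ge0 // ltW.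
have lim : (\sum_(i < n) \sum_(j < n) q i * q j * gram T i j * (b m * w m i))
    @[m --> \oo] --> \sum_(i < n) \sum_(j < n) q i * q j * gram T i j * b i.
  apply: (@cvg_ord_sum n (fun i m => \sum_(j < n) q i * q j * gram T i j * (b m * w m i))
    (fun i => \sum_(j < n) q i * q j * gram T i j * b i)) => i.
  apply: (@cvg_ord_sum n (fun j m => q i * q j * gram T i j * (b m * w m i))
    (fun j => q i * q j * gram T i j * b i)) => j.
  apply: cvgM; first exact: cvg_cst.
  rewrite (_ : (fun m => _) = (fun m => b m / b (i + m)%N * b i)).
    by rewrite -[X in _ --> X]mul1r; apply: cvgM => //; exact: cvg_cst.
  by apply/funext => m; rewrite [X in _ = _ * X](bE m i) mulrA divfK // gt_eqF.
rewrite -(cvg_lim (@Rhausdorff R) lim); apply: limr_ge; first exact: cvgP lim.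
apply: nearW => m.
have -> : \sum_(i < n) \sum_(j < n) q i * q j * gram T i j * (b m * w m i) =
    b m * \sum_(i < n) \sum_(j < n) q i * q j * gram T i j * w m i.
  rewrite mulr_sumr; apply: eq_bigr => i _; rewrite mulr_sumr; apply: eq_bigr => j _.
  by ring.
by rewrite mulr_ge0 ?(ltW (b0 _)) //; apply: gram_weight_ge0.
Qed.

End positivity.

(** * The Caputo derivative as an operator on polynomials *)

Section shifted_operator.
Variable R : realType.
Local Notation mu := (@lebesgue_measure R).
Variables (T alpha : R).
Hypothesis T_gt0 : 0 < T.
Hypothesis alpha_gt0 : 0 < alpha.
Hypothesis alpha_lt1 : alpha < 1.
Local Notation D := (dom T).
Implicit Types (p q v : {poly R}).

(** This is [Gamma(alpha + j + 1) / Gamma(j + 1)]: the factor before the product equals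
    [Gamma(alpha + 1)], since [B(1 - alpha, alpha) = Gamma(1 - alpha) Gamma(alpha)]. In this form
    all that is asked of [Gamma] is that [Gamma (1 - alpha)] be positive. *)
Definition caputo_coef (j : nat) : R :=
  alpha * bfun 0 1 (1 - alpha) alpha / Gamma (1 - alpha) *
  \prod_(i < j) ((alpha + i%:R + 1) / (i%:R + 1)).

Definition diag_poly (c : nat -> R) p := \poly_(i < size p) (c i * p`_i).

Lemma coef_diag_poly c p i : (diag_poly c p)`_i = c i * p`_i.
Proof.
rewrite coef_poly; case: ltnP => // h.
by rewrite nth_default ?mulr0.
Qed.

Lemma size_diag_poly c p : (size (diag_poly c p) <= size p)%N.
Proof. exact: size_poly. Qed.

Lemma diag_poly_is_linear c a p q :
  diag_poly c (a *: p + q) = a *: diag_poly c p + diag_poly c q.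
Proof.
apply/polyP => i; rewrite coefD coefZ !coef_diag_poly coefD coefZ; ring.
Qed.

Lemma diag_poly_comp c d p :
  diag_poly c (diag_poly d p) = diag_poly (fun i => c i * d i) p.
Proof. by apply/polyP => i; rewrite !coef_diag_poly mulrA. Qed.

Lemma diag_poly1 c p : (forall i, c i = 1) -> diag_poly c p = p.
Proof. by move=> c1; apply/polyP => i; rewrite coef_diag_poly c1 mul1r. Qed.

Definition flip p := p \Po (T%:P - 'X).

Lemma flipE p t : (flip p).[t] = p.[T - t].
Proof. by rewrite /flip horner_comp !hornerE. Qed.

Lemma flip_linear a p q : flip (a *: p + q) = a *: flip p + flip q.
Proof. by rewrite /flip comp_polyD comp_polyZ. Qed.

Lemma flipK : involutive flip.
Proof.
move=> p; rewrite /flip -comp_polyA comp_polyB comp_polyC comp_polyX.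
by rewrite opprB addrC subrK comp_polyXr.
Qed.

Lemma size_flip p : size (flip p) = size p.
Proof.
rewrite /flip size_comp_poly2 //.
by rewrite -opprB size_polyN size_XsubC.
Qed.

(* [S ((T - X)^j) = c_j (T - X)^j]: the right Caputo derivative of
   [(T - t)^alpha p(t)] is [(S p)(t)]. *)
Definition caputo_poly p := flip (diag_poly caputo_coef (flip p)).

Definition caputo_poly_inv p :=
  flip (diag_poly (fun i => (caputo_coef i)^-1) (flip p)).

Lemma caputo_poly_linear a p q :
  caputo_poly (a *: p + q) = a *: caputo_poly p + caputo_poly q.
Proof. by rewrite /caputo_poly flip_linear diag_poly_is_linear flip_linear. Qed.

Lemma size_caputo_poly p : (size (caputo_poly p) <= size p)%N.
Proof. by rewrite size_flip (leq_trans (size_diag_poly _ _)) // size_flip. Qed.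

Lemma size_caputo_poly_inv p : (size (caputo_poly_inv p) <= size p)%N.
Proof. by rewrite size_flip (leq_trans (size_diag_poly _ _)) // size_flip. Qed.

(* Integrability of the Gamma integrand; the integral would otherwise be a
   junk value. *)
Lemma Gamma_gt0 (z : R) : 0 < z -> z < 1 -> 0 < Gamma z.
Proof.
move=> z0 z1; rewrite /Gamma.
pose f (t : R) := t `^ (z - 1) * expR (- t).
have mpos : measurable (`]0%R, +oo[%classic : set (measurableTypeR R)) by exact: measurable_itv.
have cf : {in `]0, +oo[, continuous f}.
  move=> t; rewrite in_itv/= andbT => t0; apply: cvgM.
    exact: (is_derive_continuous (is_derive1_powR (z - 1) t0)).
  apply: (@continuous_comp R R R (fun t => - t) expR t); last exact: continuous_expR.
  exact: oppr_continuous.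
have mf : measurable_fun (`]0, +oo[%classic : set R) f.
  apply: subspace_continuous_measurable_fun => //.
  by apply: continuous_in_subspaceT => x; rewrite inE/= => xab; exact: cf.
have f0 t : 0 <= f t by rewrite mulr_ge0 ?powR_ge0 ?expR_ge0.
pose h (t : R) := expR (- t).
have i1 : intg `]0, 1[ (fun t : R => (t - 0) `^ (z - 1)) by exact: integrable_powRl.
have cexp : continuous h.
  move=> t; apply: (@continuous_comp R R R (fun t => - t) expR t); last exact: continuous_expR.
  exact: oppr_continuous.
have dexp (t : R) : is_derive t 1 (fun t : R => - expR (- t)) (h t).
  have dn : is_derive t 1 (fun t : R => - t) (- 1).
    exact: is_deriveN.
  have d1 := is_derive1_comp (is_derive_expR (- t)) dn.
  apply: (is_derive_ext (is_deriveN d1)) => //.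
  by rewrite mulrN1 opprK.
have i2 : (\int[mu]_(t in `[1%R, +oo[) (h t)%:E = (expR (-1))%:E)%E.
  rewrite (@ge0_continuous_FTC2y R h (fun t => - expR (- t)) 1 0).
  - by rewrite sub0e -EFinN opprK.
  - by move=> t _; exact: expR_ge0.
  - exact: continuous_subspaceT.
  - rewrite -oppr0; apply: cvgN.
    exact: cvgr_expR.
  - by move=> t _; case: (dexp t).
  - apply: cvg_at_right_filter; exact: is_derive_continuous (dexp 1).
  - by move=> t _; rewrite derive1E; case: (dexp t) => _ ->.
have m01 := @measurable_oo R 0 1.
have m1y : measurable (`[1%R, +oo[%classic : set (measurableTypeR R)) by exact: measurable_itv.
(* The integrand is dominated by [t^(z - 1)] to the left of [1] and by [exp(- t)] to its right. *)
have split : `]0%R, +oo[%classic = `]0%R, 1%R[%classic `|` `[1%R, +oo[%classic :> set R.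
  by rewrite -(@itv_bndbnd_setU _ _ (BRight 0) (BLeft 1) +oo%O) // bnd_simp.
have fin : (\int[mu]_(t in `]0%R, +oo[) (f t)%:E < +oo)%E.
  rewrite split ge0_integral_setU //=.
  - apply: lte_add_pinfty.
      apply: (@le_lt_trans _ _ (\int[mu]_(t in `]0%R, 1%R[) ((t - 0) `^ (z - 1))%:E)%E).
        apply: ge0_le_integral => //.
        + by move=> t _; rewrite lee_fin.
        + apply/measurable_EFinP; apply: measurable_funS mf => //.
          by rewrite split; exact: subsetUl.
        + by apply/measurable_EFinP; exact: intg_measurable i1.
        + move=> t; rewrite /= in_itv/= => /andP[t0 t1].
          rewrite lee_fin /f subr0 ler_piMr ?powR_ge0 //.
          by rewrite -expR0 ler_expR oppr_le0 ltW.
      by rewrite (Rint_EFin m01 i1) ltry.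
    apply: (@le_lt_trans _ _ (\int[mu]_(t in `[1%R, +oo[) (h t)%:E)%E); last by rewrite i2 ltry.
    apply: ge0_le_integral => //.
    + by move=> t _; rewrite lee_fin.
    + apply/measurable_EFinP; apply: measurable_funS mf => //.
      by rewrite split; exact: subsetUr.
    + apply/measurable_EFinP; apply: measurable_funTS; exact: continuous_measurable_fun.
    + move=> t; rewrite /= in_itv/= andbT => t1.
      rewrite lee_fin /f ler_piMl ?expR_ge0 //.
      by rewrite -[X in _ <= X](powRr0 t); apply: ler_powR => //; lra.
  - by rewrite -split; exact/measurable_EFinP.
  - by move=> t _; rewrite lee_fin.
  - by rewrite disj_set2E; apply/eqP; rewrite -subset0 => t [/=]; rewrite !in_itv/= => /andP[_ t1]; rewrite andbT leNgt t1.
have fi : intg `]0, +oo[ f by apply: ge0_intg.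
have if01 : intg `]0, 1[ f.
  apply: integrableS fi; [exact: mpos|exact: m01|].
  by rewrite split; exact: subsetUl.
apply: (@lt_le_trans _ _ (\int[mu]_(t in `]0, 1[) f t)).
  apply: Rint_gt0_continuous => //.
    by move=> t; rewrite in_itv/= => /andP[t0 _]; apply: cf; rewrite in_itv/= t0.
  by move=> t; rewrite in_itv/= => /andP[t0 _]; rewrite mulr_gt0 ?powR_gt0 ?expR_gt0.
rewrite -lee_fin -(Rint_EFin m01 if01) -(Rint_EFin mpos fi).
apply: ge0_subset_integral => //.
- exact/measurable_EFinP.
- by move=> t _; rewrite lee_fin.
- by rewrite split; exact: subsetUl.
Qed.

Lemma caputo_coef_gt0 j : 0 < caputo_coef j.
Proof.
have a1 : 0 < 1 - alpha by have := alpha_lt1; lra.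
have a2 : 1 - alpha < 1 by have := alpha_gt0; lra.
have G0 := Gamma_gt0 a1 a2.
have B0 := bfun_gt0 (@ltr01 R) a1 alpha_gt0.
rewrite /caputo_coef; apply: mulr_gt0.
  by apply: divr_gt0 => //; exact: mulr_gt0.
apply: prodr_gt0 => i _; apply: divr_gt0; last by rewrite ltr_wpDl.
by rewrite ltr_wpDl // addr_ge0 // ltW.
Qed.

Lemma caputo_coefS j :
  (j%:R + 1) * caputo_coef j.+1 = (alpha + j%:R + 1) * caputo_coef j.
Proof.
rewrite /caputo_coef big_ord_recr /=; set P := \prod_(i < j) _.
have h : j%:R + 1 != 0 :> R by rewrite gt_eqF // ltr_wpDl.
have g : Gamma (1 - alpha) != 0.
  by rewrite gt_eqF // Gamma_gt0 //; have := alpha_lt1; have := alpha_gt0; lra.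
by field; rewrite h g.
Qed.

Lemma caputo_polyK : cancel caputo_poly_inv caputo_poly.
Proof.
move=> p; rewrite /caputo_poly /caputo_poly_inv flipK diag_poly_comp diag_poly1 ?flipK //.
by move=> i; rewrite divff // gt_eqF // caputo_coef_gt0.
Qed.

Lemma caputo_poly_invK : cancel caputo_poly caputo_poly_inv.
Proof.
move=> p; rewrite /caputo_poly /caputo_poly_inv flipK diag_poly_comp diag_poly1 ?flipK //.
by move=> i; rewrite mulVf // gt_eqF // caputo_coef_gt0.
Qed.

Lemma flip_poly_sum p t : (flip p).[t] = \sum_(i < size p) p`_i * (T - t) ^+ i.
Proof. by rewrite flipE horner_coef. Qed.

(** In powers of [T - s], the derivative of [(T - s)^(alpha + j)] meets the kernel
    [(s - t)^(- alpha)] in a Beta integral on []t, T[], which scales as [(T - t)^j]; the remaining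
    constants satisfy the recurrence of [caputo_coef]. *)
Lemma right_caputo_omega p t : D t ->
  right_caputo T alpha (fun s => omega T alpha 0 s * p.[s]) t = (caputo_poly p).[t].
Proof.
move=> Dt; have [t0 tT] := domP Dt.
have Tt0 : 0 < T - t by rewrite subr_gt0.
have a1 : 0 < 1 - alpha by have := alpha_lt1; lra.
pose q := flip p; have pq : p = flip q by rewrite /q flipK.
have [n nE] : exists n, n = size q by eexists.
pose w (s : R) := \sum_(j < n) q`_j * (T - s) `^ (alpha + j%:R).
pose dw (s : R) := \sum_(j < n) q`_j * - ((alpha + j%:R) * (T - s) `^ (alpha + j%:R - 1)).
have aj j : 0 < alpha + j%:R by rewrite ltr_wpDr.
have dwP (s : R) : s < T -> is_derive s 1 w (dw s).
  move=> sT; rewrite /w /dw; clear nE w dw; elim: n => [|m IH].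
    apply: (is_derive_ext (is_derive_cst (0 : R) s 1)) => [x|]; by rewrite big_ord0.
  have d1 := is_deriveZ q`_m (is_derive_powRr (alpha + m%:R) sT).
  apply: (is_derive_ext (is_deriveD IH d1)) => [x|]; by rewrite big_ord_recr.
have dE (s : R) : s \in `]t, T[ ->
    derive1 (fun s => omega T alpha 0 s * p.[s]) s = dw s.
  rewrite in_itv/= => /andP[ts sT]; have [_ <-] := dwP _ sT.
  rewrite derive1E; apply: near_eq_derive.
  have : \forall x \near s, x \in `]t, T[ by apply: near_in_itvoo; rewrite in_itv/= ts.
  apply: filterS => x; rewrite in_itv/= => /andP[tx xT].
  rewrite /omega powRr0 mulr1 pq flip_poly_sum -nE mulr_sumr; apply: eq_bigr => j _.
  by rewrite powRD_gt0 ?subr_gt0 // powR_mulrn ?subr_ge0 ?(ltW xT) //; ring.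
rewrite /right_caputo /right_integral.
have mtT := measurable_oo t T.
have iker j := integrable_bker tT a1 (aj j).
have E s : `]t, T[%classic s ->
   derive1 (fun s => omega T alpha 0 s * p.[s]) s / (s - t) `^ (1 - (1 - alpha)) =
   \sum_(j < n) (- (q`_j * (alpha + j%:R))) * bker t T (1 - alpha) (alpha + j%:R) s.
  move=> sD; rewrite dE //; move: sD; rewrite /= in_itv/= => /andP[ts sT].
  rewrite /dw mulr_suml; apply: eq_bigr => j _; rewrite /bker.
  have -> : 1 - alpha - 1 = - (1 - (1 - alpha)) by ring.
  by rewrite powRN; ring.
rewrite (Rint_eq E) (Rint_sum mtT _ (fun j : 'I_n => intgZ mtT _ (iker j))).
rewrite /caputo_poly /= -/q flip_poly_sum.
have sE : \sum_(i < size (diag_poly caputo_coef q)) (diag_poly caputo_coef q)`_i * (T - t) ^+ i =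
   \sum_(i < n) (caputo_coef i * q`_i) * (T - t) ^+ i.
  rewrite -horner_coef (@horner_coef_wide _ n) ?nE ?size_diag_poly //.
  by apply: eq_bigr => i _; rewrite coef_diag_poly.
rewrite sE mulr_sumr -sumrN; apply: eq_bigr => j _.
rewrite (RintZ mtT _ (iker j)) -/(bfun t T (1 - alpha) (alpha + j%:R)).
rewrite (bfun_scale tT a1 (aj j)).
have -> : 1 - alpha + (alpha + j%:R) - 1 = j%:R by ring.
rewrite powR_mulrn ?(ltW Tt0) //.
have ind : (alpha + j%:R) * bfun 0 1 (1 - alpha) (alpha + j%:R) =
    alpha * bfun 0 1 (1 - alpha) alpha * \prod_(i < j) ((alpha + i%:R + 1) / (i%:R + 1)).
  elim: (nat_of_ord j) => [|m IH]; first by rewrite big_ord0 addr0 mulr1.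
  rewrite big_ord_recr /= mulrA -IH.
  have h : m%:R + 1 != 0 :> R by rewrite gt_eqF // ltr_wpDl.
  have e := bfun_recr (@ltr01 R) a1 (aj m).
  rewrite subr0 mulr1 (_ : 1 - alpha + (alpha + m%:R) = m%:R + 1) in e; last by ring.
  rewrite -natr1 addrA; apply: (mulfI h); rewrite mulrCA e; field.
  exact: h.
rewrite /caputo_coef; set P := \prod_(i < j) _ in ind *.
have g : Gamma (1 - alpha) != 0.
  by rewrite gt_eqF // Gamma_gt0 //; have := alpha_lt1; have := alpha_gt0; lra.
transitivity (q`_j * (T - t) ^+ j / Gamma (1 - alpha) *
  ((alpha + j%:R) * bfun 0 1 (1 - alpha) (alpha + j%:R))); first by field.
by rewrite ind; field.
Qed.

End shifted_operator.

(** * Adjoint, spectrum and positivity of the operator *)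

Section caputo_spectrum.
Variable R : realType.
Local Notation mu := (@lebesgue_measure R).
Variables (T alpha : R).
Hypothesis T_gt0 : 0 < T.
Hypothesis alpha_gt0 : 0 < alpha.
Hypothesis alpha_lt1 : alpha < 1.
Local Notation D := (dom T).
Local Notation ip := (winner T).
Local Notation S := (caputo_poly T alpha).
Local Notation c := (caputo_coef alpha).
Implicit Types (p q r v w : {poly R}) (g b x y : R).

Let alpha_ge0 : 0 <= alpha. Proof. exact: ltW. Qed.

Lemma bfun_x1 x : 0 < x -> bfun 0 T x 1 = T `^ x / x.
Proof.
move=> x0; have h := lt0r_neq0 x0.
have dF s : s \in `]0, T[ -> is_derive s 1 (fun s => x^-1 * (s - 0) `^ x) (bker 0 T x 1 s).
  rewrite in_itv/= => /andP[s0 sT].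
  apply: (is_derive_ext (is_deriveZ x^-1 (is_derive_powRl x s0))) => //.
  by rewrite -[LHS]/(x^-1 * (x * (s - 0) `^ (x - 1))) mulKf // /bker subrr powRr0 mulr1.
have cF : {within `[0, T], continuous (fun s => x^-1 * (s - 0) `^ x)}.
  by move=> s; apply: (@cvgM _ _ _ _ (cst x^-1)); [exact: cvg_cst|exact: within_powRl].
rewrite /bfun (Rintegral_oo_FTC T_gt0 cF dF (@continuous_oo_bker _ 0 T x 1)); last first.
  exact: integrable_bker.
by rewrite subrr powR0 // mulr0 !subr0 mulrC.
Qed.

Lemma bfun_1y y : 0 < y -> bfun 0 T 1 y = T `^ y / y.
Proof.
move=> y0; have h := lt0r_neq0 y0.
have dF s : s \in `]0, T[ -> is_derive s 1 (fun s => - y^-1 * (T - s) `^ y) (bker 0 T 1 y s).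
  rewrite in_itv/= => /andP[s0 sT].
  apply: (is_derive_ext (is_deriveZ (- y^-1) (is_derive_powRr y sT))) => //.
  rewrite -[LHS]/(- y^-1 * - (y * (T - s) `^ (y - 1))) mulrNN mulKf //.
  by rewrite /bker subrr powRr0 mul1r.
have cF : {within `[0, T], continuous (fun s => - y^-1 * (T - s) `^ y)}.
  by move=> s; apply: (@cvgM _ _ _ _ (cst (- y^-1))); [exact: cvg_cst|exact: within_powRr].
rewrite /bfun (Rintegral_oo_FTC T_gt0 cF dF (@continuous_oo_bker _ 0 T 1 y)); last first.
  exact: integrable_bker.
by rewrite subrr powR0 // mulr0 sub0r subr0 mulNr opprK mulrC.
Qed.

Lemma ip_monomials g b i j k l : 0 <= g -> 0 <= b ->
  ip g b (horner ('X^i * (T%:P - 'X) ^+ k)) (horner ('X^j * (T%:P - 'X) ^+ l)) =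
  bfun 0 T (b + (i + j)%:R + 1) (g + (k + l)%:R + 1).
Proof.
move=> g0 b0; apply: Rint_eq => t Dt; have [t0 tT] := domP Dt.
have Tt : 0 < T - t by rewrite subr_gt0.
rewrite !hornerM !horner_exp hornerD hornerN hornerC hornerX /omega /bker subr0 !addrK.
rewrite (powRD_gt0 _ _ t0) (powRD_gt0 _ _ Tt) (powR_mulrn _ (ltW t0)) (powR_mulrn _ (ltW Tt)).
by rewrite !exprD; ring.
Qed.

Lemma flip_def w : flip T w = \sum_(j < size w) w`_j *: (T%:P - 'X) ^+ j.
Proof. by rewrite /flip comp_polyE. Qed.

Lemma ip_expansion g b n m r w : 0 <= g -> 0 <= b -> (size r <= n)%N -> (size w <= m)%N ->
  ip g b (horner r) (horner (flip T w)) =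
  \sum_(i < n) \sum_(j < m) r`_i * w`_j * bfun 0 T (b + i%:R + 1) (g + j%:R + 1).
Proof.
move=> g0 b0 rn wm.
have L p : L2w T g b (horner p) by exact: L2w_poly.
have rE := poly_monomials rn.
have wE : flip T w = \sum_(j < m) w`_j *: (T%:P - 'X) ^+ j.
  rewrite flip_def [RHS](bigID (fun j : 'I_m => (j < size w)%N)) /= [X in _ = _ + X]big1 ?addr0.
    by rewrite (big_ord_widen _ (fun j => w`_j *: (T%:P - 'X) ^+ j) wm).
  by move=> j; rewrite -leqNgt => jw; rewrite nth_default // scale0r.
rewrite {1}rE ipC ip_poly_sumr //; apply: eq_bigr => i _.
rewrite ipC wE ip_poly_sumr // mulr_sumr; apply: eq_bigr => j _.
have := @ip_monomials g b i 0 0 j g0 b0.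
by rewrite expr0 mulr1 mul1r addn0 add0n => ->; rewrite mulrA.
Qed.

Lemma ip_caputo_expansion b n m r v : 0 <= b -> (size r <= n)%N -> (size v <= m)%N ->
  ip 0 b (horner r) (horner (S v)) =
  \sum_(i < n) \sum_(j < m) r`_i * (c j * (flip T v)`_j) *
     bfun 0 T (b + i%:R + 1) (j%:R + 1).
Proof.
move=> b0 rn vm; rewrite /caputo_poly (ip_expansion (lexx 0) b0 rn (m := m)); last first.
  by rewrite (leq_trans (size_diag_poly _ _)) // size_flip.
apply: eq_bigr => i _; apply: eq_bigr => j _.
by rewrite coef_diag_poly add0r.
Qed.

Local Opaque caputo_coef bfun.

(** Both sides are [T^(alpha + i + j + 1) Gamma(alpha + i + 1) Gamma(alpha + j + 1) / Gamma(alpha +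
    i + j + 2)], which is symmetric in [i] and [j]. The Beta recurrences prove it by induction on
    [j], and on [i] in the base case. *)
Lemma caputo_coef_sym i j :
  c j * bfun 0 T (alpha + i%:R + 1) (j%:R + 1) =
  c i * bfun 0 T (i%:R + 1) (alpha + j%:R + 1).
Proof.
have p1 k : 0 < k%:R + 1 :> R by rewrite ltr_wpDl.
have pa k : 0 < alpha + k%:R + 1 by rewrite ltr_wpDl // addr_ge0.
elim: j => [|j IH].
  rewrite add0r bfun_x1 //; elim: i => [|i IH].
    by rewrite !addr0 add0r bfun_1y // addr_gt0.
  move: IH; rewrite !addr0 -!natr1 => IH.
  have pa0 : 0 < alpha + 1 by rewrite addr_gt0.
  have e := bfun_recl T_gt0 (p1 i) pa0.
  have eT : T `^ (alpha + (i%:R + 1) + 1) = T * T `^ (alpha + i%:R + 1).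
    rewrite (_ : alpha + (i%:R + 1) + 1 = 1 + (alpha + i%:R + 1)); last by ring.
    by rewrite (powRD_gt0 1 (alpha + i%:R + 1) T_gt0) (powRr1 (ltW T_gt0)).
  have h1 := lt0r_neq0 (p1 i); have h2 := lt0r_neq0 (pa i).
  have h3 : alpha + (i%:R + 1) + 1 != 0 by rewrite gt_eqF // natr1 pa.
  have e' : (alpha + (i%:R + 1) + 1) * bfun 0 T (i%:R + 1 + 1) (alpha + 1) =
      (i%:R + 1) * T * bfun 0 T (i%:R + 1) (alpha + 1).
    by rewrite subr0 in e; rewrite -e; ring.
  apply: (mulfI h1); apply: (mulfI h3).
  transitivity ((alpha + i%:R + 1) * (i%:R + 1) * T * (c 0 * (T `^ (alpha + i%:R + 1) / (alpha + i%:R + 1)))).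
    by rewrite eT; field; rewrite h2 h3.
  rewrite IH.
  transitivity (((i%:R + 1) * c i.+1) * ((alpha + (i%:R + 1) + 1) * bfun 0 T (i%:R + 1 + 1) (alpha + 1))).
    by rewrite (caputo_coefS alpha_gt0 alpha_lt1) e'; ring.
  by ring.
have e1 := bfun_recr T_gt0 (pa i) (p1 j).
have e2 := bfun_recr T_gt0 (p1 i) (pa j).
have h1 := lt0r_neq0 (p1 j).
have h2 : alpha + i%:R + 1 + (j%:R + 1) != 0 := lt0r_neq0 (addr_gt0 (pa i) (p1 j)).
rewrite !subr0 in e1 e2; rewrite -natr1 addrA.
apply: (mulfI h1); apply: (mulfI h2).
transitivity (((j%:R + 1) * c j.+1) * ((alpha + i%:R + 1 + (j%:R + 1)) * bfun 0 T (alpha + i%:R + 1) (j%:R + 1 + 1))).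
  by ring.
rewrite e1 (caputo_coefS alpha_gt0 alpha_lt1).
transitivity ((alpha + j%:R + 1) * (j%:R + 1) * T * (c j * bfun 0 T (alpha + i%:R + 1) (j%:R + 1))).
  by ring.
rewrite IH.
transitivity ((j%:R + 1) * c i * ((i%:R + 1 + (alpha + j%:R + 1)) * bfun 0 T (i%:R + 1) (alpha + j%:R + 1 + 1))).
  by rewrite e2; ring.
by ring.
Qed.

(** The adjoint of [S], which is diagonal in the powers of [T - t], is diagonal in the powers of [t]
    with the same coefficients: expanding in the products [t^i (T - t)^j] reduces this to
    [caputo_coef_sym]. *)
Lemma caputo_adjoint r v :
  ip 0 alpha (horner r) (horner (S v)) =
  ip alpha 0 (horner (diag_poly c r)) (horner v).
Proof.
rewrite (ip_caputo_expansion alpha_ge0 (leqnn _) (leqnn _)).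
have sv : (size (flip T v) <= size v)%N by rewrite size_flip.
rewrite -[in RHS](flipK T v) (ip_expansion alpha_ge0 (lexx 0) (size_diag_poly _ _) sv).
apply: eq_bigr => i _; apply: eq_bigr => j _.
by rewrite coef_diag_poly add0r -(mulrA r`_i) (mulrAC (c j)) caputo_coef_sym; ring.
Qed.

Lemma coef_flip_top n p : (size p <= n.+1)%N -> (flip T p)`_n = (-1) ^+ n * p`_n.
Proof.
move=> pn; have s2 : size (T%:P - 'X : {poly R}) = 2%N.
  by rewrite -opprB size_polyN size_XsubC.
have [ps|ps] := leqP (size p) n.
  by rewrite !nth_default ?mulr0 // size_flip.
have sp : size p = n.+1 by apply/eqP; rewrite eqn_leq pn ps.
have -> : (flip T p)`_n = lead_coef (flip T p) by rewrite lead_coefE size_flip sp.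
rewrite /flip lead_coef_comp ?s2 // lead_coefE sp /= mulrC; congr (_ ^+ _ * _).
by rewrite -opprB lead_coefN lead_coefXsubC.
Qed.

(** The signs [(-1)^n] of the two reflections cancel. *)
Lemma coef_caputo_top n p : (size p <= n.+1)%N -> (S p)`_n = c n * p`_n.
Proof.
move=> pn; rewrite /caputo_poly coef_flip_top; last first.
  by rewrite (leq_trans (size_diag_poly _ _)) // size_flip.
rewrite coef_diag_poly coef_flip_top // mulrCA (mulrA (_ ^+ n)) -exprD addnn -mul2n.
by rewrite exprM sqrrN expr1n expr1n mul1r.
Qed.

Lemma caputo_poly_sum m (a : nat -> R) (P : nat -> {poly R}) :
  S (\sum_(k < m) a k *: P k) = \sum_(k < m) a k *: S (P k).
Proof.
elim: m => [|m IH].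
  rewrite !big_ord0 /caputo_poly /flip comp_poly0 (_ : diag_poly _ 0 = 0) ?comp_poly0 //.
  by apply/polyP => i; rewrite coef_diag_poly !coef0 mulr0.
by rewrite !big_ord_recr /= addrC caputo_poly_linear IH addrC.
Qed.

Section family.
Variable P : nat -> {poly R}.
Hypothesis oP : orth_family T alpha 0 P.
Local Notation h := (hsq T alpha 0 P).
Local Notation cf := (coefs T alpha 0 P).

(** Once [S] is moved across, [diag_poly c (S (P k))] has degree at most that of [P k], so it is
    orthogonal to [P l] for [k < l]; on the diagonal only its leading coefficient, [c_i^2] times
    that of [P i], contributes. *)
Lemma caputo_orth i j :
  ip 0 alpha (horner (S (P i))) (horner (S (P j))) = if i == j then c i ^+ 2 * h i else 0.
Proof.
have [si oi] := oP i; have [sj oj] := oP j.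
have lt k l : (k < l)%N -> ip 0 alpha (horner (S (P k))) (horner (S (P l))) = 0.
  move=> kl; have [sk _] := oP k; have [_ ol] := oP l.
  rewrite caputo_adjoint ipC ol // (leq_trans (size_diag_poly _ _)) //.
  by rewrite (leq_trans (size_caputo_poly _ _ _)) // sk.
case: (ltngtP i j) => [ij|ij|ij]; first exact: lt.
  by rewrite ipC lt.
rewrite -ij caputo_adjoint.
have sS : (size (S (P i)) <= i.+1)%N by rewrite -si size_caputo_poly.
set q := diag_poly c (S (P i)).
have qn : (size q <= i.+1)%N by rewrite (leq_trans (size_diag_poly _ _)).
have qE : q = c i ^+ 2 *: P i + (q - c i ^+ 2 *: P i) by rewrite addrC subrK.
have rn : (size (q - c i ^+ 2 *: P i)%R <= i)%N.
  apply/leq_sizeP => k; rewrite leq_eqVlt => /predU1P[<-|ik].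
    rewrite coefB coefZ /q coef_diag_poly coef_caputo_top ?si //; ring.
  rewrite coefB coefZ (nth_default _ (leq_trans qn ik)).
  by rewrite (nth_default 0 (_ : size (P i) <= k)%N) ?si // mulr0 subrr.
have L p : L2w T alpha 0 (horner p) by exact: L2w_poly.
rewrite qE ip_polyDZl // (ipC _ _ _ (horner (q - _))) (oi _ rn) addr0.
by [].
Qed.

Lemma caputo_parseval n v : (size v <= n)%N ->
  ip 0 alpha (horner (S v)) (horner (S v)) =
  \sum_(k < n) cf (horner v) k ^+ 2 * h k * c k ^+ 2.
Proof.
move=> vn.
have L p : L2w T 0 alpha (horner p) by exact: L2w_poly.
rewrite {1 2}(orth_expansion T_gt0 alpha_ge0 (lexx 0) oP vn) !caputo_poly_sum.
rewrite ip_poly_sumr //; apply: eq_bigr => k _.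
rewrite ipC ip_poly_sumr // (bigD1 k) //= big1 ?addr0.
  by rewrite caputo_orth eqxx; ring.
move=> j jk; rewrite caputo_orth ifN ?mulr0 //.
by apply: contra jk => /eqP e; apply/eqP/val_inj.
Qed.

(** This is [(1 + x)^alpha <= 1 + alpha x] at [x = 1 / (k + 1)], from Young's inequality with
    exponents [1 / alpha] and [1 / (1 - alpha)]. *)
Lemma powR_step k : (k.+2%:R : R) `^ alpha <= k.+1%:R `^ alpha * (1 + alpha / (k%:R + 1)).
Proof.
have k1 : 0 < k%:R + 1 :> R by rewrite ltr_wpDl.
have -> : k.+2%:R = k.+1%:R * (1 + (k%:R + 1)^-1) :> R.
  by rewrite -!natr1; field; rewrite gt_eqF.
have x0 : 0 <= 1 + (k%:R + 1)^-1 :> R by rewrite addr_ge0 // invr_ge0 ltW.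
rewrite powRM // ler_wpM2l ?powR_ge0 //.
have a1 : 0 < 1 - alpha by have := alpha_lt1; lra.
have := @conjugate_powR R ((1 + (k%:R + 1)^-1) `^ alpha) 1 alpha^-1 (1 - alpha)^-1.
rewrite mulr1 -powRrM mulfV ?gt_eqF // powRr1 // powR1 !invrK mul1r => /(_ _ _ _ _ _) h.
apply: le_trans (h _ _ _ _ _) _; rewrite ?powR_ge0 ?invr_gt0 //; first by ring.
by rewrite le_eqVlt; apply/orP; left; apply/eqP; ring.
Qed.

(** The ratio [c_(k+1) / c_k = 1 + alpha / (k + 1)] is at least the corresponding ratio of the
    powers [(k + 1)^alpha]. This growth is what lets [S] control the norm of order [alpha]. *)
Lemma caputo_coef_lb k : c 0 * k.+1%:R `^ alpha <= c k.
Proof.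
elim: k => [|k IH]; first by rewrite powR1 mulr1.
have k1 : 0 < k%:R + 1 :> R by rewrite ltr_wpDl.
have c0 := caputo_coef_gt0 alpha_gt0 alpha_lt1.
have -> : c k.+1 = c k * (1 + alpha / (k%:R + 1)).
  apply: (mulfI (lt0r_neq0 k1)); rewrite (caputo_coefS alpha_gt0 alpha_lt1); field.
  by rewrite gt_eqF.
have s0 : 0 <= 1 + alpha / (k%:R + 1) by rewrite addr_ge0 // divr_ge0 // ltW.
apply: le_trans; last exact: (ler_wpM2r s0 IH).
rewrite -(mulrA (c 0)).
exact: (ler_wpM2l (ltW (c0 0%N)) (powR_step k)).
Qed.

Lemma caputo_coef_ge0 k : c 0 <= c k.
Proof.
apply: le_trans (caputo_coef_lb k); rewrite ler_peMr ?(ltW (caputo_coef_gt0 _ _ _)) //.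
rewrite -[leLHS](powRr0 k.+1%:R); apply: ler_powR => //.
by rewrite ler1n.
Qed.

Lemma nrm_caputo_ge v : c 0 * nrm T alpha 0 (horner v) <= nrm T 0 alpha (horner (S v)).
Proof.
have c0 := caputo_coef_gt0 alpha_gt0 alpha_lt1.
have n0 : 0 <= c 0 * nrm T alpha 0 (horner v).
  exact: (mulr_ge0 (ltW (c0 0%N)) (nrm_ge0 _ _ _ _)).
have n1 := nrm_ge0 T 0 alpha (horner (S v)).
rewrite -(@ler_pXn2r R 2 isT _ _ n0 n1).
rewrite exprMn !nrm_sq (caputo_parseval (leqnn _)).
rewrite (parseval T_gt0 alpha_ge0 (lexx 0) oP (leqnn _)) mulr_sumr.
apply: ler_sum => k _; rewrite mulrC ler_wpM2l //.
  by rewrite mulr_ge0 ?sqr_ge0 ?(ltW (hsq_gt0 _ _ _ oP _)).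
by rewrite lerXn2r ?nnegrE ?(ltW (c0 _)) // caputo_coef_ge0.
Qed.

End family.

Definition weighted_poly v (t : R) := omega T alpha 0 t * v.[t].
Local Notation W := weighted_poly.

Lemma W_L2 v : L2w T 0 alpha (W v).
Proof.
have [k vk] := continuous_bounded_dom T (continuous_poly (p := v)).
apply: (@L2w_bounded _ _ T_gt0 _ _ _ (T `^ alpha * T `^ 0 * k)) => //.
  apply: measurable_funM; first exact: omega_measurable.
  apply: measurable_funTS; apply: continuous_measurable_fun; exact: continuous_poly.
move=> x Dx; rewrite normrM ger0_norm ?omega_ge0 // ler_pM ?omega_ge0 ?vk //.
exact: omega_bound.
Qed.

Lemma nrm_W v : nrm T 0 alpha (W v) <= T `^ alpha * nrm T alpha 0 (horner v).
Proof.
have L : L2w T alpha 0 (horner v) by exact: L2w_poly.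
rewrite -(@ler_pXn2r _ 2) ?nnegrE ?nrm_ge0 ?mulr_ge0 ?nrm_ge0 ?powR_ge0 //.
rewrite exprMn !nrm_sq /winner -(RintZ (mdom T) _ (L2w_prod L L)).
apply: Rint_le.
- exact: mdom.
- exact: L2w_prod (W_L2 v) (W_L2 v).
- exact: (intgZ (mdom T) _ (L2w_prod L L)).
move=> t Dt; rewrite /W.
have -> : omega T alpha 0 t * v.[t] * (omega T alpha 0 t * v.[t]) * omega T 0 alpha t =
  omega T alpha alpha t * (v.[t] * v.[t] * omega T alpha 0 t).
  by rewrite /omega !powRr0; ring.
have -> : (T `^ alpha) ^+ 2 = T `^ alpha * T `^ alpha by rewrite expr2.
apply: ler_wpM2r; first exact: (mulr_ge0 (sqr_ge0 v.[t]) (omega_ge0 _ _ _ _)).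
exact: (omega_bound T_gt0 alpha_ge0 alpha_ge0 Dt).
Qed.

Lemma caputo_positive v : 0 <= ip 0 alpha (horner (S v)) (W v).
Proof.
set q := S v; set n := size q.
have -> : ip 0 alpha (horner q) (W v) = ip alpha alpha (horner q) (horner v).
  by apply: Rint_eq => t _; rewrite /W /omega !powRr0; ring.
have pa k : 0 < alpha + k%:R + 1 by rewrite ltr_wpDl // addr_ge0.
have p2a k : 0 < 2 * alpha + k%:R + 1 by rewrite ltr_wpDl // addr_ge0 // mulr_ge0.
have pa0 : 0 < alpha + 1 by rewrite addr_gt0.
have a2 : 0 <= 2 * alpha by rewrite mulr_ge0.
have c0 := caputo_coef_gt0 alpha_gt0 alpha_lt1.
(* [b i] equals [Gamma(alpha + i + 1) / Gamma(2 alpha + i + 1)]. It is defined so that [bE] holds at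
   [j = 0]; both sides of [bE] then obey the same recurrence in [j]. *)
pose b i := bfun 0 T (alpha + i%:R + 1) (alpha + 1) / (c 0 * bfun 0 T (2 * alpha + i%:R + 1) 1).
have B0 i j : 0 < bfun 0 T (alpha + i%:R + 1) (alpha + j%:R + 1).
  exact: (bfun_gt0 T_gt0 (pa i) (pa j)).
have B2 i : 0 < bfun 0 T (2 * alpha + i%:R + 1) 1.
  exact: (bfun_gt0 T_gt0 (p2a i) (@ltr01 R)).
have B1 i : 0 < bfun 0 T (alpha + i%:R + 1) (alpha + 1).
  exact: (bfun_gt0 T_gt0 (pa i) pa0).
have b0 i : 0 < b i := divr_gt0 (B1 i) (mulr_gt0 (c0 0%N) (B2 i)).
have bE i j : bfun 0 T (alpha + i%:R + 1) (alpha + j%:R + 1) =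
    b i * (c j * bfun 0 T (2 * alpha + i%:R + 1) (j%:R + 1)).
  elim: j => [|j IH].
    rewrite addr0 add0r /b /b.
    have h1 := lt0r_neq0 (B2 i); have h2 := lt0r_neq0 (c0 0%N).
    by field; rewrite h1 h2.
  have p1 : 0 < j%:R + 1 :> R by rewrite ltr_wpDl.
  have e1 := bfun_recr T_gt0 (pa i) (pa j).
  have e2 := bfun_recr T_gt0 (p2a i) p1.
  rewrite !subr0 in e1 e2; rewrite -(natr1 j) addrA.
  have h1 := lt0r_neq0 (addr_gt0 (pa i) (pa j)).
  have h2 := lt0r_neq0 p1.
  apply: (mulfI h1); apply: (mulfI h2); rewrite e1 IH.
  transitivity (b i * ((j%:R + 1) * c j.+1) * ((2 * alpha + i%:R + 1 + (j%:R + 1)) * bfun 0 T (2 * alpha + i%:R + 1) (j%:R + 1 + 1))).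
    by rewrite e2 (caputo_coefS alpha_gt0 alpha_lt1); ring.
  by ring.
have brec i : (2 * alpha + i%:R + 1) * b i.+1 = (alpha + i%:R + 1) * b i.
  have e1 := bfun_recl T_gt0 (pa i) pa0; have e2 := bfun_recl T_gt0 (p2a i) (@ltr01 R).
  rewrite !subr0 in e1 e2; rewrite /b -(natr1 i) !addrA.
  set X1 := bfun 0 T (alpha + i%:R + 1 + 1) _ in e1 *.
  set X0 := bfun 0 T (alpha + i%:R + 1) _ in e1 *.
  set Y1 := bfun 0 T (2 * alpha + i%:R + 1 + 1) _ in e2 *.
  set Y0 := bfun 0 T (2 * alpha + i%:R + 1) _ in e2 *.
  have Y00 : Y0 != 0 := lt0r_neq0 (B2 i).
  have s0 : 2 * alpha + i%:R + 1 + 1 != 0 := lt0r_neq0 (addr_gt0 (p2a i) ltr01).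
  have T0 := lt0r_neq0 T_gt0; have c00 := lt0r_neq0 (c0 0).
  have h0 := lt0r_neq0 (p2a i).
  have {}e1 : X1 = (alpha + i%:R + 1) * T * X0 / (2 * alpha + i%:R + 1 + 1).
    by apply: (canRL (mulfK s0)); rewrite -e1 mulrC; congr (_ * _); ring.
  have {}e2 : Y1 = (2 * alpha + i%:R + 1) * T * Y0 / (2 * alpha + i%:R + 1 + 1).
    by apply: (canRL (mulfK s0)); rewrite -e2 mulrC.
  by rewrite e1 e2; field; rewrite s0 Y00 h0 T0 c00.
have gram_ip (U : R) m (p : nat -> R) : 0 < U ->
  0 <= \sum_(i < m) \sum_(j < m) p i * p j * (U ^+ (i + j) / (2 * alpha + (i + j)%:R + 1)).
  (* Rescaling the coefficients by [(U / T)^i] turns the Gram matrix on [(0, U)] into the one on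
     [(0, T)]. *)
  move=> U0; pose pp := \poly_(i < m) (p i * (U / T) ^+ i).
  have L r : L2w T 0 (2 * alpha) (horner r) by exact: L2w_poly.
  have U1 : 0 < T `^ (2 * alpha + 1) by rewrite powR_gt0.
  rewrite -(pmulr_rge0 _ U1); suff <- : ip 0 (2 * alpha) (horner pp) (horner pp) =
    T `^ (2 * alpha + 1) * \sum_(i < m) \sum_(j < m) p i * p j * (U ^+ (i + j) / (2 * alpha + (i + j)%:R + 1)).
    exact: ip_ge0.
  rewrite /pp poly_def ip_poly_sumr // mulr_sumr; apply: eq_bigr => i _.
  rewrite ipC ip_poly_sumr // !mulr_sumr; apply: eq_bigr => j _.
  have := @ip_monomials 0 (2 * alpha) i j 0 0 (lexx 0) a2.
  rewrite !expr0 !mulr1 addn0 !add0r => ->.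
  rewrite bfun_x1 // (_ : 2 * alpha + (i + j)%:R + 1 = (2 * alpha + 1) + (i + j)%:R); last by ring.
  rewrite powRD_gt0 // powR_mulrn ?(ltW T_gt0) // !exprMn !exprVn !exprD.
  have T0 k : T ^+ k != 0 by rewrite expf_neq0 // gt_eqF.
  have h0 : 2 * alpha + 1 + (i + j)%:R != 0 by rewrite -addrA (addrC 1) addrA gt_eqF.
  move: (T0 i) (T0 j) h0.
  move: (T ^+ i) (T ^+ j) (U ^+ i) (U ^+ j) (_ + _%:R) (T `^ _) => x y z w s t hx hy hs.
  by field; rewrite hx hy hs.
have -> : ip alpha alpha (horner q) (horner v) =
  T `^ (2 * alpha + 1) * \sum_(i < n) \sum_(j < n) q`_i * q`_j * (T ^+ (i + j) / (2 * alpha + (i + j)%:R + 1)) * b i.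
  rewrite -[in LHS](flipK T v) (ip_expansion alpha_ge0 alpha_ge0 (leqnn n) (m := size v)) ?size_flip //.
  (* By [bE], the weight [(T - t)^alpha] is exchanged for the operator [S], termwise in the powers
     of [T - t]. *)
  have E (i : 'I_n) : \sum_(j < size v) q`_i * (flip T v)`_j * bfun 0 T (alpha + i%:R + 1) (alpha + j%:R + 1) =
      q`_i * b i * ip 0 (2 * alpha) (horner 'X^i) (horner q).
    rewrite (ip_caputo_expansion a2 (n := i.+1) (m := size v)) ?size_polyXn //.
    rewrite [in RHS]big_ord_recr /= [in RHS]big1 ?add0r; last first.
      by move=> k _; rewrite big1 // => j _; rewrite coefXn ltn_eqF // !mul0r.
    have c1 : ('X^i : {poly R})`_i = 1 by rewrite coefXn eqxx.
    by rewrite mulr_sumr; apply: eq_bigr => j _; rewrite c1 bE; ring.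
  rewrite (eq_bigr _ (fun i _ => E i)) mulr_sumr; apply: eq_bigr => i _.
  have L r : L2w T 0 (2 * alpha) (horner r) by exact: L2w_poly.
  have qE : q = \sum_(k < n) q`_k *: 'X^k by rewrite -poly_def coefK.
  rewrite {2}qE ip_poly_sumr // !mulr_sumr; apply: eq_bigr => j _.
  have := @ip_monomials 0 (2 * alpha) i j 0 0 (lexx 0) a2.
  rewrite !expr0 !mulr1 addn0 !add0r => ->.
  rewrite bfun_x1 // (_ : 2 * alpha + (i + j)%:R + 1 = (2 * alpha + 1) + (i + j)%:R); last by ring.
  by rewrite powRD_gt0 // powR_mulrn ?(ltW T_gt0) //; ring.
by rewrite mulr_ge0 ?powR_ge0 //; apply: gram_beta_ge0.
Qed.

End caputo_spectrum.

(** * Jacobi polynomials and the bilinear form on polynomials *)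

Section jacobi_expansion.
Variable R : realType.
Local Notation mu := (@lebesgue_measure R).
Variables (T alpha : R).
Hypothesis T_gt0 : 0 < T.
Hypothesis alpha_gt0 : 0 < alpha.
Hypothesis alpha_lt1 : alpha < 1.
Local Notation D := (dom T).
Local Notation ip := (winner T).
Local Notation S := (caputo_poly T alpha).
Implicit Types (p q v : {poly R}).

Let alpha_ge0 : 0 <= alpha. Proof. exact: ltW. Qed.

(** [Q_n^(alpha, 0)] in the products [t^(n-i) (T - t)^i], whose moments for [omega^(alpha, 0)] are
    Beta integrals. The sign comes from [(x - 1) / 2 = - (T - t) / T] at [x = 2 t / T - 1]. *)
Definition jacobi_shift n : {poly R} :=
  \sum_(i < n.+1) ((-1) ^+ i * T^-1 ^+ n * (gbinom (n%:R + alpha) (n - i) * 'C(n, i)%:R)) *: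
     ('X^(n - i) * (T%:P - 'X) ^+ i).

Lemma gbinom_nat n i : gbinom (n%:R : R) i = 'C(n, i)%:R.
Proof.
have h : (i`!%:R : R) != 0 by rewrite pnatr_eq0 -lt0n fact_gt0.
apply: (mulIf h); rewrite /gbinom divfK // -natrM bin_ffact.
elim: i {h} => [|i IH]; first by rewrite big_ord0 ffactn0.
rewrite big_ord_recr /= IH ffactnSr natrM.
have [ni|ni] := ltnP n i; first by rewrite ffact_small // !mul0r.
by rewrite natrB.
Qed.

Lemma horner_jacobi_shift n : horner (jacobi_shift n) = Qjac T alpha 0 n.
Proof.
have T0 := lt0r_neq0 T_gt0.
apply/funext => t; rewrite /Qjac /jacobi /jacobi_shift !horner_sum; apply: eq_bigr => i _.
have ni : (n = (n - i) + i)%N by rewrite subnK // -ltnS.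
rewrite addr0 gbinom_nat !hornerZ !hornerM !horner_exp !hornerZ !hornerD hornerN hornerX !hornerC.
rewrite hornerN hornerC hornerX.
have -> : 2^-1 * (2 * t / T - 1 - 1) = - T^-1 * (T - t) by field.
have -> : 2^-1 * (2 * t / T - 1 + 1) = T^-1 * t by field.
have -> : T^-1 ^+ n = T^-1 ^+ (n - i) * T^-1 ^+ i by rewrite -exprD -ni.
by rewrite !exprMn !(exprNn T^-1); ring.
Qed.

Lemma gbinomS (a : R) k : (k%:R + 1) * gbinom a k.+1 = (a - k%:R) * gbinom a k.
Proof.
rewrite /gbinom big_ord_recr /= factS natrM -natr1.
have h1 : (k`!%:R : R) != 0 by rewrite pnatr_eq0 -lt0n fact_gt0.
have h2 : k%:R + 1 != 0 :> R by rewrite natr1 pnatr_eq0.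
by field; rewrite h1 h2.
Qed.

(** Up to a factor free of [i], the [i]-th term is [(-1)^i C(n, i) F_i], and [F_i] is proportional
    to [(n - i + j)! / (n - i)!], a polynomial [G] in [i] of degree [j < n], which alternating
    binomial sums annihilate. *)
Lemma jacobi_shift_moment n j : (j < n)%N ->
  ip alpha 0 (horner (jacobi_shift n)) (horner 'X^j) = 0.
Proof.
move=> jn.
have L p : L2w T alpha 0 (horner p) by exact: L2w_poly.
pose F i := gbinom (n%:R + alpha) (n - i) * bfun 0 T ((n - i)%:R + j%:R + 1) (alpha + i%:R + 1).
pose G : {poly R} := \prod_(l < j) ((n%:R + 1 + l%:R)%:P - 'X).
have GE x : G.[x] = \prod_(l < j) (n%:R + 1 + l%:R - x).
  by rewrite horner_prod; apply: eq_bigr => l _; rewrite hornerD hornerN hornerC hornerX.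
have sG : (size G <= n)%N.
  apply: leq_trans jn; rewrite size_prod.
    rewrite (eq_bigr (fun=> 2%N)) ?sum_nat_const ?card_ord; first by rewrite mulnC mul2n -addnn subSn ?leq_addr // addnK.
    by move=> l _; rewrite -opprB size_polyN size_XsubC.
  by move=> l _; rewrite -opprB oppr_eq0 polyXsubC_eq0.
have GS i : (n%:R - i%:R + j%:R) * G.[i.+1%:R] = (n%:R - i%:R) * G.[i%:R].
  rewrite !GE; clear; elim: j => [|j IH]; first by rewrite !big_ord0 addr0.
  rewrite !big_ord_recr /= [RHS]mulrA -IH -(natr1 j) -(natr1 i); ring.
have FS i : (i < n)%N -> (n%:R - i%:R + j%:R) * F i.+1 = (n%:R - i%:R) * F i.
  move=> ni; rewrite /F.
  have e : (n - i = (n - i.+1).+1)%N by rewrite subnSK.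
  have eR : n%:R - i%:R = (n - i.+1)%:R + 1 :> R by rewrite -natrB ?(ltnW ni) // e natr1.
  have e3 := gbinomS (n%:R + alpha) (n - i.+1).
  set k := (n - i.+1)%N in e eR e3 *.
  have x0 : 0 < k%:R + j%:R + 1 :> R by rewrite ltr_wpDl // addr_ge0.
  have y0 : 0 < alpha + i%:R + 1 by rewrite ltr_wpDl // addr_ge0.
  have e2 := bfun_recr T_gt0 x0 y0; have e1 := bfun_recl T_gt0 x0 y0.
  rewrite subr0 in e1 e2.
  rewrite eR e -(natr1 k) -(natr1 i) (addrA alpha) (addrAC k%:R 1 j%:R).
  have s0 := lt0r_neq0 (addr_gt0 x0 y0).
  have nE : n%:R + alpha - k%:R = alpha + i%:R + 1.
    by rewrite -(subrK i%:R n%:R) eR; ring.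
  rewrite nE in e3.
  apply: (mulfI s0).
  transitivity (gbinom (n%:R + alpha) k * (k%:R + 1 + j%:R) * ((k%:R + j%:R + 1 + (alpha + i%:R + 1)) * bfun 0 T (k%:R + j%:R + 1) (alpha + i%:R + 1 + 1))).
    by ring.
  rewrite e2.
  transitivity ((alpha + i%:R + 1) * gbinom (n%:R + alpha) k * ((k%:R + j%:R + 1) * T * bfun 0 T (k%:R + j%:R + 1) (alpha + i%:R + 1))).
    by ring.
  by rewrite -e3 -e1; ring.
have GF i : (i <= n)%N -> G.[0] * F i = F 0%N * G.[i%:R].
  elim: i => [|i IH] ni; first by rewrite mulrC.
  have h : n%:R - i%:R + j%:R != 0 :> R.
    by rewrite -natrB ?(ltnW ni) // -natrD pnatr_eq0 -lt0n addn_gt0 subn_gt0 ni.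
  apply: (mulfI h); rewrite mulrCA FS // [in RHS]mulrCA GS mulrCA IH ?(ltnW ni) //; ring.
have G0 : G.[0] != 0.
  rewrite GE; apply/prodf_neq0 => l _; rewrite subr0.
  by rewrite natr1 -natrD pnatr_eq0.
apply: (mulfI G0); rewrite mulr0.
rewrite ipC ip_poly_sumr // mulr_sumr.
transitivity (T^-1 ^+ n * F 0%N * \sum_(i < n.+1) (-1) ^+ i * 'C(n, i)%:R * G.[i%:R]).
  rewrite mulr_sumr.
  apply: eq_bigr => i _; have iln : (i <= n)%N by rewrite -ltnS.
  transitivity (T^-1 ^+ n * ((-1) ^+ i * 'C(n, i)%:R) * (G.[0] * F i)); last by rewrite GF //; ring.
  have := @ip_monomials R T alpha 0 (n - i) j i 0 alpha_ge0 (lexx 0).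
  rewrite expr0 mulr1 addn0 add0r natrD ipC => ->.
  by rewrite /F; ring.
by rewrite (alternating_binomial_poly sG) mulr0.
Qed.

(** The leading sign of [(T - t)^i] cancels [(-1)^i], so all contributions to the coefficient of
    degree [n] are positive. *)
Lemma size_jacobi_shift n : size (jacobi_shift n) = n.+1.
Proof.
have le : (size (jacobi_shift n) <= n.+1)%N.
  rewrite (leq_trans (size_sum _ _ _)) //; apply/bigmax_leqP => i _.
  have ni : (n = (n - i) + i)%N by rewrite subnK // -ltnS.
  rewrite (leq_trans (size_scale_leq _ _)) // (leq_trans (size_polyMleq _ _)) // size_polyXn /=.
  rewrite [X in (_ <= X.+1)%N]ni -addnS leq_add2l (leq_trans (size_poly_exp_leq _ _)) //.
  by rewrite -opprB size_polyN size_XsubC mul1n.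
apply/eqP; rewrite eqn_leq le ltnNge; apply/negP => /leq_sizeP /(_ n (leqnn _)); apply/eqP.
rewrite coef_sum.
have E i : (i < n.+1)%N -> (((-1) ^+ i * T^-1 ^+ n * (gbinom (n%:R + alpha) (n - i) * 'C(n, i)%:R)) *:
     ('X^(n - i) * (T%:P - 'X) ^+ i))`_n = T^-1 ^+ n * (gbinom (n%:R + alpha) (n - i) * 'C(n, i)%:R).
  move=> ni; rewrite coefZ coefXnM ltnNge leq_subr /= subKn //.
  have -> : (T%:P - 'X) ^+ i = flip T 'X^i by rewrite /flip comp_Xn_poly.
  rewrite coef_flip_top ?size_polyXn // coefXn eqxx mulr1.
  rewrite mulrC !mulrA -exprD addnn -mul2n exprM sqrrN expr1n expr1n mul1r //.
rewrite (eq_bigr _ (fun (i : 'I_n.+1) _ => E i (ltn_ord i))).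
rewrite -mulr_sumr mulf_neq0 //; first by rewrite expf_neq0 // invr_eq0 lt0r_neq0.
have gb (i : 'I_n.+1) : 0 < gbinom (n%:R + alpha) (n - i).
  rewrite divr_gt0 ?ltr0n ?fact_gt0 //; apply: prodr_gt0 => k _.
  rewrite addrAC ltr_wpDl // subr_ge0 ler_nat.
  by rewrite (leq_trans (ltnW (ltn_ord k))) // leq_subr.
apply: lt0r_neq0; rewrite big_ord_recl ltr_pwDl //.
  by rewrite mulr_gt0 // ltr0n bin_gt0.
by apply: sumr_ge0 => i _; exact: (mulr_ge0 (ltW (gb _)) (ler0n _ _)).
Qed.

Lemma jacobi_orth_family : orth_family T alpha 0 jacobi_shift.
Proof.
move=> n; split; first exact: size_jacobi_shift.
have L p : L2w T alpha 0 (horner p) by exact: L2w_poly.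
move=> q qn; rewrite (poly_monomials qn).
by rewrite ip_poly_sumr // big1 // => k _; rewrite jacobi_shift_moment // mulr0.
Qed.

Lemma caputo_partial_poly v n t : (size v <= n)%N -> D t ->
  caputo_partial T alpha (horner v) n t = (S v).[t].
Proof.
move=> vn Dt; have oP := jacobi_orth_family.
rewrite [in RHS](orth_expansion T_gt0 alpha_ge0 (lexx 0) oP vn) caputo_poly_sum horner_sum.
apply: eq_bigr => k _; rewrite hornerZ; congr (_ * _).
  by rewrite /jacobi_coef /coefs /hsq horner_jacobi_shift.
rewrite -(right_caputo_omega alpha_gt0 alpha_lt1 _ Dt).
by rewrite horner_jacobi_shift.
Qed.

(** [caputo_weighted] is a choice among the possible limits, hence known only up to a function of
    norm zero. The partial sums of a polynomial are stationary, which makes [S v] one of these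
    limits. *)
Lemma caputo_weighted_poly v : wL2 T 0 alpha (caputo_weighted T alpha (horner v)) /\
  nrm T 0 alpha (fun t => caputo_weighted T alpha (horner v) t - (S v).[t]) = 0.
Proof.
have L : L2w T 0 alpha (horner (S v)) by exact: L2w_poly.
have W (g : R -> R) N : (size v <= N)%N ->
    wnorm T 0 alpha (g \- caputo_partial T alpha (horner v) N) =
    wnorm T 0 alpha (fun t => g t - (S v).[t]).
  move=> vN; rewrite /wnorm; congr sqrte; apply: eq_integral => t; rewrite inE => Dt.
  by rewrite /= caputo_partial_poly.
have [gL gc] : [set g | wL2 T 0 alpha g /\
    (fun N => wnorm T 0 alpha (g \- caputo_partial T alpha (horner v) N)) @ \oo
      --> 0%E] (caputo_weighted T alpha (horner v)).
  apply: xgetPex; exists (horner (S v)); split; first exact/wL2P.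
  apply: cvg_near_cst; exists (size v) => // N /= vN; rewrite W //.
  by rewrite (wnormE (L2wB L L)) /nrm (ipBl L L (L2wB L L)) subrr sqrtr0.
move: (caputo_weighted _ _ _) gL gc => g gL gc.
split => //; have gL' := (wL2P _ _ _ _).1 gL.
have c : wnorm T 0 alpha (g \- caputo_partial T alpha (horner v) N) @[N --> \oo] -->
    wnorm T 0 alpha (fun t => g t - (S v).[t]).
  by apply: cvg_near_cst; exists (size v) => // N /= vN; rewrite W.
have := cvg_unique (@ereal_hausdorff R) c gc.
by rewrite (wnormE (L2wB gL' L)) => /(_ _) -[].
Qed.

(** Writing the unknown as [omega^(0, -alpha) u] moves both terms into the inner product with weight
    [t^alpha]; Cauchy-Schwarz absorbs the ambiguity in the choice of [caputo_weighted]. *)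
Lemma bform_poly lambda u v : L2w T 0 alpha (fun t => omega T 0 (- alpha) t * u t) ->
  bform T alpha lambda u (horner v) =
  ip 0 alpha (fun t => omega T 0 (- alpha) t * u t) (horner (S v)) +
  lambda * ip 0 alpha (fun t => omega T 0 (- alpha) t * u t) (weighted_poly T alpha v).
Proof.
move=> uL; set P := fun t => _.
have [/wL2P gL g0] := caputo_weighted_poly v.
set g := caputo_weighted T alpha (horner v) in gL g0 *.
have L : L2w T 0 alpha (horner (S v)) by exact: L2w_poly.
have om t : D t -> t `^ (- alpha) * t `^ alpha = 1.
  by move=> /domP[t0 _]; rewrite -powRD_gt0 // addNr powRr0.
have -> : bform T alpha lambda u (horner v) = ip 0 alpha P g +
    lambda * ip 0 alpha P (weighted_poly T alpha v).
  congr (_ + _ * _); apply: Rint_eq => t Dt.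
    by rewrite /P /omega !powRr0 !mul1r mulrAC (mulrAC (_ `^ _)) om // mul1r.
  rewrite /P /weighted_poly /omega !powRr0 !mul1r !mulr1.
  transitivity ((t `^ (- alpha) * t `^ alpha) * (u t * v.[t] * (T - t) `^ alpha)).
    by rewrite om // mul1r.
  by ring.
congr (_ + _).
have : `|ip 0 alpha P (fun t => g t - (S v).[t])| <= 0.
  by apply: le_trans (ip_CS uL (L2wB gL L)) _; rewrite g0 mulr0.
by rewrite normr_le0 ipBr // subr_eq0 => /eqP.
Qed.

End jacobi_expansion.

(** * Weak derivatives and Jackson's estimate *)

Section cutoff.
Variable R : realType.
Local Notation mu := (@lebesgue_measure R).
Implicit Types (e x y : R).

(** The square of the positive part is a simple cut-off of class C^1, the regularity asked of the
    test functions in [weak_derivative]. *)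
Definition pos2 (y : R) := (Num.max y 0) ^+ 2.

Lemma max0_continuous : continuous (fun y : R => Num.max y 0).
Proof.
by move=> y; apply: (@continuous_max R R^o); [exact: cvg_id|exact: cvg_cst].
Qed.

Lemma is_derive_pos2 (y : R) : is_derive y 1 pos2 (2 * Num.max y 0).
Proof.
have dX : is_derive y 1 (fun t : R => t ^+ 2) (2 * y).
  by apply: (is_derive_ext (is_deriveM (is_derive_id y 1) (is_derive_id y 1))) => [t|];
    [rewrite expr2|rewrite /GRing.scale/= mulr1 mulr2n mulrDl mul1r].
have [y0|y0|y0] := ltgtP y 0.
- rewrite mulr0.
  have E : \forall t \near y, pos2 t = (fun=> 0 : R) t.
    by near=> t; rewrite /pos2 max_r ?expr0n //; apply/ltW; near: t; exact: lt_nbhsl.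
  have [d v] := @is_derive_cst R R R (0 : R) y 1.
  split; last by rewrite (near_eq_derive _ E).
  apply: near_eq_derivable d; by apply: filterS E => t ->.
- have E : \forall t \near y, pos2 t = (fun t : R => t ^+ 2) t.
    by near=> t; rewrite /pos2 max_l //; apply/ltW; near: t; exact: lt_nbhsr.
  have [d v] := dX.
  split; last by rewrite (near_eq_derive _ E).
  apply: near_eq_derivable d; by apply: filterS E => t ->.
- rewrite y0 mulr0.
  have n0 : `|h| @[h --> (0 : R)^'] --> (0 : R).
    have := @norm_continuous R R 0; rewrite /continuous_at normr0.
    exact: cvg_within_filter.
  have c0 : h^-1 *: (pos2 (h *: 1 + 0) - pos2 0) @[h --> (0 : R)^'] --> (0 : R).
    apply: (@squeeze_cvgr _ _ _ _ (fun h : R => - `|h|) (fun h : R => `|h|)).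
    + near=> h; rewrite addr0 /pos2 [h *: 1]mulr1 (@max_l _ _ 0 0) // expr0n subr0.
      have h0 : h != 0 by near: h; exact: nbhs_dnbhs_neq.
      rewrite -ler_norml normrM normfV.
      have hp : 0 < `|h| by rewrite normr_gt0.
      rewrite mulrC ler_pdivrMr // -expr2 normrX lerXn2r ?nnegrE //.
      by case: (leP h 0) => hh; rewrite ?normr0.
    + have m0 : - `|h| @[h --> (0 : R)^'] --> - (0 : R) by exact: cvgN.
      by rewrite oppr0 in m0; exact: m0.
    + exact: n0.
  split; first exact: cvgP c0.
  by rewrite /derive; exact: cvg_lim c0.
Unshelve. all: by end_near. Qed.

Variable T : R.
Hypothesis T_gt0 : 0 < T.
Local Notation D := (dom T).

Definition bump e x := pos2 (x - e) * pos2 (T - e - x).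
Definition dbump e x :=
  2 * Num.max (x - e) 0 * pos2 (T - e - x) - pos2 (x - e) * (2 * Num.max (T - e - x) 0).

Lemma is_derive_bump e x : is_derive x 1 (bump e) (dbump e x).
Proof.
have d1 : is_derive x 1 (fun x : R => x - e) 1.
  apply: (is_derive_ext (is_derive_affine (- e) 1 x)) => // t; by rewrite mul1r addrC.
have d2 : is_derive x 1 (fun x : R => T - e - x) (- 1).
  apply: (is_derive_ext (is_derive_affine (T - e) (-1) x)) => // t; by rewrite mulN1r.
have D1 := @is_derive1_comp R pos2 (fun x => x - e) x _ _ (is_derive_pos2 (x - e)) d1.
have D2 := @is_derive1_comp R pos2 (fun x => T - e - x) x _ _ (is_derive_pos2 (T - e - x)) d2.
apply: (is_derive_ext (is_deriveM D1 D2)) => //.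
rewrite -[LHS]/(pos2 (x - e) * (2 * Num.max (T - e - x) 0 * -1) +
  pos2 (T - e - x) * (2 * Num.max (x - e) 0 * 1)) /dbump; ring.
Qed.

Lemma dbump_continuous e : continuous (dbump e).
Proof.
have cp : continuous pos2 by move=> y; exact: is_derive_continuous (is_derive_pos2 y).
have c1 : continuous (fun x : R => x - e).
  by move=> x; apply: cvgB; [exact: cvg_id|exact: cvg_cst].
have c2 : continuous (fun x : R => T - e - x).
  by move=> x; apply: cvgB; [exact: cvg_cst|exact: cvg_id].
have m1 : continuous (fun x : R => Num.max (x - e) 0).
  by move=> x; exact: (@continuous_comp R R R (fun x => x - e) (fun y => Num.max y 0) x (c1 x) (@max0_continuous (x - e))).
have m2 : continuous (fun x : R => Num.max (T - e - x) 0).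
  by move=> x; exact: (@continuous_comp R R R (fun x => T - e - x) (fun y => Num.max y 0) x (c2 x) (@max0_continuous (T - e - x))).
have p1 : continuous (fun x : R => pos2 (x - e)).
  by move=> x; exact: (@continuous_comp R R R (fun x => x - e) pos2 x (c1 x) (cp _)).
have p2 : continuous (fun x : R => pos2 (T - e - x)).
  by move=> x; exact: (@continuous_comp R R R (fun x => T - e - x) pos2 x (c2 x) (cp _)).
move=> x; apply: cvgB.
  apply: cvgM; last exact: p2.
  by apply: cvgM; [exact: cvg_cst|exact: m1].
apply: cvgM; first exact: p1.
by apply: cvgM; [exact: cvg_cst|exact: m2].
Qed.

Lemma bump_out e x : x <= e \/ T - e <= x -> bump e x = 0 /\ dbump e x = 0.
Proof.
rewrite /bump /dbump /pos2 => -[h|h].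
  by rewrite (@max_r _ _ (x - e)) ?subr_le0 // expr0n; split; rewrite ?mul0r ?mulr0 ?mul0r ?subr0.
rewrite (@max_r _ _ (T - e - x)) ?subr_le0 // expr0n; split; rewrite ?mulr0 ?subr0 //.
Qed.

Section product.
Variables (G dG : R -> R).
Hypothesis GP : forall x, x \in `]0, T[ -> is_derive x 1 G (dG x).
Hypothesis dGc : {in `]0, T[, continuous dG}.
Variable e : R.
Hypothesis e_gt0 : 0 < e.

Let phi x := bump e x * G x.
Let dphi x := if x \in `]0, T[ then dbump e x * G x + bump e x * dG x else 0.

Lemma near_out x : x \notin `]0, T[ -> \forall t \near x, bump e t = 0 /\ dbump e t = 0.
Proof.
rewrite in_itv/= negb_and -!leNgt => /orP[x0|xT].
  near=> t; apply: bump_out; left; apply/ltW; near: t; apply: lt_nbhsl.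
  exact: le_lt_trans e_gt0.
near=> t; apply: bump_out; right; apply/ltW; near: t; apply: lt_nbhsr.
by apply: lt_le_trans xT; rewrite ltrBlDr ltrDl.
Unshelve. all: by end_near. Qed.

Lemma bump_product_derive x : is_derive x 1 phi (dphi x).
Proof.
rewrite /dphi; case: ifPn => xD.
  apply: (is_derive_ext (is_deriveM (is_derive_bump e x) (GP xD))) => //.
  rewrite -[LHS]/(bump e x * dG x + G x * dbump e x); ring.
have E : \forall t \near x, phi t = (fun=> 0 : R) t.
  by apply: filterS (near_out xD) => t [h _]; rewrite /phi h mul0r.
have [d v] := @is_derive_cst R R R (0 : R) x 1.
split; last by rewrite (near_eq_derive _ E).
by apply: near_eq_derivable d; apply: filterS E => t ->.
Qed.

Lemma bump_product_continuous : continuous dphi.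
Proof.
move=> x; case: (boolP (x \in `]0, T[)) => xD.
  have E : \forall t \near x, dphi t = dbump e t * G t + bump e t * dG t.
    by apply: filterS (near_in_itvoo xD) => t tD; rewrite /dphi tD.
  have c : {for x, continuous (fun t => dbump e t * G t + bump e t * dG t)}.
    apply: cvgD; apply: cvgM.
    - exact: dbump_continuous.
    - exact: is_derive_continuous (GP xD).
    - exact: is_derive_continuous (is_derive_bump e x).
    - exact: dGc.
  rewrite /continuous_at {2}/dphi xD; apply: cvg_trans c.
  by apply: near_eq_cvg; apply: filterS E => t ->.
have E : \forall t \near x, dphi t = 0.
  apply: filterS (near_out xD) => t [h1 h2]; rewrite /dphi h1 h2 !mul0r addr0.
  by case: ifP.
rewrite /continuous_at {2}/dphi (negbTE xD); apply: cvg_near_cst; exact: E.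
Qed.

(** [G] may be singular at [0] and [T], but the cut-off vanishes near every point outside []0, T[],
    so the product is of class C^1 on the whole line. *)
Lemma bump_product_Cc : Cc T 1 phi.
Proof.
have dE : derive1 phi = dphi.
  by apply/funext => x; rewrite derive1E; case: (bump_product_derive x).
split.
- by case=> // _ x; rewrite /derive1n /=; case: (bump_product_derive x).
- rewrite (_ : derive1n 1 phi = dphi) //; exact: bump_product_continuous.
exists e, (T - e); split => //; first by rewrite ltrBlDr ltrDl.
move=> x; rewrite in_itv/= negb_and -!ltNge => /orP[h|h].
  by rewrite /phi (bump_out (or_introl (ltW h))).1 mul0r.
by rewrite /phi (bump_out (or_intror (ltW h))).1 mul0r.
Qed.

Lemma bump_product_derive1 x : D x -> derive1 phi x = dbump e x * G x + bump e x * dG x.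
Proof.
move=> Dx; rewrite derive1E; case: (bump_product_derive x) => _ ->.
by rewrite /dphi; move: Dx; rewrite /dom /= => ->.
Qed.

End product.
End cutoff.

Section weak_integration_by_parts.
Variable R : realType.
Local Notation mu := (@lebesgue_measure R).
Variables (T g b : R).
Hypothesis T_gt0 : 0 < T.
Hypothesis g_ge0 : 0 <= g.
Hypothesis b_ge0 : 0 <= b.
Local Notation D := (dom T).
Implicit Types (p q : {poly R}) (v w : R -> R).

(* [(omega^(g+1, b+1) q)' = omega^(g, b) (adj q)]. *)
Definition adj q : {poly R} :=
  (((b + 1) * T)%:P - (g + b + 2) *: 'X) * q + 'X * (T%:P - 'X) * q^`().

Lemma adjE q x : (adj q).[x] =
  ((b + 1) * T - (g + b + 2) * x) * q.[x] + x * (T - x) * q^`().[x].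
Proof.
rewrite /adj hornerD !hornerM !hornerD !hornerN hornerZ hornerX !hornerC.
by [].
Qed.

(* The test functions [bump T e * G q] tend to [omega^(g+1, b+1) q] as [e] goes to 0: the
   bump tends to [x^2 (T - x)^2], and vanishes to second order so that the derivatives are
   dominated uniformly in [e]. *)
Let G q x := x `^ (b - 1) * (T - x) `^ (g - 1) * q.[x].
Let dG q x := x `^ (b - 1) * (T - x) `^ (g - 1) * q^`().[x] +
  ((b - 1) * x `^ (b - 1 - 1) * (T - x) `^ (g - 1) -
   x `^ (b - 1) * ((g - 1) * (T - x) `^ (g - 1 - 1))) * q.[x].

Let dGP q x : x \in `]0, T[ -> is_derive x 1 (G q) (dG q x).
Proof.
rewrite in_itv/= => /andP[x0 xT].
have d1 := is_derive1_powR (b - 1) x0.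
have d2 := is_derive_powRr (g - 1) xT.
have d3 := is_derive_poly q x.
apply: (is_derive_ext (is_deriveM (is_deriveM d1 d2) d3)) => //.
rewrite -[LHS]/(x `^ (b - 1) * (T - x) `^ (g - 1) * q^`().[x] +
  q.[x] * (x `^ (b - 1) * - ((g - 1) * (T - x) `^ (g - 1 - 1)) +
   (T - x) `^ (g - 1) * ((b - 1) * x `^ (b - 1 - 1)))) /dG; ring.
Qed.

Let cpl (a : R) : {in `]0, T[, continuous (fun x => x `^ a)}.
Proof.
move=> x; rewrite in_itv/= => /andP[x0 _].
exact: is_derive_continuous (is_derive1_powR a x0).
Qed.

Let dGc q : {in `]0, T[, continuous (dG q)}.
Proof.
move=> x xD; have xT := @continuous_oo_powRr R 0 T _ x xD.
apply: cvgD; apply: cvgM; first by apply: cvgM; [exact: cpl|exact: xT].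
- exact: continuous_poly.
- apply: cvgB; apply: cvgM; last by apply: cvgM; [exact: cvg_cst|exact: xT].
  + by apply: cvgM; [exact: cvg_cst|exact: cpl].
  + exact: xT.
  + exact: cpl.
exact: continuous_poly.
Qed.

Let ep n : R := T / n.+3%:R.
Let ep0 n : 0 < ep n. Proof. by rewrite divr_gt0. Qed.
Let cvg_ep : ep n @[n --> \oo] --> (0 : R).
Proof.
rewrite -(mulr0 T); apply: cvgM; first exact: cvg_cst.
apply/gtr0_cvgV0; first exact: nearW.
apply: (@ger_cvgy _ _ _ _ (fun n => n%:R)); last exact: cvgr_idn.
by apply: nearW => n; rewrite ler_nat -addn3 leq_addr.
Qed.

Let max0_bound (x e : R) : 0 < e -> 0 <= x -> (0 : R) <= Num.max (x - e) 0 <= x.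
Proof.
move=> e0 x0; rewrite le_max lexx orbT /= ge_max x0 andbT; lra.
Qed.

Let powm1 (x a : R) : 0 < x -> x ^+ 2 * x `^ (a - 1) = x `^ (a + 1).
Proof.
move=> x0; rewrite -(powR_mulrn 2 (ltW x0)) -powRD_gt0 //; congr (_ `^ _); ring.
Qed.

Let powm0 (x a : R) : 0 < x -> x * x `^ (a - 1) = x `^ a.
Proof.
by move=> x0; rewrite -{1}(powRr1 (ltW x0)) -powRD_gt0 //; congr (_ `^ _); ring.
Qed.

Let powm2 (x a : R) : 0 < x -> x ^+ 2 * x `^ (a - 1 - 1) = x `^ a.
Proof.
move=> x0; rewrite -(powR_mulrn 2 (ltW x0)) -powRD_gt0 //; congr (_ `^ _); ring.
Qed.

(* The limit and a bound of the derivative of the truncated test function. *)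
Let L q x := omega T g b x * (adj q).[x].
Let bnd q x := omega T g b x * (2 * T * `|q.[x]| + T ^+ 2 * `|q^`().[x]| +
   (`|b - 1| + `|g - 1|) * T * `|q.[x]|).

(** The cut-off factors [M <= x] and [N <= T - x] compensate the lowered exponents: each product
    with powers of [x] and [T - x] is at most a constant times [omega T g b x], uniformly in [n]. *)
Let dphi_bound q n x : D x ->
  `|dbump T (ep n) x * G q x + bump T (ep n) x * dG q x| <= bnd q x.
Proof.
move=> Dx; have [x0 xT] := domP Dx.
have Tx0 : 0 < T - x by rewrite subr_gt0.
have /andP[m1 m1'] := max0_bound (ep0 n) (ltW x0).
have /andP[m2 m2'] := max0_bound (ep0 n) (ltW Tx0).
rewrite /dbump /bump /pos2 (_ : T - ep n - x = T - x - ep n); last by rewrite addrAC.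
set M := Num.max (x - ep n) 0 in m1 m1' *.
set N := Num.max (T - x - ep n) 0 in m2 m2' *.
rewrite /G /dG.
set X := x `^ (b - 1); set Y := (T - x) `^ (g - 1).
set X' := x `^ (b - 1 - 1); set Y' := (T - x) `^ (g - 1 - 1).
have X0 : 0 <= X by exact: powR_ge0.
have Y0 : 0 <= Y by exact: powR_ge0.
have X'0 : 0 <= X' by exact: powR_ge0.
have Y'0 : 0 <= Y' by exact: powR_ge0.
have MM : M ^+ 2 <= x ^+ 2 by rewrite lerXn2r ?nnegrE ?(ltW x0).
have NN : N ^+ 2 <= (T - x) ^+ 2 by rewrite lerXn2r ?nnegrE ?(ltW Tx0).
have w0 : 0 <= omega T g b x by exact: omega_ge0.
have A1 : M * N ^+ 2 * (X * Y) <= T * omega T g b x.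
  apply: (@le_trans _ _ (x * (T - x) ^+ 2 * (X * Y))).
    by apply: ler_wpM2r; [exact: mulr_ge0|apply: ler_pM; rewrite ?sqr_ge0].
  have -> : x * (T - x) ^+ 2 * (X * Y) = (T - x) * ((T - x) * Y * (x * X)) by ring.
  by rewrite /X /Y !powm0 // ler_wpM2r // gerBl ltW.
have A2 : M ^+ 2 * N * (X * Y) <= T * omega T g b x.
  apply: (@le_trans _ _ (x ^+ 2 * (T - x) * (X * Y))).
    by apply: ler_wpM2r; [exact: mulr_ge0|apply: ler_pM; rewrite ?sqr_ge0].
  have -> : x ^+ 2 * (T - x) * (X * Y) = x * ((T - x) * Y * (x * X)) by ring.
  by rewrite /X /Y !powm0 // ler_wpM2r // ltW.
have A3 : M ^+ 2 * N ^+ 2 * (X * Y) <= T ^+ 2 * omega T g b x.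
  apply: (@le_trans _ _ (x ^+ 2 * (T - x) ^+ 2 * (X * Y))).
    by apply: ler_wpM2r; [exact: mulr_ge0|apply: ler_pM; rewrite ?sqr_ge0].
  have -> : x ^+ 2 * (T - x) ^+ 2 * (X * Y) = (x * (T - x)) * ((T - x) * Y * (x * X)) by ring.
  rewrite /X /Y !powm0 // expr2 ler_wpM2r //.
  by apply: ler_pM; rewrite ?(ltW x0) ?(ltW xT) ?(ltW Tx0) // gerBl ltW.
have A4 : M ^+ 2 * N ^+ 2 * (X' * Y) <= T * omega T g b x.
  apply: (@le_trans _ _ (x ^+ 2 * (T - x) ^+ 2 * (X' * Y))).
    by apply: ler_wpM2r; [exact: mulr_ge0|apply: ler_pM; rewrite ?sqr_ge0].
  have -> : x ^+ 2 * (T - x) ^+ 2 * (X' * Y) = (T - x) * ((T - x) * Y * (x ^+ 2 * X')) by ring.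
  by rewrite /X' /Y powm2 // powm0 // ler_wpM2r // gerBl ltW.
have A5 : M ^+ 2 * N ^+ 2 * (X * Y') <= T * omega T g b x.
  apply: (@le_trans _ _ (x ^+ 2 * (T - x) ^+ 2 * (X * Y'))).
    by apply: ler_wpM2r; [exact: mulr_ge0|apply: ler_pM; rewrite ?sqr_ge0].
  have -> : x ^+ 2 * (T - x) ^+ 2 * (X * Y') = x * ((T - x) ^+ 2 * Y' * (x * X)) by ring.
  by rewrite /X /Y' powm2 // powm0 // ler_wpM2r // ltW.
have -> : (2 * M * N ^+ 2 - M ^+ 2 * (2 * N)) * (X * Y * q.[x]) +
   M ^+ 2 * N ^+ 2 * (X * Y * q^`().[x] + ((b - 1) * X' * Y - X * ((g - 1) * Y')) * q.[x]) =
   (2 * (M * N ^+ 2 * (X * Y)) - 2 * (M ^+ 2 * N * (X * Y))) * q.[x] +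
   (M ^+ 2 * N ^+ 2 * (X * Y) * q^`().[x] +
   ((b - 1) * (M ^+ 2 * N ^+ 2 * (X' * Y)) - (g - 1) * (M ^+ 2 * N ^+ 2 * (X * Y'))) * q.[x]).
  by ring.
have B1 : 0 <= M * N ^+ 2 * (X * Y) by rewrite !mulr_ge0 ?sqr_ge0.
have B2 : 0 <= M ^+ 2 * N * (X * Y) by rewrite !mulr_ge0 ?sqr_ge0.
have B3 : 0 <= M ^+ 2 * N ^+ 2 * (X * Y) by rewrite !mulr_ge0 ?sqr_ge0.
have B4 : 0 <= M ^+ 2 * N ^+ 2 * (X' * Y) by rewrite !mulr_ge0 ?sqr_ge0.
have B5 : 0 <= M ^+ 2 * N ^+ 2 * (X * Y') by rewrite !mulr_ge0 ?sqr_ge0.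
rewrite /bnd !mulrDr -!addrA.
apply: le_trans (ler_normD _ _) _; apply: lerD.
  rewrite normrM (_ : omega T g b x * (2 * T * `|q.[x]|) = 2 * (T * omega T g b x) * `|q.[x]|); last by ring.
  apply: ler_wpM2r; first exact: normr_ge0.
  move: A1 A2 B1 B2; move: (M * _ * _) (M ^+ 2 * N * _) (T * _) => a1 a2 a3 A1 A2 B1 B2.
  by rewrite ler_norml; apply/andP; split; lra.
apply: le_trans (ler_normD _ _) _; apply: lerD.
  rewrite normrM mulrA (ger0_norm B3) (mulrC (omega _ _ _ _)).
  exact: (ler_wpM2r (normr_ge0 _) A3).
rewrite normrM [leRHS]mulrA; apply: (ler_wpM2r (normr_ge0 _)).
apply: le_trans (ler_normB _ _) _.
rewrite (normrM (b - 1)) (normrM (g - 1)) (ger0_norm B4) (ger0_norm B5).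
have -> : omega T g b x * ((`|b - 1| + `|g - 1|) * T) =
  `|b - 1| * (T * omega T g b x) + `|g - 1| * (T * omega T g b x) by ring.
by apply: lerD; apply: ler_wpM2l => //; exact: normr_ge0.
Qed.

Let cvg_max_ep x : 0 <= x -> Num.max (x - ep n) 0 @[n --> \oo] --> x.
Proof.
move=> x0; rewrite -[X in _ --> X](max_l x0) -[X in _ --> Num.max X _]subr0.
apply: (@cvg_comp _ _ _ (fun n => x - ep n) (fun y : R => Num.max y 0) _ (nbhs (x - 0))).
  by apply: cvgB; [exact: cvg_cst|exact: cvg_ep].
exact: max0_continuous.
Qed.

Let dphi_cvg q x : D x ->
  (dbump T (ep n) x * G q x + bump T (ep n) x * dG q x) @[n --> \oo] --> L q x.
Proof.
move=> Dx; have [x0 xT] := domP Dx.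
have Tx0 : 0 < T - x by rewrite subr_gt0.
have c1 := cvg_max_ep (ltW x0).
have c2 := cvg_max_ep (ltW Tx0).
have -> : L q x = (2 * x * ((T - x) * (T - x)) - x * x * (2 * (T - x))) * G q x +
    x * x * ((T - x) * (T - x)) * dG q x.
  rewrite /L adjE /G /dG /omega -(powm0 b x0) -(powm0 g Tx0).
  have e1 : x `^ (b - 1) = x * x `^ (b - 1 - 1) by rewrite powm0.
  have e2 : (T - x) `^ (g - 1) = (T - x) * (T - x) `^ (g - 1 - 1) by rewrite powm0.
  by rewrite e1 e2; ring.
rewrite (_ : (fun n => _) = (fun n =>
   (2 * Num.max (x - ep n) 0 * (Num.max (T - x - ep n) 0 * Num.max (T - x - ep n) 0) -
    Num.max (x - ep n) 0 * Num.max (x - ep n) 0 * (2 * Num.max (T - x - ep n) 0)) * G q x +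
   Num.max (x - ep n) 0 * Num.max (x - ep n) 0 *
    (Num.max (T - x - ep n) 0 * Num.max (T - x - ep n) 0) * dG q x)); last first.
  apply/funext => n; rewrite /dbump /bump /pos2 !expr2 (_ : T - ep n - x = T - x - ep n) //.
  by rewrite addrAC.
apply: cvgD; (apply: cvgM; last exact: cvg_cst).
  apply: cvgB; apply: cvgM; try exact: cvgM; apply: cvgM => //; exact: cvg_cst.
by apply: cvgM; exact: cvgM.
Qed.

(** The definition of the weak derivative is applied to the truncated test functions, and dominated
    convergence passes to the limit on both sides; the vanishing of [omega^(g+1, b+1)] at the
    endpoints is why no boundary term appears. *)
Lemma weak_ibp v v' q : weak_derivative T v v' -> L2w T g b v ->
  L2w T (g + 1) (b + 1) v' ->
  winner T (g + 1) (b + 1) v' (horner q) = - winner T g b v (horner (adj q)).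
Proof.
move=> [_ _ wd] v2 v'2.
have g1 : 0 <= g + 1 by rewrite addr_ge0.
have b1 : 0 <= b + 1 by rewrite addr_ge0.
pose phi n x := bump T (ep n) x * G q x.
have phiCc n : Cc T 1 (phi n) := bump_product_Cc (@dGP q) (@dGc q) (ep0 n).
have dphiE n x : D x -> derive1 (phi n) x = dbump T (ep n) x * G q x + bump T (ep n) x * dG q x.
  exact: (bump_product_derive1 (@dGP q) (ep0 n)).
have mphi n : measurable_fun D (phi n).
  apply: measurable_funTS; apply: continuous_measurable_fun => x.
  case: (phiCc n) => d _ _; have := d 0%N isT x => dd.
  by apply: differentiable_continuous; exact/derivable1_diffP.
have mdphi n : measurable_fun D (derive1 (phi n)).
  apply: measurable_funTS; apply: continuous_measurable_fun.
  by case: (phiCc n) => _ + _.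
have mv := L2w_measurable v2; have mv' := L2w_measurable v'2.
have q2 := L2w_poly T_gt0 q g1 b1.
have lim1 : (\int[mu]_(x in D) (v' x * phi n x)) @[n --> \oo] -->
    winner T (g + 1) (b + 1) v' (horner q).
  apply: (Rint_dominated (mdom T) _ _ (intg_norm (L2w_prod v'2 q2))).
  - by move=> n; exact: measurable_funM.
  - by apply: (intg_measurable (L2w_prod v'2 q2)).
  - move=> x Dx; have [x0 xT] := domP Dx.
    have Tx0 : 0 < T - x by rewrite subr_gt0.
    have c1 := cvg_max_ep (ltW x0); have c2 := cvg_max_ep (ltW Tx0).
    rewrite -mulrA; apply: cvgM; first exact: cvg_cst.
    have -> : q.[x] * omega T (g + 1) (b + 1) x = x * x * ((T - x) * (T - x)) * G q x.
      by rewrite /omega -!powm1 // /G; ring.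
    rewrite (_ : (fun n => _) = (fun n => Num.max (x - ep n) 0 * Num.max (x - ep n) 0 *
      (Num.max (T - x - ep n) 0 * Num.max (T - x - ep n) 0) * G q x)); last first.
      apply/funext => n; rewrite /phi /bump /pos2 !expr2 (_ : T - ep n - x = T - x - ep n) //.
      by rewrite addrAC.
    by apply: cvgM; [apply: cvgM; exact: cvgM|exact: cvg_cst].
  - move=> n x Dx; have [x0 xT] := domP Dx.
    have Tx0 : 0 < T - x by rewrite subr_gt0.
    have /andP[m1 m1'] := max0_bound (ep0 n) (ltW x0).
    have /andP[m2 m2'] := max0_bound (ep0 n) (ltW Tx0).
    rewrite -mulrA (normrM (v' x)) (normrM (v' x)); apply: (ler_wpM2l (normr_ge0 _)).
    set M := Num.max (x - ep n) 0 in m1 m1' *; set N := Num.max (T - x - ep n) 0 in m2 m2' *.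
    have MM : M ^+ 2 <= x ^+ 2 by rewrite lerXn2r ?nnegrE ?(ltW x0).
    have NN : N ^+ 2 <= (T - x) ^+ 2 by rewrite lerXn2r ?nnegrE ?(ltW Tx0).
    rewrite (_ : `|q.[x] * omega T (g + 1) (b + 1) x| = x ^+ 2 * (T - x) ^+ 2 * `|G q x|); last first.
      rewrite -[in RHS](ger0_norm (mulr_ge0 (sqr_ge0 x) (sqr_ge0 (T - x)))) -normrM.
      by rewrite /omega -(powm1 b x0) -(powm1 g Tx0) /G; congr `|_|; ring.
    have -> : phi n x = M ^+ 2 * N ^+ 2 * G q x.
      by rewrite /phi /bump /pos2 (_ : T - ep n - x = T - x - ep n) // addrAC.
    rewrite normrM (ger0_norm (mulr_ge0 (sqr_ge0 M) (sqr_ge0 N))).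
    apply: (ler_wpM2r (normr_ge0 _)).
    by apply: ler_pM; rewrite ?sqr_ge0.
have Lq := L2w_poly T_gt0 (adj q) g_ge0 b_ge0.
have [k kb] : exists k, forall x, D x -> 2 * T * `|q.[x]| + T ^+ 2 * `|q^`().[x]| +
   (`|b - 1| + `|g - 1|) * T * `|q.[x]| <= k.
  have [k1 h1] := continuous_bounded_dom T (continuous_poly (p := q)).
  have [k2 h2] := continuous_bounded_dom T (continuous_poly (p := q^`())).
  exists (2 * T * k1 + T ^+ 2 * k2 + (`|b - 1| + `|g - 1|) * T * k1) => x Dx.
  by rewrite !lerD // ler_wpM2l ?h1 ?h2 ?sqr_ge0 ?mulr_ge0 ?addr_ge0 // ltW.
have one2 : L2w T g b (fun=> 1) by apply: L2w_continuous => // x; exact: cvg_cst.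
have lim2 : (\int[mu]_(x in D) (v x * derive1 (phi n) x)) @[n --> \oo] -->
    winner T g b v (horner (adj q)).
  apply: (Rint_dominated (mdom T) _ _ (intgZ (mdom T) k (intg_norm (L2w_prod v2 one2)))).
  - by move=> n; exact: measurable_funM.
  - by apply: (intg_measurable (L2w_prod v2 Lq)).
  - move=> x Dx; rewrite -mulrA; apply: cvgM; first exact: cvg_cst.
    rewrite (_ : (fun n => _) = (fun n => dbump T (ep n) x * G q x + bump T (ep n) x * dG q x)); last first.
      by apply/funext => n; rewrite dphiE.
    by rewrite mulrC; exact: dphi_cvg.
  - move=> n x Dx; rewrite dphiE // mulr1 (normrM (v x)) (normrM (v x)) [leRHS]mulrCA; apply: (ler_wpM2l (normr_ge0 _)).
    apply: le_trans (dphi_bound q n Dx) _.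
    by rewrite (ger0_norm (omega_ge0 _ _ _ _)) /bnd mulrC ler_wpM2r ?omega_ge0 // kb.
have lim3 : (\int[mu]_(x in D) (v x * derive1 (phi n) x)) @[n --> \oo] -->
    - winner T (g + 1) (b + 1) v' (horner q).
  rewrite (_ : (fun n => _) = (fun n => - \int[mu]_(x in D) (v' x * phi n x))); last first.
    by apply/funext => n; rewrite wd.
  exact: cvgN.
by rewrite -(cvg_unique (@Rhausdorff R) lim3 lim2) opprK.
Qed.

End weak_integration_by_parts.

Section weak_derivative_of_polynomials.
Variable R : realType.
Local Notation mu := (@lebesgue_measure R).
Variable T : R.
Hypothesis T_gt0 : 0 < T.
Local Notation D := (dom T).
Implicit Types (p q : {poly R}).

Lemma intg_continuous (f : R -> R) : continuous f -> intg D f.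
Proof.
move=> cf; have [k fk] := continuous_bounded_dom T cf.
apply: (intg_bounded T_gt0 _ fk).
by apply: measurable_funTS; exact: continuous_measurable_fun.
Qed.

Lemma weak_derivative_poly p : weak_derivative T (horner p) (horner p^`()).
Proof.
have oD : open (D : set R) by exact: itv_open.
have li q : locally_integrable D (horner q).
  apply: open_integrable_locally => //; exact: intg_continuous (continuous_poly (p := q)).
split; [exact: li|exact: li|move=> phi [dphi cphi [a [b [a0 bT ab]]]]].
have dphi0 (x : R) : is_derive x 1 phi (derive1 phi x).
  by have d := dphi 0%N isT x; split; rewrite ?derive1E.
have phi_c : continuous phi.
  by move=> x; exact: is_derive_continuous (dphi0 x).
have dF (x : R) : is_derive x 1 (fun x => p.[x] * phi x) (p.[x] * derive1 phi x + p^`().[x] * phi x).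
  apply: (is_derive_ext (is_deriveM (is_derive_poly p x) (dphi0 x))) => //.
  by rewrite -[LHS]/(p.[x] * derive1 phi x + phi x * p^`().[x]) (mulrC (phi x)).
have c1 : continuous (fun x => p.[x] * derive1 phi x).
  by move=> x; apply: cvgM; [exact: continuous_poly|exact: cphi].
have c2 : continuous (fun x => p^`().[x] * phi x).
  by move=> x; apply: cvgM; [exact: continuous_poly|exact: phi_c].
have c3 : continuous (fun x => p.[x] * derive1 phi x + p^`().[x] * phi x).
  by move=> x; apply: cvgD; [exact: c1|exact: c2].
apply/eqP; rewrite -addr_eq0 -(RintD (mdom T) (intg_continuous c1) (intg_continuous c2)).
have cF : {within `[0, T], continuous (fun x => p.[x] * phi x)}.
  apply: continuous_subspaceT => x.
  by apply: cvgM; [exact: continuous_poly|exact: phi_c].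
have cf : {in `]0, T[, continuous (fun x => p.[x] * derive1 phi x + p^`().[x] * phi x)}.
  by move=> x _; exact: c3.
have dFi (x : R) : x \in `]0, T[ -> is_derive x 1 (fun x => p.[x] * phi x) (p.[x] * derive1 phi x + p^`().[x] * phi x).
  by move=> _; exact: dF.
rewrite (Rintegral_oo_FTC T_gt0 cF dFi cf (intg_continuous c3)).
rewrite !ab ?mulr0 ?subrr // in_itv/= negb_and -!ltNge ?a0 //.
by rewrite bT orbT.
Qed.

End weak_derivative_of_polynomials.

Section antiderivative.
Variable R : realType.
Implicit Types (q : {poly R}).

Definition antideriv q : {poly R} :=
  \poly_(i < (size q).+1) (if i == 0%N then 0 else q`_i.-1 / i%:R).

Lemma antiderivK q : (antideriv q)^`() = q.
Proof.
apply/polyP => i; rewrite coef_deriv coef_poly ltnS /=; case: ltnP => [iq|iq].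
  by rewrite -[LHS]mulr_natr divfK // pnatr_eq0.
by rewrite mul0rn nth_default.
Qed.

Lemma size_antideriv q : (size (antideriv q) <= (size q).+1)%N.
Proof. exact: size_poly. Qed.

End antiderivative.

(** * The Sturm-Liouville equation and Jackson's estimate *)

Section sturm_liouville.
Variable R : realType.
Variables (T g b : R).
Hypothesis T_gt0 : 0 < T.
Hypothesis g_ge0 : 0 <= g.
Hypothesis b_ge0 : 0 <= b.
Implicit Types (p q r : {poly R}) (v w : R -> R).
Local Notation ip := (winner T g b).
Local Notation ip' := (winner T (g + 1) (b + 1)).
Local Notation A := (adj T g b).

Let g1_ge0 : 0 <= g + 1. Proof. by rewrite addr_ge0. Qed.
Let b1_ge0 : 0 <= b + 1. Proof. by rewrite addr_ge0. Qed.
Let L p : L2w T g b (horner p). Proof. exact: L2w_poly. Qed.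
Let L' p : L2w T (g + 1) (b + 1) (horner p). Proof. exact: L2w_poly. Qed.

(** What the approximation argument uses of a weak derivative: integration by parts against
    polynomials, a relation stable under subtracting a polynomial from [v] and its derivative from
    [v']. *)
Definition jacobi_ibp v v' := forall q, ip' v' (horner q) = - ip v (horner (A q)).

Lemma jacobi_ibp_poly p : jacobi_ibp (horner p) (horner p^`()).
Proof.
by move=> q; apply: (weak_ibp T_gt0 g_ge0 b_ge0) => //; exact: weak_derivative_poly.
Qed.

Lemma adj_linear a p q : A (a *: p + q) = a *: A p + A q.
Proof. by rewrite /adj derivD derivZ !mulrDr -!scalerAr scalerDr; ring. Qed.

Lemma adj0 : A 0 = 0.
Proof. by rewrite /adj deriv0 !mulr0 addr0. Qed.

Lemma coef_adjS q j : (A q)`_j.+1 =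
  (b + 2 + j%:R) * T * q`_j.+1 - (g + b + 2 + j%:R) * q`_j.
Proof.
have -> : A q = ((b + 1) * T) *: q - (g + b + 2) *: (q * 'X) + T *: (q^`() * 'X) - q^`() * 'X * 'X.
  by rewrite /adj -!mul_polyC; ring.
rewrite !(coefB, coefD, coefZ, coefMX) /= coef_deriv -mulr_natr -natr1.
case: j => [|j] /=; first by ring.
by rewrite coef_deriv -mulr_natr -natr1; ring.
Qed.

Lemma size_adj n q : (size q <= n)%N -> (size (A q) <= n.+1)%N.
Proof.
move=> qn; apply/leq_sizeP => -[//|j] nj.
by rewrite coef_adjS !nth_default ?mulr0 ?subrr // (leq_trans qn) // ltnW.
Qed.

Lemma coef_adj n q : (size q <= n.+1)%N ->
  (A q)`_n.+1 = - ((g + b + 2 + n%:R) * q`_n).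
Proof. by move=> qn; rewrite coef_adjS (nth_default _ qn) mulr0 sub0r. Qed.

Variable P : nat -> {poly R}.
Hypothesis oP : orth_family T g b P.
Local Notation h := (hsq T g b P).
Local Notation cf := (coefs T g b P).

Definition sl_eigen n : R := n%:R * (n%:R + g + b + 1).

Lemma sl_eigen_ge n : n%:R ^+ 2 <= sl_eigen n.
Proof. by rewrite /sl_eigen expr2 ler_wpM2l // -!addrA lerDl !addr_ge0. Qed.

(** Differentiation followed by [A] is symmetric and does not raise the degree, so its value at
    [P n] is orthogonal to all lower degrees, hence a multiple of [P n]; the leading coefficient
    gives the eigenvalue. *)
Lemma adj_deriv_orth n : A (P n)^`() = - sl_eigen n *: P n.
Proof.
have [sn on] := oP n.
have sz q m : (size q <= m.+1)%N -> (size q^`() <= m)%N.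
  by move=> qm; apply/leq_sizeP => j mj; rewrite coef_deriv nth_default ?mul0rn // (leq_trans qm).
have sA : (size (A (P n)^`()) <= n.+1)%N by apply: size_adj; apply: sz; rewrite sn.
have l0 := coef_last_neq0 sn.
rewrite (orth_lead T_gt0 g_ge0 b_ge0 oP sA); last first.
  move=> r rn; rewrite ipC; apply: oppr_inj; rewrite oppr0 -jacobi_ibp_poly ipC.
  rewrite jacobi_ibp_poly on ?oppr0 //.
  case: n rn {sn on sA l0} => [|n] rn; last exact/size_adj/sz.
  move: rn; rewrite leqn0 size_poly_eq0 => /eqP ->.
  by rewrite deriv0 adj0 size_poly0.
congr (_ *: _); apply: (mulIf l0); rewrite divfK //.
case: n sn {on sA l0} => [|n] sn.
  rewrite /sl_eigen mul0r oppr0 mul0r (size1_polyC (_ : (size (P 0) <= 1)%N)) ?sn //.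
  by rewrite derivC adj0 coef0.
rewrite coef_adj; last by apply: sz; rewrite sn.
by rewrite coef_deriv /sl_eigen -mulr_natr -natr1; ring.
Qed.

(** In place of a Parseval identity for an infinite series, only the block [d] of modes from [n] up
    to [M] is considered: [|d'|^2 = <v', d'>] gives [|d'| <= |v'|], the eigenvalues give
    [n |d| <= |d'|], and what lies beyond [M] is at most [e] by density. *)
Lemma jackson_step v v' n : L2w T g b v -> L2w T (g + 1) (b + 1) v' ->
  jacobi_ibp v v' -> (0 < n)%N ->
  exists2 p : {poly R}, (size p <= n)%N &
    nrm T g b (fun x => v x - p.[x]) <= nrm T (g + 1) (b + 1) v' / n%:R.
Proof.
move=> v2 v'2 vv' n0; exists (\sum_(k < n) cf v k *: P k); first exact: size_orth_sum.
have nR0 : 0 < n%:R :> R by rewrite ltr0n.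
apply/ler_addgt0Pr => e e0.
have [q qe] := poly_dense T_gt0 g_ge0 b_ge0 v2 e0.
pose M := maxn (size q) n.
pose e_ k := if (k < n)%N then 0 else cf v k.
pose d := \sum_(k < M) e_ k *: P k.
have pd : \sum_(k < n) cf v k *: P k = \sum_(k < M) cf v k *: P k - d.
  rewrite -sumrB (big_ord_widen M (fun k => cf v k *: P k)) ?leq_maxr // big_mkcond /=.
  by apply: eq_bigr => k _; rewrite /e_ -scalerBl; case: ifP => _; rewrite ?subr0 // subrr scale0r.
have Ad : A d^`() = \sum_(k < M) (- sl_eigen k * e_ k) *: P k.
  rewrite /d raddf_sum /= {d pd}; elim: M => [|m IH].
    by rewrite !big_ord0 adj0.
  by rewrite !big_ord_recr /= addrC derivZ adj_linear IH adj_deriv_orth scalerA (mulrC (e_ m)) addrC.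
have E1 : ip' (horner d^`()) (horner d^`()) = \sum_(k < M) sl_eigen k * e_ k ^+ 2 * h k.
  rewrite jacobi_ibp_poly Ad /d (ip_orth_sum T_gt0 g_ge0 b_ge0 oP M e_ (fun k => - sl_eigen k * e_ k)) -sumrN.
  by apply: eq_bigr => k _; ring.
have E2 : ip' v' (horner d^`()) = \sum_(k < M) sl_eigen k * e_ k ^+ 2 * h k.
  rewrite vv' Ad (ip_poly_sumr T_gt0 g_ge0 b_ge0 _ (fun k : 'I_M => - sl_eigen k * e_ k) (fun k : 'I_M => P k) v2) -sumrN; apply: eq_bigr => k _.
  have -> : ip v (horner (P k)) = cf v k * h k.
    by rewrite /coefs divfK // gt_eqF // hsq_gt0.
  by rewrite /e_; case: ifP => _; ring.
have E3 : n%:R ^+ 2 * ip (horner d) (horner d) <= ip' (horner d^`()) (horner d^`()).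
  rewrite E1 /d (ip_orth_sum T_gt0 g_ge0 b_ge0 oP M e_ e_) mulr_sumr; apply: ler_sum => k _.
  have hk := ltW (hsq_gt0 T_gt0 g_ge0 b_ge0 oP k).
  rewrite mulrA -expr2 ler_wpM2r //; rewrite /e_; case: ltnP => kn.
    by rewrite expr0n /= !mulr0.
  rewrite ler_wpM2r ?sqr_ge0 //; apply: le_trans (sl_eigen_ge k).
  by rewrite lerXn2r ?nnegrE // ler_nat.
have d_le : nrm T g b (horner d) <= nrm T (g + 1) (b + 1) v' / n%:R.
  rewrite ler_pdivlMr //.
  have s1 : nrm T (g + 1) (b + 1) (horner d^`()) <= nrm T (g + 1) (b + 1) v'.
    have := ip_CS v'2 (L' d^`()); rewrite E2 -E1 -nrm_sq ger0_norm ?sqr_ge0 // expr2.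
    have [->|z] := eqVneq (nrm T (g + 1) (b + 1) (horner d^`())) 0; first by rewrite nrm_ge0.
    by rewrite ler_pM2r // lt_neqAle eq_sym z nrm_ge0.
  apply: le_trans s1; rewrite -(@ler_pXn2r R 2 isT) ?nnegrE ?nrm_ge0 ?mulr_ge0 ?nrm_ge0 //.
  by rewrite exprMn !nrm_sq mulrC.
have pm : nrm T g b (fun x => v x - (\sum_(k < M) cf v k *: P k).[x]) <= e.
  apply: le_trans qe.
  apply: (projection_best T_gt0 g_ge0 b_ge0 v2 (n := M)).
  - exact: size_orth_sum.
  - exact: leq_maxl.
  - exact: projE.
have -> : nrm T g b (fun x => v x - (\sum_(k < n) cf v k *: P k).[x]) =
    nrm T g b (fun x => (v x - (\sum_(k < M) cf v k *: P k).[x]) + d.[x]).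
  by apply: nrm_eq => x _; rewrite pd hornerD hornerN opprD opprK addrA.
rewrite addrC; apply: le_trans (nrmD (L2wB v2 (L _)) (L d)) _.
exact: lerD.
Qed.

End sturm_liouville.

Section jackson.
Variable R : realType.
Variables (T : R).
Hypothesis T_gt0 : 0 < T.

(* Approximating [D 1] by [q] and integrating reduces the order of the remaining
   derivative, at the price of one degree. *)
Lemma jackson k : exists2 C : R, 0 <= C & forall (g b : R) (D : nat -> R -> R) (M : R) n,
  0 <= g -> 0 <= b ->
  (forall j, (j <= k)%N -> L2w T (g + j%:R) (b + j%:R) (D j)) ->
  (forall j, (j < k)%N -> weak_derivative T (D j) (D j.+1)) ->
  (forall j, (j <= k)%N -> nrm T (g + j%:R) (b + j%:R) (D j) <= M) ->
  (0 < n)%N ->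
  exists2 p : {poly R}, (size p <= n)%N &
    nrm T g b (fun x => D 0%N x - p.[x]) <= C * M / n%:R ^+ k.
Proof.
elim: k => [|k [C C0 IH]].
  exists 1 => // g b D M n g0 b0 _ _ HM _; exists 0; first by rewrite size_poly0.
  rewrite expr0 divr1 mul1r; have := HM 0%N isT; rewrite !addr0 => H0.
  suff -> : nrm T g b (fun x => D 0%N x - 0.[x]) = nrm T g b (D 0%N) by [].
  by apply: nrm_eq => x _; rewrite horner0 subr0.
(* [1] serves the case [n = 1], where the approximation is [0]; [2^k] pays for [n <= 2 (n - 1)], as
   the induction hypothesis is used at [n - 1]. *)
exists (1 + 2 ^+ k * C); first by rewrite addr_ge0 // mulr_ge0 // exprn_ge0.
move=> g b D M n g0 b0 DL DW HM n0.
have M0 : 0 <= M by apply: le_trans (HM 0%N _) => //; exact: nrm_ge0.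
have D0 : L2w T g b (D 0%N) by have := DL 0%N isT; rewrite !addr0.
have D1 : L2w T (g + 1) (b + 1) (D 1%N) by exact: (DL 1%N isT).
have [n1|n1] := leqP n 1.
  have -> : n = 1%N by apply/eqP; rewrite eqn_leq n1.
  exists 0; first by rewrite size_poly0.
  rewrite expr1n divr1.
  have -> : nrm T g b (fun x => D 0%N x - 0.[x]) = nrm T g b (D 0%N).
    by apply: nrm_eq => x _; rewrite horner0 subr0.
  have := HM 0%N isT; rewrite !addr0 => /le_trans; apply.
  by rewrite ler_peMl // lerDl mulr_ge0 // exprn_ge0.
have [q qn qe] : exists2 q : {poly R}, (size q <= n.-1)%N &
    nrm T (g + 1) (b + 1) (fun x => D 1%N x - q.[x]) <= C * M / n.-1%:R ^+ k.
  apply: (IH (g + 1) (b + 1) (fun j => D j.+1) M n.-1).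
  - by rewrite addr_ge0.
  - by rewrite addr_ge0.
  - by move=> j jk; rewrite -!addrA nat1r; exact: DL.
  - by move=> j jk; exact: DW.
  - by move=> j jk; rewrite -!addrA nat1r; exact: HM.
  - by rewrite -subn1 subn_gt0.
have g1 : 0 <= g + 1 by rewrite addr_ge0.
have b1 : 0 <= b + 1 by rewrite addr_ge0.
have L p : L2w T g b (horner p) by exact: L2w_poly.
have L' p : L2w T (g + 1) (b + 1) (horner p) by exact: L2w_poly.
have ibp : jacobi_ibp T g b (fun x => D 0%N x - (antideriv q).[x]) (fun x => D 1%N x - q.[x]).
  move=> r; rewrite (ipBl D1 (L' q) (L' r)) (ipBl D0 (L _) (L _)).
  rewrite (weak_ibp T_gt0 g0 b0 r (DW 0%N isT) D0 D1) -{1}(antiderivK q).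
  by rewrite (jacobi_ibp_poly T_gt0 g0 b0) opprB opprK addrC.
have [P oP] := orth_family_exists T_gt0 g0 b0.
have [p pn pe] := jackson_step T_gt0 g0 b0 oP (L2wB D0 (L _)) (L2wB D1 (L' _)) ibp n0.
exists (antideriv q + p).
  rewrite (leq_trans (size_polyD _ _)) // geq_max pn andbT.
  rewrite (leq_trans (size_antideriv _)) // (leq_ltn_trans qn) // prednK //.
have -> : nrm T g b (fun x => D 0%N x - (antideriv q + p).[x]) =
    nrm T g b (fun x => D 0%N x - (antideriv q).[x] - p.[x]).
  by apply: nrm_eq => x _; rewrite hornerD opprD addrA.
apply: le_trans pe _.
have nR0 : 0 < n%:R :> R by rewrite ltr0n.
have n1R0 : 0 < n.-1%:R :> R by rewrite ltr0n -subn1 subn_gt0.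
have n2 : n%:R <= 2 * n.-1%:R :> R.
  by rewrite -natrM ler_nat mul2n -addnn -{1}(prednK n0) -add1n leq_add2r -subn1 subn_gt0.
rewrite exprSr invfM mulrA ler_pM2r ?invr_gt0 //; apply: le_trans qe _.
rewrite ler_pdivrMr ?exprn_gt0 // mulrAC ler_pdivlMr ?exprn_gt0 //.
apply: (@le_trans _ _ (C * M * (2 * n.-1%:R) ^+ k)).
  by rewrite ler_wpM2l ?mulr_ge0 // lerXn2r ?nnegrE // mulr_ge0.
rewrite exprMn mulrA ler_wpM2r ?exprn_ge0 ?(ltW n1R0) // (mulrC (C * M)) mulrA ler_wpM2r //.
by rewrite lerDr.
Qed.

End jackson.

(** * The K-functional *)

Section nonnegative_integrals.
Variable R : realType.
Local Notation mu := (@lebesgue_measure R).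
Local Open Scope ereal_scope.

(* The integral of a nonnegative function is a supremum over the simple functions below it,
   so that its monotonicity requires no measurability. *)
Lemma ge0_le_integral_sub (A B : set R) (f g : R -> \bar R) : A `<=` B ->
  (forall x, A x -> 0 <= f x) -> (forall x, B x -> 0 <= g x) ->
  (forall x, A x -> f x <= g x) ->
  \int[mu]_(x in A) f x <= \int[mu]_(x in B) g x.
Proof.
move=> AB f0 g0 fg; rewrite !ge0_integralE //.
apply: ereal_sup_le => _ [h /= hf <-]; exists h => // x; apply: le_trans (hf x) _.
rewrite !patchE; case: ifPn => [|_].
  by rewrite inE => Ax; rewrite mem_set ?fg //; exact: AB.
by case: ifPn => // ; rewrite inE; exact: g0.
Qed.

Lemma le_sqrte (x y : \bar R) : x <= y -> sqrte x <= sqrte y.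
Proof.
move=> xy; case: (leP 0 y) => y0; first by rewrite lee_sqrt.
move: x y xy y0 => [x| |] [y| |] //=.
rewrite !lee_fin lte_fin => xy y0; rewrite !ler0_sqrtr ?lexx ?(ltW y0) //.
exact: le_trans xy (ltW y0).
Qed.

Lemma lee_sqr (x y : \bar R) : 0 <= x -> x <= y -> x ^+ 2 <= y ^+ 2.
Proof. by move=> x0 xy; rewrite !expe2 lee_pmul. Qed.

End nonnegative_integrals.

Section natural_order_norms.
Variable R : realType.
Local Notation mu := (@lebesgue_measure R).
Variables (T : R).
Hypothesis T_gt0 : 0 < T.
Local Notation D := (dom T).
Implicit Types (g b M : R) (v w : R -> R) (p : {poly R}).

Lemma wnorm_ge0 g b v : (0 <= wnorm T g b v)%E.
Proof. exact: sqrte_ge0. Qed.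

Lemma wnorm_lty g b v : measurable_fun D v -> (wnorm T g b v < +oo)%E -> L2w T g b v.
Proof. by move=> mv h; apply/wL2P; split. Qed.

Lemma Hnat_norm_ge0 g b k v : (0 <= Hnat_norm T g b k v)%E.
Proof. by apply: le_ereal_inf_tmp => _ [F _ <-]; exact: sqrte_ge0. Qed.

Lemma wnorm_le_sum g b k (F : nat -> R -> R) j : (j <= k)%N ->
  (wnorm T (g + j%:R) (b + j%:R) (F j) <=
   sqrte (\sum_(i < k.+1) wnorm T (g + i%:R)%R (b + i%:R)%R (F i) ^+ 2))%E.
Proof.
move=> jk; have -> : wnorm T (g + j%:R) (b + j%:R) (F j) =
   sqrte (wnorm T (g + j%:R) (b + j%:R) (F j) ^+ 2)%E.
  by rewrite sqrte_sqr gee0_abs // wnorm_ge0.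
apply: le_sqrte; rewrite -ltnS in jk; rewrite (bigD1 (Ordinal jk)) //= leeDl //.
by apply: sume_ge0 => i _; rewrite sqre_ge0.
Qed.

(** The strict bound is what allows a family of weak derivatives to be extracted from the
    infimum. *)
Lemma Hnat_family g b k v M : (Hnat_norm T g b k v < M%:E)%E ->
  exists F : nat -> R -> R, [/\ F 0%N = v,
    forall j, (j < k)%N -> weak_derivative T (F j) (F j.+1),
    forall j, (j <= k)%N -> L2w T (g + j%:R) (b + j%:R) (F j) &
    forall j, (j <= k)%N -> nrm T (g + j%:R) (b + j%:R) (F j) <= M].
Proof.
move=> /ereal_inf_lt[_ [F [F0 Fd Fm] <-]] lt; exists F.
have FL j : (j <= k)%N -> L2w T (g + j%:R) (b + j%:R) (F j).
  move=> jk; apply: wnorm_lty; first exact: Fm.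
  by apply: le_lt_trans (wnorm_le_sum g b F jk) _; apply: lt_le_trans lt _; exact: leey.
split => // j jk; rewrite -lee_fin -(wnormE (FL _ jk)).
by apply: le_trans (wnorm_le_sum g b F jk) _; exact: ltW.
Qed.

Lemma wnorm_le_Hnat g b k v : (wnorm T g b v <= Hnat_norm T g b k v)%E.
Proof.
apply: le_ereal_inf_tmp => _ [F [F0 _ _] <-].
by have := wnorm_le_sum g b F (leq0n k); rewrite !addr0 F0.
Qed.

Lemma Hnat_measurable g b k v : (Hnat_norm T g b k v < +oo)%E -> measurable_fun D v.
Proof.
by move=> /ereal_inf_lt[_ [F [F0 _ Fm] _] _]; rewrite -F0; exact: Fm.
Qed.

Lemma Hnat_norm0_le g b v : L2w T g b v -> (Hnat_norm T g b 0 v <= (nrm T g b v)%:E)%E.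
Proof.
move=> v2; apply: ge_ereal_inf; exists (sqrte (wnorm T (g + 0) (b + 0) v ^+ 2)).
  exists (fun=> v); last by rewrite big_ord_recl big_ord0 adde0.
  by split=> // j _; exact: L2w_measurable v2.
by rewrite !addr0 sqrte_sqr gee0_abs ?wnorm_ge0 // (wnormE v2).
Qed.

Lemma Hnat_norm1_poly g b p : 0 <= g -> 0 <= b ->
  (Hnat_norm T g b 1 (horner p) <=
   (Num.sqrt (winner T g b (horner p) (horner p) +
     winner T (g + 1) (b + 1) (horner p^`()) (horner p^`())))%:E)%E.
Proof.
move=> g0 b0.
have g1 : 0 <= g + 1 by rewrite addr_ge0.
have b1 : 0 <= b + 1 by rewrite addr_ge0.
apply: ge_ereal_inf; exists (sqrte (wnorm T (g + 0) (b + 0) (horner p) ^+ 2 +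
   wnorm T (g + 1) (b + 1) (horner p^`()) ^+ 2)%E).
  exists (fun j => horner (p^`(j))); last by rewrite 2!big_ord_recl big_ord0 adde0.
  split=> // [[|//] _|j _]; first by rewrite derivn0 derivn1; exact: weak_derivative_poly.
  by apply: measurable_funTS; apply: continuous_measurable_fun; exact: continuous_poly.
rewrite !addr0 (wnormE (L2w_poly T_gt0 p g0 b0)) (wnormE (L2w_poly T_gt0 p^`() g1 b1)).
by rewrite -!EFin_expe -EFinD /= !nrm_sq.
Qed.

End natural_order_norms.

Section K_functional.
Variable R : realType.
Local Notation mu := (@lebesgue_measure R).
Variables (T : R).
Hypothesis T_gt0 : 0 < T.
Local Notation D := (dom T).
Implicit Types (g b M s theta tau kappa t : R) (v w : R -> R) (p : {poly R}) (k : nat).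

Lemma Kfun_ge0 g b k t v : 0 <= t -> (0 <= Kfun T g b k t v)%E.
Proof.
move=> t0; apply: le_ereal_inf_tmp => _ [v1 _ <-].
by rewrite adde_ge0 ?mule_ge0 ?Hnat_norm_ge0.
Qed.

Lemma Kfun_le g b k t v v1 :
  (Kfun T g b k t v <= Hnat_norm T g b k (v \- v1)%R + t%:E * Hnat_norm T g b k.+1 v1)%E.
Proof. by apply: ereal_inf_lbound; exists v1. Qed.

Lemma Kfun_homo g b k t t' v : t <= t' -> (Kfun T g b k t v <= Kfun T g b k t' v)%E.
Proof.
move=> tt'; apply: le_ereal_inf_tmp => _ [v1 _ <-]; apply: le_trans (Kfun_le _ _ _ _ _ v1) _.
by apply: leeD2l; apply: lee_wpmul2r; rewrite ?lee_fin ?Hnat_norm_ge0.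
Qed.

(** The triangle inequality for an arbitrary splitting. Parts of infinite norm are set apart,
    because measurability is derived from finiteness of the norm. *)
Lemma wnorm_le_Kfun g b k t v : 1 <= t -> (wnorm T g b v <= Kfun T g b k t v)%E.
Proof.
move=> t1; apply: le_ereal_inf_tmp => _ [v1 _ <-].
set A := Hnat_norm T g b k _; set B := Hnat_norm T g b k.+1 v1.
have A0 : (0 <= A)%E by exact: Hnat_norm_ge0.
have B0 : (0 <= B)%E by exact: Hnat_norm_ge0.
have tB : (B <= t%:E * B)%E.
  by rewrite -[leLHS]mul1e; apply: lee_wpmul2r; rewrite ?lee_fin.
have [Ay|] := ltP A +oo%E; last first.
  by rewrite leye_eq => /eqP ->; rewrite addye ?leey // -ltNye (lt_le_trans _ (le_trans B0 tB)).
have [By|] := ltP B +oo%E; last first.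
  rewrite leye_eq => /eqP Be; move: tB; rewrite Be.
  by rewrite leye_eq => /eqP ->; rewrite addey ?leey // -ltNye (lt_le_trans _ A0).
have L1 := wnorm_lty (Hnat_measurable Ay) (le_lt_trans (wnorm_le_Hnat T g b k _) Ay).
have L2 := wnorm_lty (Hnat_measurable By) (le_lt_trans (wnorm_le_Hnat T g b k.+1 _) By).
have Lv := L2wD L1 L2.
have vE : v = (fun x => (v \- v1) x + v1 x) by apply/funext => x; rewrite /= subrK.
rewrite {1}vE (wnormE Lv); apply: le_trans (leeD (wnorm_le_Hnat T g b k _) (le_trans (wnorm_le_Hnat T g b k.+1 v1) tB)).
rewrite (wnormE L1) (wnormE L2) -EFinD lee_fin; exact: nrmD.
Qed.

(* [K] is nondecreasing, so that its value at [tau] is controlled by the integral over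
   [(tau, 2 tau)]. *)
Lemma Kfun_integral_lb g b k theta v tau kappa : 0 < theta -> 0 < tau -> 0 <= kappa ->
  (kappa%:E <= Kfun T g b k tau v)%E ->
  ((kappa ^+ 2 * ((2 * tau) `^ (- (2 * theta) - 1) * tau))%:E <=
   \int[mu]_(t in `]0%R, +oo[) ((t `^ (- (2 * theta) - 1))%:E * Kfun T g b k t v ^+ 2))%E.
Proof.
move=> th0 tau0 k0 kK.
set c := (2 * tau) `^ _.
have -> : ((kappa ^+ 2 * (c * tau))%:E = \int[mu]_(t in (`]tau%R, (2 * tau)%R[%classic : set R)) (cst (c * kappa ^+ 2)%:E) t)%E.
  rewrite integral_cst; last exact: measurable_oo.
  rewrite [X in _ = (_ * X)%E](_ : _ = tau%:E); last first.
    have h := @lebesgue_measure_itv R `]tau, 2 * tau[.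
    rewrite /= lte_fin ltr_pMl // ltr1n -EFinD in h.
    apply: etrans h _; congr _%:E; ring.
  by rewrite -EFinM; congr _%:E; ring.
apply: ge0_le_integral_sub.
- by move=> t /=; rewrite !in_itv/= andbT => /andP[t1 _]; exact: lt_trans tau0 t1.
- by move=> t _; rewrite lee_fin mulr_ge0 ?powR_ge0 ?sqr_ge0.
- move=> t /=; rewrite in_itv/= andbT => t0; apply: mule_ge0; first by rewrite lee_fin powR_ge0.
  by rewrite sqre_ge0.
move=> t /=; rewrite in_itv/= => /andP[t1 t2]; rewrite EFinM; apply: lee_pmul.
- by rewrite lee_fin powR_ge0.
- by rewrite lee_fin sqr_ge0.
- have t0 := lt_trans tau0 t1.
  have e0 : - (2 * theta) - 1 = - (2 * theta + 1) by ring.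
  rewrite lee_fin /c e0 !powRN lef_pV2 ?posrE ?powR_gt0 ?mulr_gt0 //.
  by apply: ge0_ler_powR; rewrite ?nnegrE ?(ltW t2) ?(ltW t0) ?addr_ge0 ?mulr_ge0 ?(ltW th0) ?(ltW tau0).
- rewrite EFin_expe; apply: lee_sqr => //; apply: le_trans kK _; apply: Kfun_homo; exact: ltW.
Qed.

(* Only the part of the integral over [(1, 2)] is used. *)
Lemma wnorm_le_Hs g b s : 0 <= s -> exists2 c, 0 < c &
  forall v M, (Hs_norm T g b s v < M%:E)%E -> (wnorm T g b v <= (c * M)%:E)%E.
Proof.
move=> s0; pose k := Num.truncn s; pose theta := s - k%:R.
exists (Num.max 1 (Num.sqrt (2 `^ (2 * theta + 1)))); first by rewrite lt_max ltr01.
move=> v M; rewrite /Hs_norm -/k -/theta; set c := Num.max _ _.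
have c1 : 1 <= c by rewrite le_max lexx.
case: ifPn => [_ lt|th0 lt].
  apply: le_trans (wnorm_le_Hnat T g b k v) _; apply: le_trans (ltW lt) _.
  rewrite lee_fin ler_peMl // -lee_fin; apply: le_trans (ltW lt).
  exact: Hnat_norm_ge0.
have th : 0 < theta.
  by rewrite lt_neqAle eq_sym th0 subr_ge0; have /andP[] := truncn_itv s0.
have M0 : 0 < M by rewrite -lte_fin; apply: le_lt_trans lt; exact: sqrte_ge0.
set I := (\int[mu]_(t in _) _)%E in lt.
have I0 : (0 <= I)%E.
  apply: integral_ge0 => t /=; rewrite in_itv/= andbT => t0; apply: mule_ge0.
    by rewrite lee_fin powR_ge0.
  by rewrite sqre_ge0.
have IM : (I <= (M ^+ 2)%:E)%E.
  rewrite -(sqr_sqrte I0) EFin_expe; apply: lee_sqr; [exact: sqrte_ge0|exact: ltW].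
(* Stated for every real [kappa] below the norm, so that the same estimate also excludes the value
   [+oo]. *)
have key kappa : 0 <= kappa -> (kappa%:E <= wnorm T g b v)%E -> kappa <= c * M.
  move=> k0 kw.
  have := Kfun_integral_lb th ltr01 k0 (le_trans kw (wnorm_le_Kfun g b k v (lexx 1))).
  move=> /le_trans/(_ IM); rewrite lee_fin !mulr1.
  have -> : - (2 * theta) - 1 = - (2 * theta + 1) by ring.
  rewrite powRN => h.
  have p0 : 0 < 2 `^ (2 * theta + 1) :> R by rewrite powR_gt0.
  rewrite ler_pdivrMr // in h.
  have h' : kappa ^+ 2 <= (Num.sqrt (2 `^ (2 * theta + 1)) * M) ^+ 2.
    by rewrite exprMn sqr_sqrtr ?(ltW p0) // mulrC.
  apply: (@le_trans _ _ (Num.sqrt (2 `^ (2 * theta + 1)) * M)).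
    rewrite -(@ler_pXn2r R 2 isT) ?nnegrE //.
    by apply: mulr_ge0; [exact: sqrtr_ge0|exact: ltW].
  by apply: ler_wpM2r; [exact: ltW|rewrite le_max lexx orbT].
have w0 := wnorm_ge0 T g b v.
case: (wnorm T g b v) w0 key => [w w0 key|_ key|//].
  by rewrite lee_fin; apply: key => //; rewrite -lee_fin.
have h0 : 0 <= c * M + 1 by rewrite addr_ge0 // mulr_ge0 ?(ltW M0) // (le_trans _ c1).
by have := key _ h0 (leey _); rewrite gerDl ler10.
Qed.

(** The lower bound of the integral by its part over [(tau, 2 tau)] is solved for [K]. The [+ 1] in
    the constant makes the inequality strict, so that a splitting can be extracted from the
    infimum. *)
Lemma Kfun_decay g b k theta v M : 0 < theta ->
  (sqrte (\int[mu]_(t in `]0%R, +oo[)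
     ((t `^ (- (2 * theta) - 1))%:E * Kfun T g b k t v ^+ 2)) <= M%:E)%E ->
  exists2 c, 0 < c & forall tau, 0 < tau -> (Kfun T g b k tau v < (c * tau `^ theta)%:E)%E.
Proof.
move=> th0; set I := (\int[mu]_(t in _) _)%E => IM.
have I0 : (0 <= I)%E.
  apply: integral_ge0 => t /=; rewrite in_itv/= andbT => t0; apply: mule_ge0.
    by rewrite lee_fin powR_ge0.
  by rewrite sqre_ge0.
have M0 : 0 <= M by rewrite -lee_fin; apply: le_trans IM; exact: sqrte_ge0.
have {}IM : (I <= (M ^+ 2)%:E)%E.
  rewrite -(sqr_sqrte I0) EFin_expe; apply: lee_sqr => //; exact: sqrte_ge0.
pose q : R := Num.sqrt (2 `^ (2 * theta + 1)).
have p0 : 0 < 2 `^ (2 * theta + 1) :> R by rewrite powR_gt0.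
have q0 : 0 < q by rewrite sqrtr_gt0.
have qM : 0 < q * M + 1 by rewrite ltr_wpDl // mulr_ge0 // ltW.
exists (q * M + 1) => // tau tau0.
have tt0 : 0 < tau `^ theta by rewrite powR_gt0.
have key kappa : 0 <= kappa -> (kappa%:E <= Kfun T g b k tau v)%E -> kappa < (q * M + 1) * tau `^ theta.
  move=> k0 /(Kfun_integral_lb th0 tau0 k0)/le_trans/(_ IM); rewrite lee_fin.
  have -> : - (2 * theta) - 1 = - (2 * theta + 1) by ring.
  rewrite powRM ?(ltW tau0) // !powRN.
  have -> : tau `^ (2 * theta + 1) = (tau `^ theta) ^+ 2 * tau.
    by rewrite (powRD_gt0 _ _ tau0) (powRr1 (ltW tau0)) mulrC -powR_mulrn ?powR_ge0 // -powRrM mulrC (mulrC theta).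
  move=> h; apply: (@le_lt_trans _ _ (q * M * tau `^ theta)); last by rewrite ltr_pM2r // ltrDl.
  have n0 : 0 <= q * M * tau `^ theta by rewrite !mulr_ge0 ?powR_ge0 // ltW.
  rewrite -(@ler_pXn2r R 2 isT) ?nnegrE // !exprMn (sqr_sqrtr (ltW p0)).
  move: h; move: (2 `^ _) (tau `^ theta) (kappa ^+ 2) p0 tt0 => p x y p0 x0 h.
  have -> : y = y * (p^-1 * (x ^+ 2 * tau)^-1 * tau) * (p * x ^+ 2).
    by field; rewrite !lt0r_neq0.
  have -> : p * M ^+ 2 * x ^+ 2 = M ^+ 2 * (p * x ^+ 2) by ring.
  by apply: ler_wpM2r h; rewrite mulr_ge0 ?sqr_ge0 // ltW.
have K0 := Kfun_ge0 g b k v (ltW tau0).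
case: (Kfun _ _ _ _ _ _) K0 key => [w w0 key|_ key|//].
  by rewrite lte_fin; apply: key => //; rewrite -lee_fin.
have h0 : 0 <= (q * M + 1) * tau `^ theta by rewrite mulr_ge0 // ltW.
by have := key _ h0 (leey _); rewrite ltxx.
Qed.

(* A near-optimal splitting [v = (v - v1) + v1] of the K-functional at [1 / n], both parts being
   approximated by Jackson's estimate. *)
Lemma Hs_approximation g b s v : 0 <= g -> 0 <= b -> 0 <= s -> Hs T g b s v ->
  exists2 c, 0 <= c & forall n, (0 < n)%N -> exists2 p : {poly R}, (size p <= n)%N &
    nrm T g b (fun x => v x - p.[x]) <= c * n%:R `^ (- s).
Proof.
move=> g0 b0 s0; rewrite /Hs /Hs_norm /=; set k := Num.truncn s; set theta := s - k%:R.
have [C1 C10 J1] := jackson T_gt0 k.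
have [C2 C20 J2] := jackson T_gt0 k.+1.
have sE : s = k%:R + theta by rewrite addrC subrK.
have nk (n : nat) : (0 < n)%N -> n%:R `^ (- s) = (n%:R ^+ k)^-1 * (n%:R `^ theta)^-1 :> R.
  move=> n0; have nR : 0 < n%:R :> R by rewrite ltr0n.
  by rewrite sE opprD (powRD_gt0 _ _ nR) !powRN powR_mulrn.
case: ifPn => [/eqP th0 lty|th0 lty].
  have [M Mv] : exists M, (Hnat_norm T g b k v < M%:E)%E.
    have := Hnat_norm_ge0 T g b k v.
    case: (Hnat_norm T g b k v) lty => // r _ _; exists (r + 1).
    by rewrite lte_fin ltrDl.
  have [F [F0 Fd FL FM]] := Hnat_family Mv.
  have M0 : 0 <= M by apply: le_trans (FM 0%N _) => //; exact: nrm_ge0.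
  exists (C1 * M); first exact: mulr_ge0.
  move=> n n0; have [p pn pe] := J1 g b F M n g0 b0 FL Fd FM n0.
  exists p => //; rewrite nk // th0 powRr0 invr1 mulr1.
  by move: pe; rewrite F0.
have th : 0 < theta.
  by rewrite lt_neqAle eq_sym th0 subr_ge0; have /andP[] := truncn_itv s0.
set I := (sqrte _) in lty.
have [M IM] : exists M, (I <= M%:E)%E.
  have : (0 <= I)%E by exact: sqrte_ge0.
  by case: I lty => // r _ _; exists r.
have [c c0 cK] := Kfun_decay th IM.
exists ((C1 + C2) * c); first by rewrite mulr_ge0 ?addr_ge0 // ltW.
move=> n n0; have nR : 0 < n%:R :> R by rewrite ltr0n.
have nV : 0 < n%:R^-1 :> R by rewrite invr_gt0.
have /ereal_inf_lt[_ [v1 _ <-]] := cK _ nV.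
have -> : n%:R^-1 `^ theta = (n%:R `^ theta)^-1 :> R.
  by rewrite -powR_inv1 ?(ltW nR) // -powRrM mulN1r powRN.
set e := c * _ => lt.
have e0 : 0 <= e by rewrite mulr_ge0 ?invr_ge0 ?powR_ge0 // ltW.
have A0 := Hnat_norm_ge0 T g b k (v \- v1)%R.
have B0 := Hnat_norm_ge0 T g b k.+1 v1.
have nB0 : (0 <= n%:R^-1%:E * Hnat_norm T g b k.+1 v1)%E by rewrite mule_ge0 // lee_fin ltW.
(* At [1 / n] the rough part has size [e] in order [k] and the smooth part has size [n e] in order
   [k + 1]; the additional order in Jackson's estimate compensates the factor [n]. *)
have Ae : (Hnat_norm T g b k (v \- v1)%R < e%:E)%E.
  by apply: le_lt_trans lt; rewrite leeDl.
have Be : (Hnat_norm T g b k.+1 v1 < (n%:R * e)%:E)%E.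
  rewrite EFinM -lte_pdivrMl //; apply: le_lt_trans lt; rewrite leeDr //.
have [F [F0 Fd FL FM]] := Hnat_family Ae.
have [G [G0 Gd GL GM]] := Hnat_family Be.
have [p pn pe] := J1 g b F e n g0 b0 FL Fd FM n0.
have [q qn qe] := J2 g b G (n%:R * e) n g0 b0 GL Gd GM n0.
have L r : L2w T g b (horner r) by exact: L2w_poly.
have L1 : L2w T g b (v \- v1)%R by have := FL 0%N (leq0n _); rewrite !addr0 F0.
have L2 : L2w T g b v1 by have := GL 0%N (leq0n _); rewrite !addr0 G0.
exists (p + q); first by rewrite (leq_trans (size_polyD _ _)) // geq_max pn.
have -> : nrm T g b (fun x => v x - (p + q).[x]) =
    nrm T g b (fun x => ((v \- v1)%R x - p.[x]) + (v1 x - q.[x])).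
  by apply: nrm_eq => x _; rewrite hornerD /=; ring.
apply: le_trans (nrmD (L2wB L1 (L p)) (L2wB L2 (L q))) _.
rewrite F0 in pe; rewrite G0 in qe; apply: le_trans (lerD pe qe) _.
rewrite nk // /e exprS le_eqVlt; apply/orP; left; apply/eqP.
have h1 : n%:R != 0 :> R := lt0r_neq0 nR.
have h2 : n%:R ^+ k != 0 :> R by rewrite expf_neq0.
have h3 : n%:R `^ theta != 0 :> R by rewrite lt0r_neq0 // powR_gt0.
set z : R := n%:R in h1 h2 h3 *; set y := z `^ theta in h3 *; set x := z ^+ k in h2 *.
by field; rewrite h1 h2 h3.
Qed.

End K_functional.

(** * Upper bound of the fractional norm of a polynomial *)

Section fractional_norm_of_polynomials.
Variable R : realType.
Local Notation mu := (@lebesgue_measure R).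

(** The contribution of a mode of frequency [a] to the integral defining the norm of order [s]; for
    [0 < s < 1] its integral over [t] is at most a multiple of [a^(2 s)]. *)
Let wt (s a t : R) := t `^ (- (2 * s) - 1) * Num.min 1 ((a * t) ^+ 2).

Let measurable_wt s a : measurable_fun (`]0, +oo[%classic : set R) (wt s a).
Proof.
apply: measurable_funTS; apply: measurable_funM; first exact: measurable_powR.
apply: measurable_minr; first exact: measurable_cst.
apply: continuous_measurable_fun => t; apply: (@cvgM _ _ _ _ (fun t => a * t) (fun t => a * t)).
  by apply: cvgM; [exact: cvg_cst|exact: cvg_id].
by apply: cvgM; [exact: cvg_cst|exact: cvg_id].
Qed.

Let wt_ge0 s a t : 0 <= wt s a t.
Proof. by rewrite mulr_ge0 ?powR_ge0 // le_min ler01 sqr_ge0. Qed.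

Lemma integral_powR_infty (x c : R) : 0 < x -> 0 < c ->
  (\int[mu]_(t in `[c, +oo[) (t `^ (- x - 1))%:E = (c `^ (- x) / x)%:E)%E.
Proof.
move=> x0 c0; have h := lt0r_neq0 x0.
pose F (t : R) := - (x^-1 * t `^ (- x)).
have dF (t : R) : 0 < t -> is_derive t 1 F (t `^ (- x - 1)).
  move=> t0; have d1 := is_derive1_powR (- x) t0.
  apply: (is_derive_ext (is_deriveN (is_deriveZ x^-1 d1))) => //.
  by rewrite -[LHS]/(- (x^-1 * (- x * t `^ (- x - 1)))) mulNr mulrN opprK mulKf.
have cp (y t : R) : 0 < t -> {for t, continuous (fun t : R => t `^ y)}.
  by move=> t0; exact: is_derive_continuous (is_derive1_powR y t0).
rewrite (@ge0_continuous_FTC2y R (fun t => t `^ (- x - 1)) F c 0).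
- by rewrite sub0e -EFinN /F opprK mulrC.
- by move=> t _; exact: powR_ge0.
- apply/continuous_within_itvcyP; split.
    by move=> t; rewrite in_itv/= andbT => ct; apply: cp; exact: lt_trans ct.
  by apply: cvg_at_right_filter; exact: cp.
- rewrite -oppr0 -[X in _ --> - X](mulr0 x^-1); apply: cvgN; apply: cvgM; first exact: cvg_cst.
  apply/cvgrPdist_lt => e e0; near=> t.
  have t0 : 0 < t by near: t; exact: nbhs_pinfty_gt.
  rewrite sub0r normrN ger0_norm ?powR_ge0 // powRN -[ltRHS]invrK ltf_pV2 ?posrE ?powR_gt0 ?invr_gt0 //.
  have -> : e^-1 = (e^-1 `^ x^-1) `^ x by rewrite -powRrM mulVf // powRr1 // invr_ge0 ltW.
  have te : e^-1 `^ x^-1 < t by near: t; exact: nbhs_pinfty_gt.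
  by apply: (gt0_ltr_powR x0 _ _ te); rewrite nnegrE ?powR_ge0 // ltW.
- by move=> t ct; case: (dF t (lt_trans c0 ct)).
- apply: cvg_at_right_filter; apply: cvgN; apply: cvgM; [exact: cvg_cst|exact: cp].
- move=> t; rewrite in_itv/= andbT => ct; rewrite derive1E.
  by case: (dF t (lt_trans c0 ct)).
Unshelve. all: by end_near. Qed.

Let integral_wt s a : 0 < s -> s < 1 -> 0 < a ->
  (\int[mu]_(t in `]0%R, +oo[) (wt s a t)%:E <=
   (a `^ (2 * s) * ((2 - 2 * s)^-1 + (2 * s)^-1))%:E)%E.
Proof.
(* The two terms of the minimum are equal at [t = 1 / a]. *)
move=> s0 s1 a0; pose c := a^-1.
have c0 : 0 < c by rewrite invr_gt0.
have x0 : 0 < 2 - 2 * s by lra.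
have x1 : 0 < 2 * s by lra.
have E : (`]0%R, +oo[%classic : set R) = (`]0%R, c[%classic : set R) `|` (`[c, +oo[%classic : set R).
  apply/seteqP; split => t /=; rewrite !in_itv/= !andbT.
    by move=> t0; case: (ltP t c) => tc; [left; rewrite t0|right].
  by move=> [/andP[]//|]; exact: lt_le_trans.
have cy y : c `^ y = a `^ (- y) by rewrite /c -powR_inv1 ?(ltW a0) // -powRrM mulN1r.
have I1 : (\int[mu]_(t in (`]0%R, c[%classic : set R)) (wt s a t)%:E <=
    (a `^ (2 * s) * (2 - 2 * s)^-1)%:E)%E.
  have ib : intg (`]0, c[%classic : set R) (fun t => a ^+ 2 * bker 0 c (2 - 2 * s) 1 t).
    by apply: (intgZ (measurable_oo 0 c)); exact: integrable_bker.
  apply: (@le_trans _ _ (\int[mu]_(t in (`]0%R, c[%classic : set R)) (a ^+ 2 * bker 0 c (2 - 2 * s) 1 t)%:E)%E).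
    apply: ge0_le_integral_sub => //.
    - by move=> t _; rewrite lee_fin wt_ge0.
    - by move=> t _; rewrite lee_fin mulr_ge0 ?sqr_ge0 // mulr_ge0 ?powR_ge0.
    move=> t /=; rewrite in_itv/= => /andP[t0 tc]; rewrite lee_fin /wt /bker subr0 subrr powRr0 mulr1.
    have -> : 2 - 2 * s - 1 = 2 + (- (2 * s) - 1) by ring.
    rewrite (powRD_gt0 2 _ t0) (powR_mulrn 2 (ltW t0)) mulrA -exprMn [leRHS]mulrC.
    by apply: ler_wpM2l; [exact: powR_ge0|rewrite ge_min lexx orbT].
  rewrite (Rint_EFin (measurable_oo 0 c) ib) (RintZ (measurable_oo 0 c) _ (integrable_bker _ _ _)) //.
  rewrite lee_fin -/(bfun 0 c (2 - 2 * s) 1) (bfun_x1 c0 x0) cy mulrA.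
  rewrite -(powR_mulrn 2 (ltW a0)) -(powRD_gt0 _ _ a0).
  by rewrite (_ : 2%:R + - (2 - 2 * s) = 2 * s) //; ring.
have I2 : (\int[mu]_(t in (`[c, +oo[%classic : set R)) (wt s a t)%:E <=
    (a `^ (2 * s) * (2 * s)^-1)%:E)%E.
  have -> : a `^ (2 * s) = c `^ (- (2 * s)) by rewrite cy opprK.
  rewrite -(integral_powR_infty x1 c0).
  apply: ge0_le_integral_sub => //.
  - by move=> t _; rewrite lee_fin wt_ge0.
  - by move=> t _; rewrite lee_fin powR_ge0.
  move=> t _; rewrite lee_fin /wt -[leRHS]mulr1.
  by apply: ler_wpM2l; [exact: powR_ge0|rewrite ge_min lexx].
rewrite E (ge0_integral_setU mu (measurable_oo 0 c) (measurable_itv _)).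
- by rewrite mulrDr EFinD; exact: leeD.
- rewrite -E; apply/measurable_EFinP; exact: measurable_wt.
- by move=> t _; rewrite lee_fin wt_ge0.
apply/disj_setPS => t [] /=; rewrite !in_itv/= andbT => /andP[_ h1] h2.
by move: (lt_le_trans h1 h2); rewrite ltxx.
Qed.

Variables (T g b : R).
Hypothesis T_gt0 : 0 < T.
Hypothesis g_ge0 : 0 <= g.
Hypothesis b_ge0 : 0 <= b.
Variable P : nat -> {poly R}.
Hypothesis oP : orth_family T g b P.
Local Notation h := (hsq T g b P).
Local Notation cf := (coefs T g b P).
Implicit Types (v : {poly R}) (s t : R).

Let h_ge0 k : 0 <= h k. Proof. exact: ltW (hsq_gt0 T_gt0 g_ge0 b_ge0 oP k). Qed.

Let ip_deriv n (d : nat -> R) (p : {poly R}) : p = \sum_(k < n) d k *: P k ->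
  winner T (g + 1) (b + 1) (horner p^`()) (horner p^`()) =
  \sum_(k < n) sl_eigen g b k * d k ^+ 2 * h k.
Proof.
move=> pE; rewrite (jacobi_ibp_poly T_gt0 g_ge0 b_ge0).
have -> : adj T g b p^`() = \sum_(k < n) (- sl_eigen g b k * d k) *: P k.
  rewrite pE raddf_sum /= {pE}; elim: n => [|m IH].
    by rewrite !big_ord0 adj0.
  rewrite !big_ord_recr /= addrC derivZ adj_linear IH.
  by rewrite (adj_deriv_orth T_gt0 g_ge0 b_ge0 oP) scalerA (mulrC (d m)) addrC.
rewrite pE (ip_orth_sum T_gt0 g_ge0 b_ge0 oP n d (fun k => - sl_eigen g b k * d k)) -sumrN.
by apply: eq_bigr => k _; ring.
Qed.

Lemma sl_eigen_le k : 1 + sl_eigen g b k <= (1 + g + b) * (k%:R + 1) ^+ 2.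
Proof.
rewrite /sl_eigen; have : 0 <= k%:R :> R by [].
move: (k%:R : R) => x x0; have := g_ge0; have := b_ge0; nra.
Qed.

(* The low modes, with [(k + 1) t <= 1], go to the smooth part. *)
Lemma Kfun_poly v n t : (size v <= n)%N -> 0 < t ->
  (Kfun T g b 0 t (horner v) ^+ 2 <=
   (\sum_(k < n) 2 * (1 + g + b) * (cf (horner v) k ^+ 2 * h k) *
      Num.min 1 (((k%:R + 1) * t) ^+ 2))%:E)%E.
Proof.
move=> vn t0.
pose d k := if (k%:R + 1) * t <= 1 then cf (horner v) k else 0.
pose e k := if (k%:R + 1) * t <= 1 then 0 else cf (horner v) k.
pose p := \sum_(k < n) d k *: P k.
have L q : L2w T g b (horner q) by exact: L2w_poly.
have vE : v - p = \sum_(k < n) e k *: P k.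
  rewrite {1}(orth_expansion T_gt0 g_ge0 b_ge0 oP vn) -sumrB; apply: eq_bigr => k _.
  by rewrite -scalerBl /d /e; case: ifP => _; rewrite ?subrr // subr0.
have pE : p = \sum_(k < n) d k *: P k by [].
pose A := winner T g b (horner (v - p)) (horner (v - p)).
pose B := winner T g b (horner p) (horner p) +
   winner T (g + 1) (b + 1) (horner p^`()) (horner p^`()).
have AE : A = \sum_(k < n) e k ^+ 2 * h k.
  rewrite /A vE (ip_orth_sum T_gt0 g_ge0 b_ge0 oP n e e).
  by apply: eq_bigr => k _; rewrite expr2.
have BE : B = \sum_(k < n) (1 + sl_eigen g b k) * d k ^+ 2 * h k.
  rewrite /B (ip_deriv pE) pE (ip_orth_sum T_gt0 g_ge0 b_ge0 oP n d d) -big_split.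
  by apply: eq_bigr => k _ /=; ring.
have A0 : 0 <= A by exact: ip_ge0.
have B0 : 0 <= B := addr_ge0 (ip_ge0 _ _ _ _) (ip_ge0 _ _ _ _).
have K1 : (Kfun T g b 0 t (horner v) <= (Num.sqrt A + t * Num.sqrt B)%:E)%E.
  apply: le_trans (Kfun_le T g b 0 t (horner v) (horner p)) _.
  rewrite EFinD EFinM; apply: leeD.
    have -> : (horner v \- horner p)%R = horner (v - p).
      by apply/funext => x; rewrite /= hornerD hornerN.
    exact: Hnat_norm0_le (L (v - p)).
  by apply: lee_wpmul2l; [rewrite lee_fin ltW|exact: Hnat_norm1_poly].
apply: le_trans (lee_sqr (Kfun_ge0 T g b 0 (horner v) (ltW t0)) K1) _.
rewrite -EFin_expe lee_fin.
apply: (@le_trans _ _ (2 * A + 2 * (t ^+ 2 * B))).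
  have : 0 <= (Num.sqrt A - t * Num.sqrt B) ^+ 2 by exact: sqr_ge0.
  rewrite -{3}(sqr_sqrtr A0) -{3}(sqr_sqrtr B0); nra.
rewrite AE BE !mulr_sumr -big_split; apply: ler_sum => k _ /=.
have := sl_eigen_le k; have := h_ge0 k; rewrite /d /e.
move: (h k) (cf _ k) (sl_eigen g b k) => y x m y0 mle.
have := g_ge0; have := b_ge0 => b0 g0.
have k1 : 0 < k%:R + 1 :> R by rewrite ltr_wpDl.
case: ifP => kt.
  rewrite expr0n /= mul0r mulr0 add0r min_r; last first.
    by rewrite -[leRHS](expr1n _ 2) lerXn2r ?nnegrE // mulr_ge0 // ltW.
  rewrite exprMn.
  have -> : 2 * (t ^+ 2 * ((1 + m) * x ^+ 2 * y)) = (1 + m) * (2 * t ^+ 2 * x ^+ 2 * y) by ring.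
  have -> : 2 * (1 + g + b) * (x ^+ 2 * y) * ((k%:R + 1) ^+ 2 * t ^+ 2) =
    (1 + g + b) * (k%:R + 1) ^+ 2 * (2 * t ^+ 2 * x ^+ 2 * y) by ring.
  apply: ler_wpM2r mle.
  exact: (mulr_ge0 (mulr_ge0 (mulr_ge0 (ler0n _ 2) (sqr_ge0 t)) (sqr_ge0 x)) y0).
rewrite expr0n /= mulr0 mul0r !mulr0 addr0 min_l; last first.
  rewrite -[leLHS](expr1n _ 2) lerXn2r ?nnegrE //; last by rewrite ltW // ltNge kt.
  by rewrite mulr_ge0 // ltW.
have -> : 2 * (1 + g + b) * (x ^+ 2 * y) * 1 = (1 + g + b) * (2 * (x ^+ 2 * y)) by ring.
rewrite -[leLHS]mul1r; apply: ler_wpM2r.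
  exact: (mulr_ge0 (ler0n _ 2) (mulr_ge0 (sqr_ge0 x) y0)).
by rewrite -addrA lerDl addr_ge0.
Qed.

(** [Kfun_poly] bounds the K-functional mode by mode, and each mode integrates to a multiple of
    [(k + 1)^(2 s)]; the two inverses come from the integrals on either side of
    [t = 1 / (k + 1)]. *)
Lemma Hs_norm_poly s v n : 0 < s -> s < 1 -> (size v <= n)%N ->
  (Hs_norm T g b s (horner v) <=
   (Num.sqrt (2 * (1 + g + b) * ((2 - 2 * s)^-1 + (2 * s)^-1) *
     \sum_(k < n) (cf (horner v) k ^+ 2 * h k) * (k%:R + 1) `^ (2 * s)))%:E)%E.
Proof.
move=> s0 s1 vn.
have tr : Num.truncn s = 0%N by apply: truncn_def; rewrite (ltW s0).
rewrite /Hs_norm tr subr0 gt_eqF //.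
set C := 2 * (1 + g + b); pose ck k := C * (cf (horner v) k ^+ 2 * h k).
have C0 : 0 <= C by rewrite mulr_ge0 // -addrA addr_ge0 // addr_ge0.
have ck0 k : 0 <= ck k by rewrite mulr_ge0 // mulr_ge0 ?sqr_ge0.
set X := (X in Num.sqrt X); rewrite -[(Num.sqrt X)%:E]/(sqrte X%:E).
apply: le_sqrte.
apply: (@le_trans _ _ (\int[mu]_(t in (`]0%R, +oo[%classic : set R))
    (\sum_(k < n) (ck k)%:E * (wt s (k%:R + 1) t)%:E))%E).
  apply: ge0_le_integral_sub => //.
  - move=> t /=; rewrite in_itv/= andbT => t0; apply: mule_ge0; last by rewrite sqre_ge0.
    by rewrite lee_fin powR_ge0.
  - by move=> t _; apply: sume_ge0 => k _; rewrite mule_ge0 // lee_fin ?wt_ge0.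
  move=> t /=; rewrite in_itv/= andbT => t0.
  have p0 : (0 <= (t `^ (- (2 * s) - 1))%:E)%E by rewrite lee_fin powR_ge0.
  apply: le_trans (lee_wpmul2l p0 (Kfun_poly vn t0)) _.
  rewrite -EFinM sumEFin lee_fin mulr_sumr le_eqVlt; apply/orP; left; apply/eqP.
  by apply: eq_bigr => k _; rewrite /wt /ck /C; ring.
rewrite ge0_integral_sum //.
- rewrite /X mulr_sumr -sumEFin; apply: lee_sum => k _.
  have k1 : 0 < k%:R + 1 :> R by rewrite ltr_wpDl.
  rewrite ge0_integralZl //; last first.
  - by rewrite lee_fin.
  - by move=> t _; rewrite lee_fin wt_ge0.
  - by apply/measurable_EFinP; exact: measurable_wt.
  apply: le_trans (lee_wpmul2l _ (integral_wt s0 s1 k1)) _; first by rewrite lee_fin.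
  by rewrite -EFinM lee_fin le_eqVlt; apply/orP; left; apply/eqP; rewrite /ck; ring.
- move=> k; apply: measurable_funeM; apply/measurable_EFinP; exact: measurable_wt.
- by move=> k t _; rewrite mule_ge0 // lee_fin ?wt_ge0.
Qed.

End fractional_norm_of_polynomials.

(** * The Petrov-Galerkin method *)

Section petrov_galerkin.
Local Opaque caputo_coef.
Variable R : realType.
Local Notation mu := (@lebesgue_measure R).
Variables (alpha T lambda : R).
Hypothesis alpha_gt0 : 0 < alpha.
Hypothesis alpha_lt1 : alpha < 1.
Hypothesis T_gt0 : 0 < T.
Hypothesis lambda_ge0 : 0 <= lambda.
Local Notation D := (dom T).
Local Notation ip := (winner T 0 alpha).
Local Notation nm := (nrm T 0 alpha).
Local Notation L2 := (L2w T 0 alpha).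
Local Notation S := (caputo_poly T alpha).
Local Notation Sinv := (caputo_poly_inv T alpha).
Local Notation W := (weighted_poly T alpha).
Implicit Types (p q v : {poly R}) (u w : R -> R) (r s M : R) (f : (R -> R) -> R).

Let alpha_ge0 : 0 <= alpha. Proof. exact: ltW. Qed.
Let L p : L2 (horner p). Proof. exact: L2w_poly. Qed.
Let LW p : L2 (W p). Proof. exact: W_L2. Qed.
Let c0_gt0 : 0 < caputo_coef alpha 0. Proof. exact: caputo_coef_gt0. Qed.

Definition poly_linear (F : {poly R} -> R) :=
  forall a p q, F (a *: p + q) = a * F p + F q.

Lemma poly_linear0 F : poly_linear F -> F 0 = 0.
Proof. by move=> lF; have := lF (-1) 0 0; rewrite scaler0 addr0 mulN1r addNr. Qed.

Lemma poly_linearZ F a p : poly_linear F -> F (a *: p) = a * F p.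
Proof. by move=> lF; rewrite -[a *: p]addr0 lF poly_linear0 // addr0. Qed.

Lemma poly_linear_monomials F n p : poly_linear F -> (size p <= n)%N ->
  F p = \sum_(i < n) p`_i * F 'X^i.
Proof.
move=> lF pn; rewrite {1}(poly_monomials pn).
have H m (c : nat -> R) : F (\sum_(k < m) c k *: 'X^k) = \sum_(k < m) c k * F 'X^k.
  elim: m => [|m IH]; first by rewrite !big_ord0 poly_linear0.
  by rewrite !big_ord_recr /= addrC lF IH addrC.
exact: H.
Qed.

(* [b(t^alpha P, v)] for a polynomial [v]. *)
Definition aform u v := ip u (horner (S v)) + lambda * ip u (W v).

Lemma caputo_poly0 : S 0 = 0.
Proof.
by have := caputo_poly_linear T alpha (-1) 0 0; rewrite scaler0 addr0 scaleN1r addNr.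
Qed.

Lemma caputo_polyZ a p : S (a *: p) = a *: S p.
Proof. by have := caputo_poly_linear T alpha a p 0; rewrite caputo_poly0 !addr0. Qed.

Let combine (a x y z t l : R) : a * x + y + l * (a * z + t) = a * (x + l * z) + (y + l * t).
Proof. by ring. Qed.

Lemma aform_linearl v : poly_linear (fun p => aform (horner p) v).
Proof. by move=> a p q; rewrite /aform !ip_polyDZl // combine. Qed.

Lemma weighted_polyD a p q t : W (a *: p + q) t = a * W p t + W q t.
Proof. by rewrite /weighted_poly hornerD hornerZ; ring. Qed.

Lemma aform_linearr u : L2 u -> poly_linear (aform u).
Proof.
move=> u2 a p q; rewrite /aform caputo_poly_linear ip_polyDZr //.
have -> : W (a *: p + q) = (fun t => a * W p t + W q t).
  by apply/funext => t; exact: weighted_polyD.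
by rewrite (ipDr (L2wZ a (LW p)) (LW q) u2) (ipZr a (LW p) u2) combine.
Qed.

Lemma aform_coercive v : nm (horner (S v)) ^+ 2 <= aform (horner (S v)) v.
Proof. by rewrite nrm_sq lerDl mulr_ge0 // caputo_positive. Qed.

Lemma aform_coercive_inv p : nm (horner p) ^+ 2 <= aform (horner p) (Sinv p).
Proof. by have := aform_coercive (Sinv p); rewrite caputo_polyK. Qed.

(** A bound of the map from [S v] to [omega^(alpha, 0) v]: [T^alpha] bounds the weight, and
    [caputo_coef alpha 0] is the least of the coefficients of [S]. *)
Definition inv_bound := T `^ alpha / caputo_coef alpha 0.

Lemma inv_bound_ge0 : 0 <= inv_bound.
Proof. by rewrite divr_ge0 ?powR_ge0 // ltW. Qed.

Lemma nrm_weighted_le v : nm (W v) <= inv_bound * nm (horner (S v)).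
Proof.
have [P oP] := orth_family_exists T_gt0 alpha_ge0 (lexx 0).
apply: le_trans (nrm_W T_gt0 alpha_gt0 v) _.
rewrite /inv_bound mulrAC -mulrA; apply: ler_wpM2l; first exact: powR_ge0.
by rewrite ler_pdivlMr // mulrC (nrm_caputo_ge T_gt0 alpha_gt0 alpha_lt1 oP).
Qed.

Lemma aform_le u v : L2 u ->
  `|aform u v| <= (1 + lambda * inv_bound) * nm u * nm (horner (S v)).
Proof.
move=> u2; apply: le_trans (ler_normD _ _) _; rewrite normrM (ger0_norm lambda_ge0).
have h1 := ip_CS u2 (L (S v)); have h2 := ip_CS u2 (LW v).
have h3 := ler_wpM2l (nrm_ge0 T 0 alpha u) (nrm_weighted_le v).
have h4 := ler_wpM2l lambda_ge0 (le_trans h2 h3).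
have := lerD h1 h4.
suff -> : (1 + lambda * inv_bound) * nm u * nm (horner (S v)) =
  nm u * nm (horner (S v)) + lambda * (nm u * (inv_bound * nm (horner (S v)))) by [].
by ring.
Qed.

(** Trial and test spaces have the same dimension, so the matrix on monomials is square; coercivity,
    tested with [Sinv] of an element of its kernel, makes it injective. *)
Lemma aform_solvable n F : poly_linear F ->
  exists2 p : {poly R}, (size p <= n)%N &
    forall v, (size v <= n)%N -> aform (horner p) v = F v.
Proof.
move=> lF.
pose A : 'M[R]_n := \matrix_(i, j) aform (horner 'X^i) 'X^j.
have AE (x : 'rV[R]_n) j : (x *m A) 0 j = aform (horner (rVpoly x)) 'X^j.
  rewrite (poly_linear_monomials (aform_linearl 'X^j) (n := n)) ?size_poly // mxE.
  by apply: eq_bigr => i _; rewrite coef_rVpoly_ord mxE.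
have Afree : row_free A.
  apply: inj_row_free => x xA0.
  have h v : (size v <= n)%N -> aform (horner (rVpoly x)) v = 0.
    move=> vn; rewrite (poly_linear_monomials (aform_linearr (L _)) vn) big1 // => i _.
    by rewrite -AE xA0 mxE mulr0.
  have := aform_coercive_inv (rVpoly x); rewrite h; last first.
    by rewrite (leq_trans (size_caputo_poly_inv _ _ _)) // size_poly.
  rewrite nrm_sq => ip0; have p0 : rVpoly x = 0.
    apply: (@ip_poly_eq0 _ _ T_gt0 0 alpha) => //.
    by apply/eqP; rewrite eq_le ip0 ip_ge0.
  by apply/rowP => i; rewrite mxE -coef_rVpoly_ord p0 coef0.
pose x : 'rV[R]_n := (\row_j F 'X^j) *m invmx A.
exists (rVpoly x) => [|v vn]; first exact: size_poly.
rewrite (poly_linear_monomials (aform_linearr (L _)) vn) (poly_linear_monomials lF vn).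
apply: eq_bigr => i _; congr (_ * _).
by rewrite -AE /x mulmxKV ?mxE // -row_free_unit.
Qed.

Lemma aform_unique n p q : (size p <= n)%N -> (size q <= n)%N ->
  (forall v, (size v <= n)%N -> aform (horner p) v = aform (horner q) v) -> p = q.
Proof.
move=> pn qn pq; apply/eqP; rewrite -subr_eq0; apply/eqP.
have sn : (size (p - q)%R <= n)%N.
  by rewrite (leq_trans (size_polyD _ _)) // geq_max pn size_polyN.
have := aform_coercive_inv (p - q).
have -> : aform (horner (p - q)) (Sinv (p - q)) = 0.
  have -> : p - q = (-1) *: q + p by rewrite scaleN1r addrC.
  rewrite aform_linearl pq ?mulN1r ?addNr // (leq_trans (size_caputo_poly_inv _ _ _)) //.
  by rewrite scaleN1r addrC.
rewrite nrm_sq => h; apply: (@ip_poly_eq0 _ _ T_gt0 0 alpha) => //.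
by apply/eqP; rewrite eq_le h ip_ge0.
Qed.

(* Coercivity makes the Galerkin solution a best approximation up to a constant. *)
Lemma aform_quasi_best n u p q : L2 u -> (size p <= n)%N -> (size q <= n)%N ->
  (forall v, (size v <= n)%N -> aform (horner p) v = aform u v) ->
  nm (fun x => u x - p.[x]) <= (2 + lambda * inv_bound) * nm (fun x => u x - q.[x]).
Proof.
move=> u2 pn qn pu.
have uq := L2wB u2 (L q).
have sn : (size (q - p)%R <= n)%N.
  by rewrite (leq_trans (size_polyD _ _)) // geq_max qn size_polyN.
have n0 := nrm_ge0 T 0 alpha (fun x => u x - q.[x]).
have d_le : nm (horner (q - p)) <= (1 + lambda * inv_bound) * nm (fun x => u x - q.[x]).
  have h := aform_coercive_inv (q - p).
  have vn : (size (Sinv (q - p)) <= n)%N by rewrite (leq_trans (size_caputo_poly_inv _ _ _)).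
  (* Galerkin orthogonality: [p] may be replaced by [u] against test polynomials of size at most
     [n]. *)
  have E : aform (horner (q - p)) (Sinv (q - p)) = - aform (fun x => u x - q.[x]) (Sinv (q - p)).
    have -> : q - p = (-1) *: p + q by rewrite scaleN1r addrC.
    rewrite aform_linearl; set v := Sinv _ in vn *; rewrite pu; last by rewrite /v scaleN1r addrC.
    by rewrite /aform !ipBl //; ring.
  rewrite E in h; have := le_trans h (le_trans (ler_norm _) _).
  move=> /(_ ((1 + lambda * inv_bound) * nm (fun x => u x - q.[x]) * nm (horner (q - p)))).
  rewrite normrN => /(_ _)/wrap[].
    by have := aform_le (Sinv (q - p)) uq; rewrite caputo_polyK.
  rewrite expr2; have [-> _|z] := eqVneq (nm (horner (q - p))) 0.
    by rewrite mulr_ge0 // addr_ge0 // mulr_ge0 // inv_bound_ge0.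
  by rewrite ler_pM2r // lt_neqAle eq_sym z nrm_ge0.
have -> : nm (fun x => u x - p.[x]) = nm (fun x => (u x - q.[x]) + (q - p).[x]).
  by apply: nrm_eq => x _; rewrite hornerD hornerN; ring.
apply: le_trans (nrmD uq (L _)) _.
have -> : (2 + lambda * inv_bound) * nm (fun x => u x - q.[x]) =
  nm (fun x => u x - q.[x]) + (1 + lambda * inv_bound) * nm (fun x => u x - q.[x]) by ring.
by apply: lerD.
Qed.

(** Compares the factors [(k + 1)^(2 s)], which weigh the modes in the fractional norm, with the
    [c_k^2], which weigh them in [|S v|^2]; the growth of [c_k] suffices up to the order
    [s = alpha]. *)
Lemma Hs_norm_poly_le s : 0 < s -> s <= alpha -> exists2 C, 0 < C &
  forall v, (Hs_norm T alpha 0 s (horner v) <= (C * nm (horner (S v)))%:E)%E.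
Proof.
move=> s0 sa.
have [P oP] := orth_family_exists T_gt0 alpha_ge0 (lexx 0).
have s1 := le_lt_trans sa alpha_lt1.
pose K := 2 * (1 + alpha + 0) * ((2 - 2 * s)^-1 + (2 * s)^-1).
have K0 : 0 < K.
  have h1 : 0 < 1 + alpha + 0 by have := alpha_gt0; lra.
  have h2 : 0 < 2 - 2 * s by lra.
  by rewrite !mulr_gt0 // addr_gt0 ?invr_gt0 // mulr_gt0.
exists (Num.sqrt K / caputo_coef alpha 0); first by rewrite divr_gt0 ?sqrtr_gt0.
move=> v; apply: le_trans (Hs_norm_poly T_gt0 alpha_ge0 (lexx 0) oP s0 s1 (leqnn _)) _.
rewrite lee_fin -/K (sqrtrM _ (ltW K0)) -mulrA; apply: ler_wpM2l; first exact: sqrtr_ge0.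
rewrite [leRHS]mulrC ler_pdivlMr // -(@ler_pXn2r R 2 isT) ?nnegrE ?nrm_ge0 //; last first.
  by rewrite mulr_ge0 ?sqrtr_ge0 // ltW.
have hk k := ltW (hsq_gt0 T_gt0 alpha_ge0 (lexx 0) oP k).
rewrite exprMn sqr_sqrtr; last first.
  apply: sumr_ge0 => k _; apply: mulr_ge0; last exact: powR_ge0.
  exact: (mulr_ge0 (sqr_ge0 _) (hk k)).
rewrite nrm_sq (caputo_parseval T_gt0 alpha_gt0 alpha_lt1 oP (leqnn _)) mulr_suml.
apply: ler_sum => k _; rewrite -(mulrA (_ * hsq T alpha 0 P k)).
have w0 : 0 <= coefs T alpha 0 P (horner v) k ^+ 2 * hsq T alpha 0 P k.
  exact: (mulr_ge0 (sqr_ge0 _) (hk k)).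
suff key : (k%:R + 1) `^ (2 * s) * caputo_coef alpha 0 ^+ 2 <= caputo_coef alpha k ^+ 2.
  exact: (ler_wpM2l w0 key).
have lb0 : 0 <= caputo_coef alpha 0 * k.+1%:R `^ alpha.
  by apply: mulr_ge0; [exact: ltW|exact: powR_ge0].
have ub0 := ltW (caputo_coef_gt0 alpha_gt0 alpha_lt1 k).
apply: (@le_trans _ _ ((caputo_coef alpha 0 * k.+1%:R `^ alpha) ^+ 2)).
  have le : (k%:R + 1) `^ (2 * s) <= (k.+1%:R `^ alpha) ^+ 2 :> R.
    rewrite -powR_mulrn ?powR_ge0 // -powRrM mulrC natr1.
    by apply: ler_powR; rewrite ?ler1n // mulrC (mulrC alpha) ler_wpM2l.
  have -> : (caputo_coef alpha 0 * k.+1%:R `^ alpha) ^+ 2 =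
     (k.+1%:R `^ alpha) ^+ 2 * caputo_coef alpha 0 ^+ 2 by ring.
  exact: (ler_wpM2r (sqr_ge0 _) le).
have lb := caputo_coef_lb alpha_gt0 alpha_lt1 k.
by rewrite (@ler_pXn2r R 2 isT _ _ lb0 ub0).
Qed.

Section functional.
Variables (r : R) (f : (R -> R) -> R).
Hypothesis r_ge : - alpha <= r.
Hypothesis fr : in_Hr T alpha 0 r f.
Local Notation F := (fun p : {poly R} => f (horner p)).

Let r_neg : r < 0 -> 0 < - r /\ - r <= alpha.
Proof. by move=> h; rewrite oppr_gt0 h lerNl. Qed.

(** For [r < 0] linearity is part of membership in [H^r], once polynomials are known to lie in
    [H^(-r)], which is where [- r <= alpha] enters; for [r >= 0] it is that of the inner product
    with a representative [g]. *)
Lemma functional_linear : poly_linear F.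
Proof.
move=> a p q; rewrite horner_lin; have [rlt|r0] := ltP r 0.
  have [s0 sa] := r_neg rlt.
  have [C _ HC] := Hs_norm_poly_le s0 sa.
  have HH v : Hs T alpha 0 (- r) (horner v) by apply: le_lt_trans (HC v) _; exact: ltey.
  exact: (fr.1 rlt).
have := fr.2; rewrite /Hr_norm (ltNge r 0) r0 /= => /ereal_inf_lt[_ [g [mg gf] <-] gy].
have [c _ cw] := wnorm_le_Hs T alpha 0 r0.
have [M gM] : exists M, (Hs_norm T alpha 0 r g < M%:E)%E.
  case: (Hs_norm T alpha 0 r g) gy => [x|//|] _; last by exists 0; rewrite ltNye.
  by exists (x + 1); rewrite lte_fin ltrDl.
have gL : L2w T alpha 0 g.
  by apply: wnorm_lty => //; apply: le_lt_trans (cw _ _ gM) _; exact: ltey.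
have LL v : L2w T alpha 0 (horner v) by exact: L2w_poly.
rewrite -horner_lin !gf; try exact/wL2P.
exact: ip_polyDZr.
Qed.

(** The dual norm tests the unit ball only, so [v] is rescaled by its bound [C |S v|]; when this
    bound is zero, [v = 0] because [S] is injective. *)
Lemma functional_le s M : 0 < s -> s <= alpha -> (Hr_norm T alpha 0 (- s) f <= M%:E)%E ->
  forall C, 0 < C ->
  (forall v, (Hs_norm T alpha 0 s (horner v) <= (C * nm (horner (S v)))%:E)%E) ->
  forall v, `|F v| <= C * M * nm (horner (S v)).
Proof.
move=> s0 sa fM C C0 HC v; have lF := functional_linear.
have n0 := nrm_ge0 T 0 alpha (horner (S v)).
have [z|z] := eqVneq (nm (horner (S v))) 0.
  rewrite z mulr0; suff -> : v = 0 by rewrite (poly_linear0 lF) normr0.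
  have S0 : S v = 0.
    apply: (@ip_poly_eq0 _ _ T_gt0 0 alpha) => //.
    by rewrite -nrm_sq z expr0n.
  by apply: (can_inj (caputo_poly_invK T alpha_gt0 alpha_lt1)); rewrite S0 caputo_poly0.
have np : 0 < nm (horner (S v)) by rewrite lt_neqAle eq_sym z.
pose k := (C * nm (horner (S v)))^-1.
have k0 : 0 < k by rewrite invr_gt0 mulr_gt0.
have nk : nm (horner (S (k *: v))) = k * nm (horner (S v)).
  rewrite caputo_polyZ -[k in RHS](gtr0_norm k0) -nrmZ //; apply: nrm_eq => x _.
  by rewrite hornerZ.
have H1 : (Hs_norm T alpha 0 (- - s) (horner (k *: v)) <= 1)%E.
  rewrite opprK; apply: le_trans (HC _) _; rewrite nk lee_fin mulrCA.
  by rewrite /k mulVf // mulf_neq0 // lt0r_neq0.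
have : (`|f (horner (k *: v))|%:E <= M%:E)%E.
  apply: le_trans fM; rewrite /Hr_norm oppr_lt0 s0; apply: ereal_sup_ubound.
  by exists (horner (k *: v)).
rewrite lee_fin (poly_linearZ k v lF) normrM (gtr0_norm k0) /k mulrC.
by rewrite ler_pdivrMr ?mulr_gt0 // mulrCA mulrA.
Qed.

(** For [r < 0] the supremum could be [-oo] over an empty set; the zero polynomial lies in the unit
    ball. *)
Lemma Hr_norm_ge0 : (0 <= Hr_norm T alpha 0 r f)%E.
Proof.
rewrite /Hr_norm; case: ltP => [rlt|r0].
  have [s0 sa] := r_neg rlt.
  have [C C0 HC] := Hs_norm_poly_le s0 sa.
  apply: le_ereal_sup_tmp; exists `|f (horner 0)|%:E; last by rewrite lee_fin.
  exists (horner 0) => //=; apply: le_trans (HC 0) _.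
  rewrite lee_fin (_ : nm _ = 0) ?mulr0 //.
  have lF : poly_linear (fun p => ip (horner p) (horner (S 0))).
    by move=> a p q; rewrite ip_polyDZl.
  by rewrite /nrm {1}caputo_poly0 (poly_linear0 lF) sqrtr0.
apply: le_ereal_inf_tmp => _ [g _ <-]; rewrite /Hs_norm.
by case: ifP => _; [exact: Hnat_norm_ge0|exact: sqrte_ge0].
Qed.

(** For [r >= 0] the norm is an infimum over representatives: those of norm below [d], for arbitrary
    [d > 0], make [F v] as small as desired. *)
Lemma functional_eq0 : Hr_norm T alpha 0 r f = 0%E -> forall v, F v = 0.
Proof.
move=> f0 v; apply/eqP; rewrite -normr_le0.
have [rlt|r0] := ltP r 0.
  have [s0 sa] := r_neg rlt.
  have [C C0 HC] := Hs_norm_poly_le s0 sa.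
  have fM : (Hr_norm T alpha 0 (- - r) f <= 0%:E)%E by rewrite opprK f0.
  by have := functional_le s0 sa fM C0 HC v; rewrite mulr0 mul0r.
have [c c0 cw] := wnorm_le_Hs T alpha 0 r0.
have LL p : L2w T alpha 0 (horner p) by exact: L2w_poly.
have n0 := nrm_ge0 T alpha 0 (horner v).
apply/ler_addgt0Pr => e e0; rewrite add0r.
pose d := e / (c * (nrm T alpha 0 (horner v) + 1)).
have v1 : 0 < nrm T alpha 0 (horner v) + 1 by rewrite ltr_wpDl.
have d0 : 0 < d by rewrite divr_gt0 // mulr_gt0.
have : (Hr_norm T alpha 0 r f < d%:E)%E by rewrite f0 lte_fin.
rewrite /Hr_norm (ltNge r 0) r0 /= => /ereal_inf_lt[_ [g [mg gf] <-] gd].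
have gL : L2w T alpha 0 g.
  by apply: wnorm_lty => //; apply: le_lt_trans (cw _ _ gd) _; exact: ltey.
have gle : nrm T alpha 0 g <= c * d by rewrite -lee_fin -(wnormE gL) cw.
rewrite gf; last exact/wL2P.
apply: le_trans (ip_CS gL (LL v)) _.
apply: (@le_trans _ _ (c * d * (nrm T alpha 0 (horner v) + 1))).
  by apply: ler_pM => //; [exact: nrm_ge0|rewrite lerDl].
rewrite le_eqVlt; apply/orP; left; apply/eqP; rewrite /d; field.
by rewrite !lt0r_neq0.
Qed.

End functional.

Definition lift p : R -> R := fun t => t `^ alpha * p.[t].

Lemma omega_lift p t : D t -> omega T 0 (- alpha) t * lift p t = p.[t].
Proof.
move=> /domP[t0 _]; rewrite /omega /lift powRr0 mul1r mulrA -powRD_gt0 //.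
by rewrite addNr powRr0 mul1r.
Qed.

Lemma wnorm_omega u : wnorm T 0 (- alpha) u = wnorm T 0 alpha (fun t => omega T 0 (- alpha) t * u t).
Proof.
rewrite /wnorm; congr sqrte; apply: eq_integral => t; rewrite inE => /domP[t0 _]; congr _%:E.
have E : t `^ alpha * (t `^ (- alpha)) ^+ 2 = t `^ (- alpha).
  by rewrite expr2 mulrA -powRD_gt0 // subrr powRr0 mul1r.
by rewrite /omega !powRr0 !mul1r exprMn (mulrA (t `^ alpha)) E.
Qed.

Lemma bform_lift p v : bform T alpha lambda (lift p) (horner v) = aform (horner p) v.
Proof.
have E t : D t -> omega T 0 (- alpha) t * lift p t = p.[t] by exact: omega_lift.
rewrite bform_poly //; last by apply: L2w_eq (L p) => t /E.
by rewrite /aform; congr (_ + _ * _); apply: ip_eq.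
Qed.

Lemma discrete_solutionP f N uN : discrete_solution T alpha lambda f N uN <->
  exists p, [/\ (size p <= N.+1)%N, uN = lift p &
    forall v, (size v <= N.+1)%N -> aform (horner p) v = f (horner v)].
Proof.
split=> [[[_ [p [pN ->]] ->] h]|[p [pN -> h]]].
  exists p; split=> // v vN; rewrite -bform_lift; apply: h; by exists v.
split; first by exists (horner p) => //; exists p.
by move=> _ [v [vN ->]]; rewrite bform_lift h.
Qed.

Lemma wnorm_lift p : wnorm T 0 (- alpha) (lift p) = (nm (horner p))%:E.
Proof.
rewrite wnorm_omega -(wnormE (L p)) /wnorm; congr sqrte; apply: eq_integral => t.
by rewrite inE => /omega_lift ->.
Qed.

Lemma weak_solution_poly f u : weak_solution T alpha lambda f u ->
  L2 (fun t => omega T 0 (- alpha) t * u t) /\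
  forall v, aform (fun t => omega T 0 (- alpha) t * u t) v = f (horner v).
Proof.
move=> [[mu_ uy] uf].
have uL : L2 (fun t => omega T 0 (- alpha) t * u t).
  apply: wnorm_lty; last by rewrite -wnorm_omega.
  by apply: measurable_funM => //; exact: omega_measurable.
split => // v.
have [C C0 HC] := Hs_norm_poly_le alpha_gt0 (lexx alpha).
have Hv : Hs T alpha 0 alpha (horner v) by apply: le_lt_trans (HC v) _; exact: ltey.
by rewrite -(uf _ Hv) (bform_poly T_gt0 alpha_gt0 alpha_lt1 lambda v uL).
Qed.

Lemma wnorm_sub_lift u p : L2 (fun t => omega T 0 (- alpha) t * u t) ->
  wnorm T 0 (- alpha) (u \- lift p) =
  (nm (fun t => omega T 0 (- alpha) t * u t - p.[t]))%:E.
Proof.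
move=> uL; rewrite wnorm_omega -(wnormE (L2wB uL (L p))) /wnorm; congr sqrte.
apply: eq_integral => t; rewrite inE => Dt; congr _%:E.
by rewrite /= mulrBr omega_lift.
Qed.

(** The zero polynomial solves the discrete problem in every degree, so quasi-optimality bounds
    [|u|] by a multiple of its distance to any polynomial. *)
Lemma nrm_eq0_of_dense u : L2 u -> (forall v, aform u v = 0) -> nm u = 0.
Proof.
move=> u2 u0; apply/eqP; rewrite eq_le nrm_ge0 andbT.
have k0 : 0 < 2 + lambda * inv_bound by rewrite ltr_pwDl // mulr_ge0 // inv_bound_ge0.
apply/ler_addgt0Pr => e e0; rewrite add0r.
have [q qe] := poly_dense T_gt0 (lexx 0) alpha_ge0 u2 (divr_gt0 e0 k0).
have z : (size (0%R : {poly R}) <= size q)%N by rewrite size_poly0.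
have := aform_quasi_best u2 z (leqnn (size q)) _.
have E : nm (fun x => u x - 0.[x]) = nm u by apply: nrm_eq => x _; rewrite horner0 subr0.
rewrite E => /(_ _)/wrap[].
  by move=> v _; rewrite u0 (poly_linear0 (aform_linearl v)).
move=> /le_trans; apply; apply: le_trans (ler_wpM2l (ltW k0) qe) _.
by rewrite mulrC divfK // gt_eqF.
Qed.

End petrov_galerkin.



Theorem theorem5p1 (R : realType) (alpha T lambda : R)
    (alpha_gt0 : 0 < alpha) (alpha_lt1 : alpha < 1) (T_gt0 : 0 < T)
    (lambda_ge0 : 0 <= lambda) :
  exists (N0 : nat) (C : R),
  forall (r : R) (f : (R -> R) -> R),
    - alpha <= r -> in_Hr T alpha 0 r f -> in_Hminus T alpha 0 (alpha / 2) f ->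
    (forall N : nat, (N0 <= N)%N ->
       exists2 uN : R -> R, unique (discrete_solution T alpha lambda f N) uN &
         (wnorm T 0%R (- alpha)%R uN <= C%:E * Hr_norm T alpha 0%R (- alpha)%R f)%E) /\
    (forall (u : R -> R) (m : R),
       weak_solution T alpha lambda f u ->
       0 <= m -> Hs T 0 alpha m (fun t => omega T 0 (- alpha) t * u t) ->
       exists C' : R,
       forall N : nat, (N0 <= N)%N ->
       forall uN : R -> R, discrete_solution T alpha lambda f N uN ->
         (wnorm T 0%R (- alpha)%R (u \- uN)%R <=
            (C' * N%:R `^ (- m))%:E * Hr_norm T alpha 0%R r f)%E).
Proof.
have alpha_ge0 := ltW alpha_gt0.
have L p : L2w T 0 alpha (horner p) by exact: L2w_poly.
have [C C0 HC] := Hs_norm_poly_le alpha_gt0 alpha_lt1 T_gt0 alpha_gt0 (lexx alpha).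
(* The threshold [1] comes from Jackson's estimate, applied with polynomials of size at most [N].
   [C] compares the norm of order [alpha] with [|S v|], so it depends on neither [r] nor [f]. *)
exists 1%N, C => r f r_ge fr _.
have lF := functional_linear alpha_gt0 alpha_lt1 T_gt0 r_ge fr.
split=> [N N1|u m usol m0 um].
  have [p pN pf] := aform_solvable alpha_gt0 alpha_lt1 T_gt0 lambda_ge0 N.+1 lF.
  exists (lift alpha p).
    split; first by apply/discrete_solutionP => //; exists p.
    move=> _ /discrete_solutionP[//|//|//|q [qN -> qf]]; congr lift.
    apply: (aform_unique alpha_gt0 alpha_lt1 T_gt0 lambda_ge0 pN qN) => v vN.
    by rewrite pf // qf.
  rewrite wnorm_lift //.
  have := @Hr_norm_ge0 _ _ _ alpha_gt0 alpha_lt1 T_gt0 (- alpha) f (lexx _).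
  (* An infinite norm makes the bound trivial, because [C > 0]. *)
  case Hf : (Hr_norm T alpha 0 (- alpha) f) => [M| |] // M0; last first.
    by rewrite gt0_muley ?leey // lte_fin.
  rewrite lee_fin in M0; rewrite -EFinM lee_fin.
  have fM : (Hr_norm T alpha 0 (- alpha) f <= M%:E)%E by rewrite Hf.
  (* The test polynomial is [v = Sinv p]: coercivity gives [|p|^2 <= f(v) <= C M |p|], and one
     factor [|p|] is cancelled. *)
  have := functional_le alpha_gt0 alpha_lt1 T_gt0 r_ge fr alpha_gt0 (lexx alpha) fM C0 HC.
  move=> /(_ (caputo_poly_inv T alpha p)); rewrite (caputo_polyK T alpha_gt0 alpha_lt1) => h.
  have pN' : (size (caputo_poly_inv T alpha p) <= N.+1)%N.
    by rewrite (leq_trans (size_caputo_poly_inv _ _ _)).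
  have c := aform_coercive_inv alpha_gt0 alpha_lt1 T_gt0 lambda_ge0 p.
  rewrite pf // in c; have := le_trans c (le_trans (ler_norm _) h).
  have [-> _|z] := eqVneq (nrm T 0 alpha (horner p)) 0; first by rewrite mulr_ge0 // ltW.
  by rewrite expr2 ler_pM2r // lt_neqAle eq_sym z nrm_ge0.
have [uL uf] := weak_solution_poly alpha_gt0 alpha_lt1 T_gt0 usol.
set P := (fun t => _) in uL uf um.
have Hge := Hr_norm_ge0 alpha_gt0 alpha_lt1 T_gt0 f r_ge.
(* When [f] has norm zero the right-hand side is [0], so the error itself must vanish: the discrete
   solution is [0], and the transformed solution [P] has norm zero. *)
have [Hz|Hnz] := eqVneq (Hr_norm T alpha 0 r f) 0%E.
  exists 0 => N N1 _ /discrete_solutionP[//|//|//|p [pN -> pf]].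
  have f0 := functional_eq0 alpha_gt0 alpha_lt1 T_gt0 r_ge fr Hz.
  have p0 : p = 0.
    apply: (aform_unique alpha_gt0 alpha_lt1 T_gt0 lambda_ge0 pN (n := N.+1)).
      by rewrite size_poly0.
    move=> v vN; rewrite pf // f0.
    by rewrite (poly_linear0 (aform_linearl lambda alpha_gt0 T_gt0 v)).
  rewrite Hz mule0 wnorm_sub_lift // p0 lee_fin.
  have P0 := nrm_eq0_of_dense alpha_gt0 alpha_lt1 T_gt0 lambda_ge0 uL (fun v => etrans (uf v) (f0 v)).
  suff -> : nrm T 0 alpha (fun t => P t - 0.[t]) = nrm T 0 alpha P by rewrite P0.
  by apply: nrm_eq => x _; rewrite horner0 subr0.
have [c c0 J] := Hs_approximation T_gt0 (lexx 0) alpha_ge0 m0 um.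
have := fr.2; case Hf : (Hr_norm T alpha 0 r f) Hge Hnz => [rho| |] // rho0 rhonz _.
have {}rho0 : 0 < rho by rewrite lt_neqAle -lee_fin rho0 andbT eq_sym; apply: contra rhonz => /eqP ->.
(* [C'] may depend on [u] and [f]: the norm of [f] is restored by dividing by [rho], while the rate
   comes from the regularity of [P] alone. *)
exists ((2 + lambda * inv_bound alpha T) * c / rho) => N N1 _ /discrete_solutionP[//|//|//|p [pN -> pf]].
have [q qN qe] := J N N1.
rewrite wnorm_sub_lift // -EFinM lee_fin.
have qN' : (size q <= N.+1)%N by rewrite (leq_trans qN).
have pu (v : {poly R}) : (size v <= N.+1)%N -> aform alpha T lambda (horner p) v = aform alpha T lambda P v.
  by move=> vN; rewrite pf // uf.
apply: le_trans (aform_quasi_best alpha_gt0 alpha_lt1 T_gt0 lambda_ge0 uL pN qN' pu) _.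
have k0 : 0 <= 2 + lambda * inv_bound alpha T.
  by rewrite addr_ge0 // mulr_ge0 // inv_bound_ge0.
apply: le_trans (ler_wpM2l k0 qe) _.
rewrite le_eqVlt; apply/orP; left; apply/eqP; field.
exact: lt0r_neq0.
Qed.
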